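(* Let $E$ be a complex Banach lattice and let $(e^{tA})_{t \in [0,\infty)}$ be a uniformly eventually positive $C_0$-semigroup on $E$ with $s(A) > -\infty$. Then the semigroup is uniformly exponentially balancing if and only if the following three conditions hold: (i) the semigroup $(e^{tA})_{t \in [0,\infty)}$ is norm continuous at infinity; (ii) the rescaled semigroup $(e^{t(A - s(A)I)})_{t \in [0,\infty)}$ is bounded; (iii) the spectral bound $s(A)$ is a pole of the resolvent of $A$.
   Context: A $C_0$-semigroup $(e^{tA})_{t\ge 0}$ on a complex Banach lattice $E$ is uniformly eventually positive if there exists $t_0 \ge 0$ such that $e^{tA}$ is a positive operator for every $t \ge t_0$. $s(A) := \sup\{\operatorname{Re}\lambda : \lambda \in \sigma(A)\}$ is the spectral bound and $\omega_0(A)$ the growth bound. The semigroup is norm continuous at infinity if $\omega_0(A) > -\infty$ and $S(t) := e^{t(A-\omega_0(A)I)}$ satisfies $\limsup_{s \to 0} \|S(t) - S(t+s)\| \to 0$ as $t \to \infty$. The semigroup is uniformly exponentially balancing if $s(A) > -\infty$ and the rescaled semigroup $(e^{t(A - s(A)I)})_{t\ge 0}$ converges in operator norm as $t \to \infty$. *)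

(* Defs.v *)
From HB Require Import structures.
From mathcomp Require Import all_boot all_order all_algebra.
From mathcomp Require Import all_classical all_reals all_analysis.
From mathcomp Require Import complex.
Set Implicit Arguments. Unset Strict Implicit. Unset Printing Implicit Defensive.
Import Order.TTheory GRing.Theory Num.Theory.
Import numFieldNormedType.Exports.
Local Open Scope classical_set_scope.
Local Open Scope ring_scope.
Local Open Scope complex_scope.

Section Defs.
Variables (R : realType) (V : completeNormedModType R[i]).

Definition nrm (x : V) : R := complex.Re `|x|.

Definition is_linear (f : V -> V) : Prop :=
  forall (a : R[i]) (x y : V), f (a *: x + y) = a *: f x + f y.

Definition is_bounded (f : V -> V) : Prop :=
  exists M : R, forall x, nrm (f x) <= M * nrm x.

Definition bdd_linear (f : V -> V) : Prop := is_linear f /\ is_bounded f.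

Definition opnorm (f : V -> V) : \bar R :=
  ereal_sup [set (nrm (f x))%:E | x in [set x | nrm x <= 1]].

(* V is the complexification Er + i Er of a real Banach lattice (Er, P):
   Er is the real part, P its positive cone, the order on Er is
   x <= y iff y - x \in P, and the complex norm is
   ||x + i y|| = || sup_theta |x cos theta + y sin theta| ||. *)
Definition lat_le (P : set V) (x y : V) : Prop := P (y - x).

Definition is_lub_in (Er P : set V) (S : set V) (m : V) : Prop :=
  Er m /\ (forall u, S u -> lat_le P u m) /\
  (forall b, Er b -> (forall u, S u -> lat_le P u b) -> lat_le P m b).

Definition is_modulus (Er P : set V) (x a : V) : Prop :=
  is_lub_in Er P [set x; - x] a.

Definition complex_banach_lattice (Er P : set V) : Prop :=
  [/\ [/\ Er 0, (forall x y, Er x -> Er y -> Er (x + y)) &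
      (forall (r : R) x, Er x -> Er (r%:C *: x))],
      (forall z, exists x y, [/\ Er x, Er y & z = x + 'i *: y]) /\
      (forall x y, Er x -> Er y -> x + 'i *: y = 0 -> x = 0 /\ y = 0),
      [/\ P `<=` Er, (forall x y, P x -> P y -> P (x + y)),
          (forall (r : R) x, 0 <= r -> P x -> P (r%:C *: x)) &
          (forall x, P x -> P (- x) -> x = 0)],
      (forall x y, Er x -> Er y -> exists m, is_lub_in Er P [set x; y] m) &
      [/\
      (forall x y a b, Er x -> Er y -> is_modulus Er P x a ->
         is_modulus Er P y b -> lat_le P a b -> nrm x <= nrm y) &
      (forall x y, Er x -> Er y -> exists m,
         is_lub_in Er P
           [set u | exists theta : R,
              is_modulus Er P ((cos theta)%:C *: x + (sin theta)%:C *: y) u] m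
         /\ nrm (x + 'i *: y) = nrm m)]].

Definition positive_op (P : set V) (f : V -> V) : Prop :=
  forall x, P x -> P (f x).

(* T t is only meaningful for t >= 0. *)
Definition C0_semigroup (T : R -> V -> V) : Prop :=
  [/\ (forall t, 0 <= t -> bdd_linear (T t)),
      (forall x, T 0 x = x),
      (forall t s x, 0 <= t -> 0 <= s -> T (t + s) x = T t (T s x)) &
      (forall x (t0 : R), 0 <= t0 ->
         (fun t => T t x) @ (within (fun t => 0 <= t) (nbhs t0)) --> T t0 x)].

(* graph of the generator A: x \in D(A) and A x = y *)
Definition generator (T : R -> V -> V) (x y : V) : Prop :=
  (fun h : R => (h%:C)^-1 *: (T h x - x)) @ 0^'+ --> y.

Definition is_resolvent (T : R -> V -> V) (l : R[i]) (Rl : V -> V) : Prop :=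
  [/\ bdd_linear Rl,
      (forall y, generator T (Rl y) (l *: Rl y - y)) &
      (forall x y, generator T x y -> Rl (l *: x - y) = x)].

Definition resolvent_set (T : R -> V -> V) : set R[i] :=
  [set l | exists Rl, is_resolvent T l Rl].

Definition spectrum (T : R -> V -> V) : set R[i] := ~` resolvent_set T.

Definition spectral_bound (T : R -> V -> V) : \bar R :=
  ereal_sup [set (complex.Re l)%:E | l in spectrum T].

Definition growth_bound (T : R -> V -> V) : \bar R :=
  ereal_inf [set w%:E | w in [set w : R | exists M : R, forall t, 0 <= t ->
     (opnorm (T t) <= (M * expR (w * t))%:E)%E]].

Definition rescaled (T : R -> V -> V) (w : R) : R -> V -> V :=
  fun t x => (expR (- (w * t)))%:C *: T t x.

Definition norm_continuous_at_infinity (T : R -> V -> V) : Prop :=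
  (-oo < growth_bound T)%E /\
  let S := rescaled T (fine (growth_bound T)) in
  forall eps : R, 0 < eps -> exists t0 : R, forall t, t0 <= t ->
    exists delta : R, 0 < delta /\ forall s : R, `|s| < delta -> 0 <= t + s ->
      (opnorm (fun x => (S t x - S (t + s) x)%R) <= eps%:E)%E.

Definition unif_exp_balancing (T : R -> V -> V) : Prop :=
  (-oo < spectral_bound T)%E /\
  let S := rescaled T (fine (spectral_bound T)) in
  exists Q : V -> V, bdd_linear Q /\
    (fun t => opnorm (fun x => S t x - Q x)) @ +oo --> (0 : \bar R)%E.

Definition bounded_semigroup (S : R -> V -> V) : Prop :=
  exists M : R, forall t, 0 <= t -> (opnorm (S t) <= M%:E)%E.

(* l0 is a pole of the resolvent: l0 \in sigma(A), and in a punctured disc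
   around l0 the resolvent has a norm-convergent Laurent expansion
   R(l) = sum_{n >= -k} (l - l0)^n U_n with finitely many negative terms. *)
Definition pole_of_resolvent (T : R -> V -> V) (l0 : R[i]) : Prop :=
  spectrum T l0 /\
  exists (r : R) (k : nat) (U : nat -> V -> V), 0 < r /\
    (forall n, bdd_linear (U n)) /\
    forall l : R[i], 0 < `|l - l0| -> `|l - l0| < r%:C ->
      exists Rl, is_resolvent T l Rl /\
        (fun N : nat => opnorm (fun x =>
           Rl x - \sum_(n < N) ((l - l0) ^ (n%:Z - k%:Z)) *: U n x))
        @ \oo --> (0 : \bar R)%E.

Definition unif_eventually_positive (P : set V) (T : R -> V -> V) : Prop :=
  exists t0 : R, 0 <= t0 /\ forall t, t0 <= t -> positive_op P (T t).

End Defs.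

(* Main.v *)
(* After rescaling, s(A) = 0.

   If e^{tA} converges in norm to Q, then Q is a projection fixed by the semigroup,
   which gives (i) and (ii). For large L the operator e^{LA} - Q is a contraction, so A
   is boundedly invertible on ker Q and R(z) = Q / z + R0 (1 + z R0)^-1 has a simple
   pole at 0; 0 is a spectral value, as Q = 0 would give exponential decay.

   Conversely, boundedness gives z R(z) = O(1) as z -> 0+, so the pole is simple and its
   residue Q is the mean ergodic projection. To get e^{tA} -> Q it is enough to bound
   1 - e^{is} e^{tau A} from below on ker Q, for one small tau and uniformly in the real
   number s: the coefficients of the square of a geometric sum then show that the powers
   of e^{tau A} on ker Q are O(1/n). If there is no such bound, norm continuity at
   infinity turns approximate eigenvectors of e^{tau A} into approximate eigenvectors
   y = a + ib of A for some ig with g real. For g = 0 this contradicts the mean ergodic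
   theorem. For g <> 0 the semigroup rotates the real parts of e^{is} y. Let M be their
   supremum over finitely many equally spaced angles s; the parts of these vectors close
   to M are disjoint and are moved onto each other by positive operators that move
   them only little, by norm continuity. So these parts are small, whereas positivity
   keeps Q M, and hence their sum, away from 0. *)
Require Import Defs.
From HB Require Import structures.
From mathcomp Require Import all_boot all_order all_algebra.
From mathcomp Require Import all_classical all_reals all_analysis.
From mathcomp Require Import complex.
From mathcomp Require Import ring lra zify.
Import Order.TTheory GRing.Theory Num.Theory.
Import numFieldNormedType.Exports.
Local Open Scope classical_set_scope.
Local Open Scope ring_scope.

(** Norm continuity only compares the semigroup at late times that are close together, so a rotation
    by [g] has to be refuted within a time window [dt]. The circle is cut into [4 * k] angles such
    that two steps, of duration [h] each, fit into [dt]. Every fourth peak is put into one group: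
    after [J] steps, with [4] dividing [J], a group returns to itself, and two steps later it covers
    a group disjoint from it, although the operators at these two times differ by at most [eps]. The
    obstacle is the order of the choices: [eps] determines [dt] and [dt] determines [k], so no
    estimate that carries [eps] may grow with [k]. Disjointness achieves this: a group lies below
    [(1 - cos step) M] and not merely below [k] times that, and the same factor in front of [Q M]
    cancels. Errors that grow with [k] come only from the quality of the eigenvector, which is
    chosen last. The geometric sum is squared because bounded geometric sums alone yield bounded
    powers; in the square the power of order [j] occurs [j + 1] times. *)

(** * Linear combinations by reflection *)

Inductive lexp (K : Type) : Type :=
  | LAtom of nat | LZero | LAdd of lexp K & lexp K | LOpp of lexp K
  | LScale of K & lexp K.

Fixpoint leval (K : comPzRingType) (V : lmodType K) (env : seq V) (e : lexp K) : V :=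
  match e with
  | LAtom n => env`_n
  | LZero => 0
  | LAdd a b => leval K V env a + leval K V env b
  | LOpp a => - leval K V env a
  | LScale k a => k *: leval K V env a
  end.

Fixpoint lcoef (K : comPzRingType) (e : lexp K) (n : nat) : K :=
  match e with
  | LAtom m => if eqn m n then 1 else 0
  | LZero => 0
  | LAdd a b => lcoef K a n + lcoef K b n
  | LOpp a => - lcoef K a n
  | LScale k a => k * lcoef K a n
  end.

(** A conjunction built by recursion over the atoms, so that computation leaves one coefficient
    equation per atom. *)
Fixpoint lsame (K : comPzRingType) (e1 e2 : lexp K) (n : nat) : Prop :=
  match n with
  | 0 => True
  | n'.+1 => lcoef K e1 n' = lcoef K e2 n' /\ lsame K e1 e2 n'
  end.

Lemma leval_sum (K : comPzRingType) (V : lmodType K) (env : seq V) (e : lexp K) :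
  leval K V env e = \sum_(i < size env) lcoef K e i *: env`_i.
Proof.
elim: e => [n||a IHa b IHb|a IHa|k a IHa] /=.
- have [ltn|len] := ltnP n (size env).
    rewrite (bigD1 (Ordinal ltn)) //= (_ : eqn n n = true) ?eqnE ?eqxx // scale1r.
    rewrite big1 ?addr0 // => i /eqP neq; rewrite ifF ?scale0r //.
    by apply/negbTE/eqP => eqni; apply: neq; apply: val_inj.
  (* An atom outside the environment evaluates to [0] and meets no index of the sum. *)
  rewrite nth_default // big1 // => i _; rewrite ifF ?scale0r //.
  by apply/negbTE; rewrite eqnE; apply: contraTneq (ltn_ord i) => <-; rewrite -leqNgt.
- by rewrite big1 // => i _; rewrite scale0r.
- by rewrite IHa IHb -big_split; apply: eq_bigr => i _; rewrite scalerDl.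
- by rewrite IHa -sumrN; apply: eq_bigr => i _; rewrite scaleNr.
- by rewrite IHa scaler_sumr; apply: eq_bigr => i _; rewrite scalerA.
Qed.

Lemma leval_eq (K : comPzRingType) (V : lmodType K) (env : seq V) (e1 e2 : lexp K) :
  lsame K e1 e2 (size env) -> leval K V env e1 = leval K V env e2.
Proof.
move=> h; rewrite !leval_sum; apply: eq_bigr => i _; congr (_ *: _).
elim: (size env) h (nat_of_ord i) (ltn_ord i) => // n IH /= [hn hs] j.
by rewrite ltnS leq_eqVlt => /orP [/eqP ->|] //; apply: IH.
Qed.

Ltac lmod_mem x l :=
  lazymatch l with
  | nil => false
  | cons x _ => true
  | cons _ ?l' => lmod_mem x l'
  end.

Ltac lmod_atoms e l :=
  lazymatch e with
  | @Algebra.zero _ => l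
  | @Algebra.add _ ?a ?b => let l1 := lmod_atoms a l in lmod_atoms b l1
  | @Algebra.opp _ ?a => lmod_atoms a l
  | @GRing.scale _ _ _ ?a => lmod_atoms a l
  | _ => let b := lmod_mem e l in
         lazymatch b with true => l | false => constr:(cons e l) end
  end.

Ltac lmod_index x l :=
  lazymatch l with
  | cons x _ => constr:(O)
  | cons _ ?l' => let n := lmod_index x l' in constr:(S n)
  end.

Ltac lmod_reify K e l :=
  lazymatch e with
  | @Algebra.zero _ => constr:(LZero K)
  | @Algebra.add _ ?a ?b =>
      let a' := lmod_reify K a l in let b' := lmod_reify K b l in
      constr:(LAdd K a' b')
  | @Algebra.opp _ ?a => let a' := lmod_reify K a l in constr:(LOpp K a')
  | @GRing.scale _ _ ?k ?a => let a' := lmod_reify K a l in constr:(LScale K k a')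
  | _ => let n := lmod_index e l in constr:(LAtom K n)
  end.

(* Identities between linear combinations: both sides are reified and their
   coefficients compared by [ring] (or handed back to the user). *)
Ltac lmod_with K V tac :=
  lazymatch goal with
  | |- ?x = ?y =>
    let l0 := lmod_atoms x (@nil V) in
    let l := lmod_atoms y l0 in
    let ex := lmod_reify K x l in
    let ey := lmod_reify K y l in
    apply: (leval_eq _ V l ex ey); cbn [lsame lcoef eqn size]; repeat split; tac
  end.

Set Implicit Arguments. Unset Strict Implicit. Unset Printing Implicit Defensive.
Local Open Scope complex_scope.

(** * Norms, limits and bounded operators *)

Section Norm.
Variables (R : realType) (V : completeNormedModType R[i]).
Implicit Types (x y z : V) (a b : R[i]) (r : R).

Definition cabs (a : R[i]) : R := complex.Re `|a|.

Lemma ge0_ReE a : 0 <= a -> a = (complex.Re a)%:C.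
Proof. by case: a => u v; rewrite lecE /= => /andP [/eqP -> _]. Qed.

Lemma nrmE x : `|x| = (nrm x)%:C.
Proof. exact: ge0_ReE. Qed.

Lemma cabsE a : `|a| = (cabs a)%:C.
Proof. exact: ge0_ReE. Qed.

Lemma nrm_ge0 x : 0 <= nrm x.
Proof. by rewrite -(ler0c (nrm x)) -nrmE. Qed.
Hint Resolve nrm_ge0 : core.

Lemma cabs_ge0 a : 0 <= cabs a.
Proof. by rewrite -(ler0c (cabs a)) -cabsE. Qed.

Lemma realc_inj r r' : r%:C = r'%:C -> r = r'.
Proof. by case. Qed.

Lemma nrm_le r x : (nrm x <= r) = (`|x| <= r%:C).
Proof. by rewrite nrmE lecR. Qed.

Lemma cabs_real r : cabs r%:C = `|r|.
Proof. by rewrite /cabs normc_def /= expr0n addr0 sqrtr_sqr. Qed.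

Lemma cabsM a b : cabs (a * b) = cabs a * cabs b.
Proof. by apply: realc_inj; rewrite -cabsE normrM !cabsE -rmorphM. Qed.

Lemma nrmZ a x : nrm (a *: x) = cabs a * nrm x.
Proof. by apply: realc_inj; rewrite -nrmE normrZ cabsE nrmE -rmorphM. Qed.

Lemma nrmZr r x : nrm (r%:C *: x) = `|r| * nrm x.
Proof. by rewrite nrmZ cabs_real. Qed.

Lemma nrm0 : nrm (0 : V) = 0.
Proof. by rewrite /nrm normr0. Qed.

Lemma nrm0_eq x : nrm x = 0 -> x = 0.
Proof. by move=> h; apply/normr0_eq0; rewrite nrmE h. Qed.

Lemma nrmD x y : nrm (x + y) <= nrm x + nrm y.
Proof. by have := ler_normD x y; rewrite !nrmE -rmorphD lecR. Qed.

Lemma nrmN x : nrm (- x) = nrm x.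
Proof. by rewrite /nrm normrN. Qed.

Lemma nrmBC x y : nrm (x - y) = nrm (y - x).
Proof. by rewrite -nrmN opprB. Qed.

Lemma nrmB x y : nrm (x - y) <= nrm x + nrm y.
Proof. by rewrite -(nrmN y); apply: nrmD. Qed.

Lemma nrm_tri z x y : nrm (x - y) <= nrm (x - z) + nrm (z - y).
Proof. by rewrite (_ : x - y = (x - z) + (z - y)) ?nrmD // addrA subrK. Qed.

Lemma nrm_sub_le x y : nrm x <= nrm (x - y) + nrm y.
Proof. by have := nrmD (x - y) y; rewrite subrK. Qed.

Lemma nrm_sum (I : Type) (s : seq I) (p : pred I) (f : I -> V) :
  nrm (\sum_(i <- s | p i) f i) <= \sum_(i <- s | p i) nrm (f i).
Proof.
elim/big_ind2: _ => [|u a v b h1 h2|//]; first by rewrite nrm0.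
exact: le_trans (nrmD _ _) (lerD h1 h2).
Qed.

Lemma nrm_small x : (forall e, 0 < e -> nrm x <= e) -> x = 0.
Proof.
move=> h; apply: nrm0_eq; apply/eqP; rewrite eq_le nrm_ge0 andbT.
by apply/ler_addgt0Pl => e e0; rewrite addr0; apply: h.
Qed.

Lemma eq_nrm_small x y : (forall e, 0 < e -> nrm (x - y) <= e) -> x = y.
Proof. by move=> h; apply/eqP; rewrite -subr_eq0; apply/eqP/nrm_small. Qed.

(** Limits use a real [e], since the norm of [V] takes its values in [R[i]]. *)
Definition lims (u : nat -> V) (l : V) :=
  forall e : R, 0 < e -> exists N, forall n, (N <= n)%N -> nrm (u n - l) <= e.

Lemma lims_unique u l l' : lims u l -> lims u l' -> l = l'.
Proof.
move=> h h'; apply: eq_nrm_small => e e0.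
have e2 : 0 < e / 2 by rewrite divr_gt0.
have [N hN] := h _ e2; have [N' hN'] := h' _ e2.
apply: le_trans (nrm_tri (u (maxn N N')) _ _) _.
by rewrite (splitr e) lerD // 1?nrmBC ?hN ?leq_maxl // nrmBC hN' // leq_maxr.
Qed.

Lemma nrm_complete (u : nat -> V) :
  (forall e : R, 0 < e -> exists N, forall m n, (N <= m)%N -> (N <= n)%N ->
     nrm (u m - u n) <= e) -> exists l, lims u l.
Proof.
move=> h; have cu : cvg (u @ \oo).
  apply/cauchy_cvgP/cauchy_exP => e e0.
  have eR : e = (complex.Re e)%:C by apply: ge0_ReE; apply: ltW.
  have e0' : 0 < complex.Re e / 2 by rewrite divr_gt0 // -ltcR -eR.
  have [N hN] := h _ e0'; exists (u N), N => // n /= leNn.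
  rewrite -ball_normE /=; apply: (@le_lt_trans _ _ (complex.Re e / 2)%:C).
    by rewrite -nrm_le; apply: hN.
  by rewrite eR /= ltcR ltr_pdivrMr // mulr_natr mulr2n ltrDl -ltcR -eR.
exists (lim (u @ \oo)) => e e0.
have /cvgrPdist_le /(_ e%:C) : u @ \oo --> lim (u @ \oo) by [].
rewrite ltcR => /(_ e0) [N _ hN]; exists N => n leNn.
by rewrite nrmBC nrm_le; apply: hN.
Qed.

Lemma lims_le u l C : lims u l -> (forall n, nrm (u n) <= C) -> nrm l <= C.
Proof.
move=> h hC; apply/ler_addgt0Pr => e e0; have [N hN] := h _ e0.
have := nrm_sub_le l (u N); rewrite nrmBC => hh; apply: le_trans hh _.
by rewrite addrC lerD //; apply: hN.
Qed.

Lemma lims_geom (C r : R) (u : nat -> V) : 0 <= r < 1 ->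
  (forall n, nrm (u n.+1 - u n) <= C * r ^+ n) ->
  exists2 l, lims u l & forall n, nrm (u n - l) <= C * r ^+ n / (1 - r).
Proof.
move=> /andP [r0 r1] h.
have s1 : 0 < 1 - r by rewrite subr_gt0.
have C0 : 0 <= C by have := h 0; rewrite expr0 mulr1; apply: le_trans.
have tail n p : nrm (u n - u (n + p)%N) <= C * r ^+ n / (1 - r).
  (* The factor [1 - r ^+ p] comes from the partial geometric sum and makes the induction on [p]
     close exactly. *)
  suff : nrm (u n - u (n + p)%N) <= C * r ^+ n * (1 - r ^+ p) / (1 - r).
    move/le_trans; apply; rewrite ler_pM2r ?invr_gt0 // ler_piMr //.
      by rewrite mulr_ge0 // exprn_ge0.
    by rewrite gerBl exprn_ge0.
  elim: p => [|p IH]; first by rewrite addn0 !subrr nrm0 mulr0 mul0r.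
  apply: le_trans (nrm_tri (u (n + p)%N) _ _) _.
  have := h (n + p)%N; rewrite -addnS nrmBC => h'.
  apply: le_trans (lerD IH h') _; rewrite exprD exprS.
  rewrite le_eqVlt; apply/orP; left; apply/eqP; field; exact: lt0r_neq0.
have tozero e : 0 < e -> exists N, forall n, (N <= n)%N -> C * r ^+ n / (1 - r) <= e.
  move=> e0; have : (fun n => C * r ^+ n / (1 - r)) @ \oo --> (0 : R).
    rewrite -(mul0r (1 - r)^-1) -(mulr0 C); apply: cvgMl; apply: cvgMr.
    by apply: cvg_expr; rewrite ger0_norm.
  move/cvgrPdist_le => /(_ _ e0) [N _ hN]; exists N => n leNn.
  by have := hN n leNn; rewrite sub0r normrN; apply: le_trans; apply: ler_norm.
have [l hl] : exists l, lims u l.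
  apply: nrm_complete => e e0; have [N hN] : exists N, forall n, (N <= n)%N -> C * r ^+ n / (1 - r) <= e / 2.
    by apply: tozero; rewrite divr_gt0.
  exists N => m n leNm leNn; apply: le_trans (nrm_tri (u N) _ _) _.
  rewrite (splitr e) lerD // 1?nrmBC.
    by rewrite -(subnKC leNm); apply: le_trans (tail _ _) _; apply: hN.
  by rewrite nrmBC -(subnKC leNn); apply: le_trans (tail _ _) _; apply: hN.
exists l => // n; apply/ler_addgt0Pr => e e0; have [N hN] := hl _ e0.
apply: le_trans (nrm_tri (u (n + N)%N) _ _) _; apply: lerD; first exact: tail.
by apply: hN; rewrite leq_addl.
Qed.

Section Lin.
Variable f : V -> V.
Hypothesis lf : is_linear f.
Lemma lin0 : f 0 = 0.
Proof. by have := lf (-1) 0 0; rewrite scaler0 addr0 scaleN1r addNr. Qed.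
Lemma linD x y : f (x + y) = f x + f y.
Proof. by have := lf 1 x y; rewrite !scale1r. Qed.
Lemma linZ a x : f (a *: x) = a *: f x.
Proof. by have := lf a x 0; rewrite !addr0 lin0 addr0. Qed.
Lemma linN x : f (- x) = - f x.
Proof. by rewrite -scaleN1r linZ scaleN1r. Qed.
Lemma linB x y : f (x - y) = f x - f y.
Proof. by rewrite linD linN. Qed.
Lemma lin_sum (I : Type) (s : seq I) (p : pred I) (g : I -> V) :
  f (\sum_(i <- s | p i) g i) = \sum_(i <- s | p i) f (g i).
Proof. by elim/big_ind2: _ => [|u v w z <- <-|//]; rewrite ?lin0 ?linD. Qed.
End Lin.

(** On the zero space [C] may be negative, hence the [|C| + 1] wherever a positive bound is
    needed. *)
Definition opbound (f : V -> V) (C : R) := forall x, nrm (f x) <= C * nrm x.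

Lemma opbound_le f C C' : C <= C' -> opbound f C -> opbound f C'.
Proof. by move=> h hf x; apply: le_trans (hf x) _; apply: ler_wpM2r. Qed.

Lemma opbound_lims f C u l : is_linear f -> opbound f C -> lims u l -> lims (f \o u) (f l).
Proof.
move=> lf hf hu e e0.
have C1 : 0 < `|C| + 1 by rewrite ltr_wpDl.
have [N hN] := hu _ (divr_gt0 e0 C1); exists N => n leNn /=.
rewrite -(linB lf); apply: le_trans (hf _) _.
apply: (@le_trans _ _ ((`|C| + 1) * nrm (u n - l))).
  by rewrite ler_wpM2r // (le_trans (ler_norm _)) // lerDl.
by rewrite mulrC -ler_pdivlMr //; apply: hN.
Qed.

Lemma lims_add u v l m : lims u l -> lims v m -> lims (fun n => u n + v n) (l + m).
Proof.
move=> hu hv e e0; have e2 : 0 < e / 2 by rewrite divr_gt0.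
have [N hN] := hu _ e2; have [N' hN'] := hv _ e2; exists (maxn N N') => n.
rewrite geq_max => /andP [h1 h2]; rewrite opprD addrACA (splitr e).
by apply: le_trans (nrmD _ _) _; rewrite lerD ?hN ?hN'.
Qed.

Lemma lims_scale a u l : lims u l -> lims (fun n => a *: u n) (a *: l).
Proof.
have lf : is_linear (fun x : V => a *: x).
  by move=> b x y; rewrite scalerDr !scalerA mulrC.
apply: (@opbound_lims (fun x => a *: x) (cabs a)) => // x.
by rewrite nrmZ.
Qed.

Lemma lims_eq u v l : (forall n, u n = v n) -> lims u l -> lims v l.
Proof. by move=> h hu e /hu [N hN]; exists N => n /hN; rewrite h. Qed.

Lemma opnorm_le f C : 0 <= C -> is_linear f ->
  (opnorm f <= C%:E)%E <-> opbound f C.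
Proof.
move=> C0 lf; split=> [h x|h].
  have [x0|x0] := eqVneq (nrm x) 0.
    by rewrite (nrm0_eq x0) (lin0 lf) nrm0 mulr0.
  have xp : 0 < nrm x by rewrite lt_neqAle eq_sym x0 nrm_ge0.
  have : ((nrm (f ((nrm x)^-1%:C *: x)))%:E <= C%:E)%E.
    apply: le_trans h; apply: ereal_sup_ubound; exists ((nrm x)^-1%:C *: x) => //=.
    by rewrite nrmZr ger0_norm ?invr_ge0 // mulVf.
  by rewrite lee_fin (linZ lf) nrmZr ger0_norm ?invr_ge0 // mulrC ler_pdivrMr.
apply: ge_ereal_sup => _ [x /= x1 <-]; rewrite lee_fin; apply: le_trans (h x) _.
by rewrite -[leRHS]mulr1; apply: ler_wpM2l.
Qed.

Lemma opnorm_ge0 (f : V -> V) : is_linear f -> (0 <= opnorm f)%E.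
Proof.
move=> lf; apply: ereal_sup_ubound; exists 0 => /=; first by rewrite nrm0.
by rewrite (lin0 lf) nrm0.
Qed.

End Norm.

(** * The complex exponential *)

Section Cexp.
Variable R : realType.
Implicit Types (l a b : R[i]) (t : R).

Lemma cabsD a b : cabs (a + b) <= cabs a + cabs b.
Proof. by have := ler_normD a b; rewrite !cabsE -rmorphD lecR. Qed.

Lemma cabsN a : cabs (- a) = cabs a.
Proof. by rewrite /cabs normrN. Qed.

Lemma cabsi : cabs ('i : R[i]) = 1.
Proof. by apply: realc_inj; rewrite -cabsE normCi. Qed.

Lemma complex_ReIm l : l = (complex.Re l)%:C + 'i * (complex.Im l)%:C.
Proof. by rewrite [LHS]complexE complexiE. Qed.

Lemma cabs_decomp (u v : R) : cabs (u%:C + 'i * v%:C) <= `|u| + `|v|.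
Proof. by apply: le_trans (cabsD _ _) _; rewrite cabsM cabsi mul1r !cabs_real. Qed.

Definition cis t : R[i] := (cos t)%:C + 'i * (sin t)%:C.

Lemma cis0 : cis 0 = 1.
Proof. by rewrite /cis cos0 sin0 mulr0 addr0. Qed.

Lemma cisD s t : cis (s + t) = cis s * cis t.
Proof.
have i2 : ('i : R[i]) ^+ 2 = -1 by exact: sqrCi.
rewrite /cis cosD sinD !rmorphD rmorphN !rmorphM /=.
ring: i2.
Qed.

Lemma cisN t : cis t * cis (- t) = 1.
Proof. by rewrite -cisD subrr cis0. Qed.

Lemma cabs_cis_sub1 t : cabs (cis t - 1) ^+ 2 = 2 - 2 * cos t.
Proof.
have -> : cis t - 1 = (cos t - 1) +i* sin t.
  apply/eqP; rewrite /cis -complexiE eq_complex /= ; apply/andP; split; apply/eqP; ring.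
rewrite /cabs normc_def /= sqr_sqrtr ?addr_ge0 ?sqr_ge0 //.
have := cos2Dsin2 t => h.
have s2 : sin t ^+ 2 = 1 - cos t ^+ 2 by rewrite -h; ring.
by rewrite s2; ring.
Qed.

Lemma cabs_cis t : cabs (cis t) = 1.
Proof.
have -> : cis t = cos t +i* sin t.
  apply/eqP; rewrite /cis -complexiE eq_complex /= ; apply/andP; split; apply/eqP; ring.
by rewrite /cabs normc_def /= cos2Dsin2 sqrtr1.
Qed.

Definition cexp l t : R[i] := (expR (complex.Re l * t))%:C * cis (complex.Im l * t).

Lemma cexp0 l : cexp l 0 = 1.
Proof. by rewrite /cexp !mulr0 expR0 cis0 mulr1. Qed.

Lemma cexpD l s t : cexp l (s + t) = cexp l s * cexp l t.
Proof. by rewrite /cexp !(mulrDr _ s t) expRD cisD rmorphM; ring. Qed.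

Lemma cexpN l t : cexp l t * cexp (- l) t = 1.
Proof.
rewrite /cexp !raddfN /= !mulNr mulrACA -cisD subrr cis0 -rmorphM -expRD subrr expR0 mulr1.
by [].
Qed.

Lemma cabs_cexp l t : cabs (cexp l t) = expR (complex.Re l * t).
Proof. by rewrite /cexp cabsM cabs_cis mulr1 cabs_real ger0_norm ?expR_ge0. Qed.

Lemma derive_eps (f : R -> R) (df : R) : is_derive (0 : R) (1 : R) f df ->
  forall e, 0 < e -> exists2 d, 0 < d &
    forall h, 0 < h -> h < d -> `|h^-1 * (f h - f 0) - df| <= e.
Proof.
move=> [der val] e e0; have := der; rewrite /derivable => hc.
have : h^-1 *: (f (h *: 1 + 0) - f 0) @[h --> 0^'] --> df.
  by rewrite -val /derive; move: hc => /=; under eq_fun do rewrite /shift /=.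
move/cvgrPdist_le => /(_ _ e0) [d /= d0 hd]; exists d => // h h0 hlt.
have := hd h; rewrite /= sub0r normrN gtr0_norm // => /(_ hlt (lt0r_neq0 h0)).
by rewrite distrC addr0 [h *: 1]mulr1.
Qed.

Lemma cexp_derive l e : 0 < e -> exists2 d, 0 < d &
  forall h, 0 < h -> h < d -> cabs (h^-1%:C * (cexp l h - 1) - l) <= e.
Proof.
move=> e0; pose a := complex.Re l; pose b := complex.Im l.
have e2 : 0 < e / 2 by rewrite divr_gt0.
have d1 : is_derive (0 : R) (1 : R) (fun h => expR (a * h) * cos (b * h)) a.
  apply: is_derive_eq => /=.
  by rewrite !mulr0 expR0 cos0 sin0 !scale1r /GRing.scale /= ; ring.
have d2 : is_derive (0 : R) (1 : R) (fun h => expR (a * h) * sin (b * h)) b.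
  apply: is_derive_eq => /=.
  by rewrite !mulr0 expR0 cos0 sin0 !scale1r /GRing.scale /= ; ring.
have [r1 r10 h1] := derive_eps d1 e2; have [r2 r20 h2] := derive_eps d2 e2.
exists (Num.min r1 r2); first by rewrite lt_min r10.
move=> h h0; rewrite lt_min => /andP [hr1 hr2].
have := h1 h h0 hr1; have := h2 h h0 hr2.
rewrite !mulr0 expR0 cos0 sin0 mulr0 mulr1 subr0 => q2 q1.
have -> : h^-1%:C * (cexp l h - 1) - l =
  (h^-1 * (expR (a * h) * cos (b * h) - 1) - a)%:C +
  'i * (h^-1 * (expR (a * h) * sin (b * h)) - b)%:C.
  rewrite {2}(complex_ReIm l) -/a -/b /cexp -/a -/b /cis; ring.
by apply: le_trans (cabs_decomp _ _) _; rewrite (splitr e) lerD.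
Qed.

Lemma cexp_cont0 l e : 0 < e -> exists2 d, 0 < d &
  forall h, 0 <= h -> h < d -> cabs (cexp l h - 1) <= e.
Proof.
move=> e0; have [d d0 hd] := cexp_derive l ltr01.
have c1 : 0 < cabs l + 1 by rewrite ltr_wpDl // cabs_ge0.
exists (Num.min d (e / (cabs l + 1))); first by rewrite lt_min d0 divr_gt0.
move=> h; rewrite le_eqVlt => /orP [/eqP <- _|h0].
  by rewrite cexp0 subrr /cabs normr0 ltW.
rewrite lt_min ltr_pdivlMr // => /andP [h1 h2].
have -> : cexp l h - 1 = h%:C * ((h^-1%:C * (cexp l h - 1) - l) + l).
  rewrite subrK mulrA -rmorphM mulfV ?lt0r_neq0 // mul1r //.
rewrite cabsM cabs_real gtr0_norm //; apply: le_trans (ltW h2).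
by rewrite ler_pM2l // addrC; apply: le_trans (cabsD _ _) _; rewrite lerD // hd.
Qed.

Lemma cexp_real (w t : R) : cexp w%:C t = (expR (w * t))%:C.
Proof. by rewrite /cexp /= mul0r cis0 mulr1. Qed.

Lemma cexp_imag (w t : R) : cexp ('i * w%:C) t = cis (w * t).
Proof.
have -> : 'i * w%:C = 0 +i* w :> R[i].
  by apply/eqP; rewrite -complexiE eq_complex /=; apply/andP; split; apply/eqP; ring.
by rewrite /cexp /= mul0r expR0 mul1r.
Qed.

End Cexp.

(** * Integrals and generators of semigroups *)

Section Semigroup.
Variables (R : realType) (V : completeNormedModType R[i]).
Implicit Types (x y z : V) (S : R -> V -> V) (t s e d h L : R).

Ltac lmod := lmod_with R[i] V ltac:(try ring).

Lemma nrm_sum_le (n : nat) (g : nat -> V) (C : R) :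
  (forall i, (i < n)%N -> nrm (g i) <= C) -> nrm (\sum_(i < n) g i) <= n%:R * C.
Proof.
move=> h; apply: le_trans (nrm_sum _ _ _) _.
have /le_trans : \sum_(i < n) nrm (g i) <= \sum_(i < n) C.
  by apply: ler_sum => i _; apply: h.
by apply; rewrite big_const_ord iter_addr_0 mulr_natl.
Qed.

(** Strong continuity in the form in which it is used: continuity at time [0], together with a bound
    on bounded time intervals that the uniform boundedness principle supplies once and for all. *)
Definition lb_semigroup S := [/\ forall t, 0 <= t -> is_linear (S t), forall x, S 0 x = x,
  forall t s x, 0 <= t -> 0 <= s -> S (t + s) x = S t (S s x),
  forall x e, 0 < e -> exists2 d, 0 < d & forall h, 0 <= h -> h < d -> nrm (S h x - x) <= e &
  forall L, exists2 M, 1 <= M & forall t, 0 <= t -> t <= L -> opbound (S t) M].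

Definition gen S x y := forall e : R, 0 < e -> exists2 d : R, 0 < d &
  forall h, 0 < h -> h < d -> nrm (h^-1%:C *: (S h x - x) - y) <= e.

Lemma generatorP S x y : generator S x y <-> gen S x y.
Proof.
split=> [/cvgrPdist_le h e e0|h].
  have /h : (0 : R[i]) < e%:C by rewrite ltcR.
  move=> [d /= d0 hd]; exists d => // t t0 td.
  have := hd t; rewrite /= sub0r normrN gtr0_norm // => /(_ td t0).
  by rewrite -nrm_le nrmBC fmorphV.
apply/cvgrPdist_le => e e0; rewrite (ge0_ReE (ltW e0)).
have /h [d d0 hd] : 0 < complex.Re e by rewrite -ltcR -ge0_ReE // ltW.
exists d => //= t; rewrite /= sub0r normrN => htd t0.
rewrite -nrm_le nrmBC -fmorphV; apply: hd => //.
by rewrite -(gtr0_norm t0).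
Qed.

Lemma gen_unique S x y z : gen S x y -> gen S x z -> y = z.
Proof.
move=> hy hz; apply: eq_nrm_small => e e0; have e2 : 0 < e / 2 by rewrite divr_gt0.
have [d d0 hd] := hy _ e2; have [d' d0' hd'] := hz _ e2.
pose h := Num.min d d' / 2.
have m0 : 0 < Num.min d d' by rewrite lt_min d0.
have h0 : 0 < h by rewrite divr_gt0.
have : h < Num.min d d' by rewrite /h ltr_pdivrMr // mulr_natr mulr2n ltrDl.
rewrite lt_min => /andP [h1 h2].
apply: le_trans (nrm_tri (h^-1%:C *: (S h x - x)) _ _) _.
by rewrite (splitr e) lerD ?hd' // nrmBC hd.
Qed.

Section Riemann.
Variable S : R -> V -> V.
Hypothesis sg : lb_semigroup S.

Let slin t : 0 <= t -> is_linear (S t). Proof. by case: sg => + _ _ _ _; apply. Qed.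
Let SD t s x : 0 <= t -> 0 <= s -> S (t + s) x = S t (S s x).
Proof. by case: sg => _ _ + _ _; apply. Qed.
Let cont0 x e : 0 < e ->
  exists2 d, 0 < d & forall h, 0 <= h -> h < d -> nrm (S h x - x) <= e.
Proof. by case: sg => _ _ _ + _; apply. Qed.
Let locb L : exists2 M, 1 <= M & forall t, 0 <= t -> t <= L -> opbound (S t) M.
Proof. by case: sg. Qed.

Definition rsum (h : R) (n : nat) x := h%:C *: \sum_(i < n) S (i%:R * h) x.
Definition mesh (N : nat) : R := (2 ^+ N)^-1.
(** Only complete cells of [[0, t]] are counted. The rest is shorter than one cell and disappears in
    the limit. *)
Definition cells (t : R) (N : nat) : nat := Num.truncn (t / mesh N).

Lemma mesh_gt0 N : 0 < mesh N.
Proof. by rewrite invr_gt0 exprn_gt0. Qed.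

Lemma mesh_ge0 N : 0 <= mesh N. Proof. exact/ltW/mesh_gt0. Qed.

Lemma mesh_small e : 0 < e -> exists N, forall n, (N <= n)%N -> mesh n < e.
Proof.
move=> e0; have : (fun n => (2^-1 : R) ^+ n) @ \oo --> (0 : R).
  by apply: cvg_expr; rewrite ger0_norm ?invr_ge0 // invf_lt1 // ltr1n.
move/cvgrPdist_lt => /(_ _ e0) [N _ hN]; exists N => n leNn.
by have := hN n leNn; rewrite /= sub0r normrN exprVn ger0_norm // mesh_ge0.
Qed.

Lemma cells_le t N : 0 <= t -> (cells t N)%:R * mesh N <= t.
Proof.
move=> t0; rewrite -ler_pdivlMr ?mesh_gt0 //.
by have /andP [] := truncn_itv (divr_ge0 t0 (mesh_ge0 N)).
Qed.

Lemma cells_gt t N : 0 <= t -> t - (cells t N)%:R * mesh N < mesh N.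
Proof.
move=> t0; rewrite ltrBlDl -{2}(mul1r (mesh N)) -mulrDl -ltr_pdivrMr ?mesh_gt0 //.
by have /andP [_] := truncn_itv (divr_ge0 t0 (mesh_ge0 N)); rewrite -natr1.
Qed.

Lemma sum_divn (f : nat -> V) (q n : nat) : (0 < q)%N ->
  \sum_(i < q * n) f (i %/ q)%N = q%:R *: \sum_(i < n) f i.
Proof.
move=> q0; elim: n => [|n IH]; first by rewrite muln0 !big_ord0 scaler0.
rewrite mulnS addnC big_split_ord /= IH big_ord_recr /= scalerDr; congr (_ + _).
rewrite (eq_bigr (fun=> f n)); last first.
  by move=> i _; rewrite mulnC divnMDl // divn_small // addn0.
by rewrite big_const_ord iter_addr_0 scaler_nat.
Qed.

(** Both sides are the sum of the first [m + n] terms minus that of the first [m] and that of the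
    first [n]. This is the discrete form of [integ_shift]. *)
Lemma sum_shift (u : nat -> V) (n m : nat) :
  \sum_(i < n) (u (i + m)%N - u i) = \sum_(i < m) (u (i + n)%N - u i).
Proof.
have key p q : \sum_(i < p) u (i + q)%N = \sum_(i < q + p) u i - \sum_(i < q) u i.
  rewrite big_split_ord /= addrAC subrr add0r; apply: eq_bigr => i _.
  by rewrite addnC.
by rewrite !sumrB !key addnC addrAC.
Qed.

Lemma rsum_shift h n m x : 0 <= h ->
  rsum h n (S (m%:R * h) x - x) = S (n%:R * h) (rsum h m x) - rsum h m x.
Proof.
move=> h0; have nh k : 0 <= k%:R * h by rewrite mulr_ge0.
rewrite /rsum (linZ (slin (nh n))) (lin_sum (slin (nh n))) -scalerBr -sumrB.
congr (_ *: _); pose u i := S (i%:R * h) x.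
transitivity (\sum_(i < n) (u (i + m)%N - u i)).
  by apply: eq_bigr => i _; rewrite (linB (slin (nh i))) -SD // -mulrDl -natrD.
rewrite sum_shift; apply: eq_bigr => i _.
by rewrite -SD // -mulrDl -natrD addnC.
Qed.

Lemma rsum_near h n x y e : 0 <= h ->
  (forall s, 0 <= s -> s <= n%:R * h -> nrm (S s x - y) <= e) ->
  nrm (rsum h n x - (n%:R * h)%:C *: y) <= n%:R * h * e.
Proof.
move=> h0 hS.
have -> : rsum h n x - (n%:R * h)%:C *: y = h%:C *: \sum_(i < n) (S (i%:R * h) x - y).
  rewrite sumrB scalerBr big_const_ord iter_addr_0 -[y *+ n]scaler_nat scalerA.
  by rewrite rmorphM rmorph_nat /= [_ * h%:C]mulrC.
rewrite nrmZr ger0_norm // mulrAC mulrC; apply: ler_wpM2r => //.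
apply: (nrm_sum_le (g := fun i => S (i%:R * h) x - y)) => i ilt.
by apply: hS; rewrite ?mulr_ge0 // ler_wpM2r // ler_nat ltnW.
Qed.

(** A coarse cell splits into [2 ^ p] fine ones, on which the orbit varies little by continuity at
    [0] and the local bound [M]. The fine cells left over fill at most one coarse cell. *)
Lemma rsum_cauchy t x : 0 <= t -> forall e, 0 < e -> exists N, forall m n,
  (N <= m)%N -> (N <= n)%N ->
  nrm (rsum (mesh m) (cells t m) x - rsum (mesh n) (cells t n) x) <= e.
Proof.
move=> t0 e e0; have [M M1 hM] := locb t; have M0 : 0 < M by apply: lt_le_trans M1.
(* The complete coarse cells contribute [t * M * e1], the remaining fine ones [M * nrm x * e1]. *)
pose e1 := e / 2 / (t * M + M * nrm x + 1).
have den : 0 < t * M + M * nrm x + 1.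
  by rewrite ltr_wpDl // addr_ge0 ?mulr_ge0 ?nrm_ge0 // ltW.
have e10 : 0 < e1 by rewrite divr_gt0 // divr_gt0.
have [d d0 hd] := cont0 x e10.
have [N1 hN1] := mesh_small d0; have [N2 hN2] := mesh_small e10.
have step n p : (N1 <= n)%N -> (N2 <= n)%N ->
    nrm (rsum (mesh (n + p)) (cells t (n + p)) x - rsum (mesh n) (cells t n) x) <= e / 2.
  move=> h1 h2; pose h := mesh n; pose h' := mesh (n + p).
  have hh' : h = (2 ^ p)%:R * h'.
    by rewrite /h /h' /mesh exprD invfM mulrCA natrX mulfV ?mulr1 // expf_neq0.
  have h'0 : 0 <= h' := mesh_ge0 _; have h0 : 0 <= h := mesh_ge0 _.
  pose a := cells t n; pose b := cells t (n + p).
  have q0 : (0 < 2 ^ p)%N by rewrite expn_gt0.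
  have ab : (2 ^ p * a <= b)%N.
    rewrite /b /cells truncn_ge_nat; last by rewrite divr_ge0 // mesh_ge0.
    rewrite ler_pdivlMr ?mesh_gt0 // natrM mulrAC -/h' -hh' mulrC.
    exact: cells_le.
  rewrite -/h -/h' -/a -/b /rsum -(subnKC ab) big_split_ord /=.
  have -> : h%:C *: (\sum_(i < a) S (i%:R * h) x) =
     h'%:C *: \sum_(i < 2 ^ p * a) S ((i %/ 2 ^ p)%:R * h) x.
    rewrite (sum_divn (fun i => S (i%:R * h) x)) // scalerA {1}hh' rmorphM rmorph_nat.
    by rewrite mulrC.
  rewrite scalerDr addrAC -scalerBr -sumrB.
  apply: le_trans (nrmD _ _) _; rewrite !nrmZr !(ger0_norm h'0).
  have B1 : h' * nrm (\sum_(i < 2 ^ p * a)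
      (S (i%:R * h') x - S ((i %/ 2 ^ p)%:R * h) x)) <= t * M * e1.
    have B i : (i < 2 ^ p * a)%N -> nrm (S (i%:R * h') x - S ((i %/ 2 ^ p)%:R * h) x) <= M * e1.
      move=> ilt; pose j := (i %/ 2 ^ p)%N; pose k := (i %% 2 ^ p)%N.
      have -> : i%:R * h' = j%:R * h + k%:R * h'.
        by rewrite hh' mulrA -natrM -mulrDl -natrD -divn_eq.
      have j0 : 0 <= j%:R * h by rewrite mulr_ge0.
      have k0 : 0 <= k%:R * h' by rewrite mulr_ge0.
      rewrite SD // -(linB (slin j0)); apply: le_trans (hM _ _ _ _) _ => //.
        apply: le_trans (cells_le n t0); rewrite ler_wpM2r // ler_nat ltnW //.
        by rewrite ltn_divLR // mulnC.
      apply: ler_wpM2l; first exact: ltW.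
      apply: hd => //; apply: lt_trans (hN1 n h1); rewrite -/h hh' ltr_pM2r ?mesh_gt0 //.
      by rewrite ltr_nat ltn_mod.
    apply: (@le_trans _ _ (h' * ((2 ^ p * a)%:R * (M * e1)))).
      apply: ler_wpM2l => //.
      exact: (nrm_sum_le (g := fun i => S (i%:R * h') x - S ((i %/ 2 ^ p)%:R * h) x)).
    have -> : h' * ((2 ^ p * a)%:R * (M * e1)) = (a%:R * h) * (M * e1).
      by rewrite hh' natrM; ring.
    rewrite -(mulrA t M); apply: ler_wpM2r; last exact: cells_le.
    exact: mulr_ge0 (ltW M0) (ltW e10).
  have B2 : h' * nrm (\sum_(i < b - 2 ^ p * a) S ((2 ^ p * a + i)%:R * h') x)
      <= M * nrm x * e1.
    apply: (@le_trans _ _ (h' * ((b - 2 ^ p * a)%:R * (M * nrm x)))).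
      apply: ler_wpM2l => //.
      apply: (nrm_sum_le (g := fun i => S ((2 ^ p * a + i)%:R * h') x)) => i ilt.
      apply: hM; first by rewrite mulr_ge0.
      apply: le_trans (cells_le (n + p) t0); rewrite ler_wpM2r // ler_nat.
      by rewrite ltnW // -ltn_subRL.
    have hx : h' * (b - 2 ^ p * a)%:R <= h.
      have := cells_gt n t0; rewrite -/h -/a => ct.
      have := cells_le (n + p) t0; rewrite -/h' -/b => cb.
      rewrite natrB // natrM; move: ct cb; rewrite hh' => ct cb; lra.
    rewrite (mulrA h') (mulrC (h' * _)); apply: ler_wpM2l.
      by rewrite mulr_ge0 ?nrm_ge0 ?(ltW M0).
    exact: le_trans hx (ltW (hN2 n h2)).
  apply: le_trans (lerD B1 B2) _; rewrite -mulrDl mulrC /e1 mulrAC.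
  rewrite ler_pdivrMr // ler_wpM2l ?lerDl //; exact/ltW/divr_gt0.
exists (maxn N1 N2) => m n; rewrite !geq_max => /andP [m1 m2] /andP [n1 n2].
have N12 : (N1 <= maxn N1 N2)%N /\ (N2 <= maxn N1 N2)%N by rewrite leq_maxl leq_maxr.
case: N12 => g1 g2.
apply: le_trans (nrm_tri (rsum (mesh (maxn N1 N2)) (cells t (maxn N1 N2)) x) _ _) _.
rewrite (splitr e) lerD //.
  by rewrite -(subnKC (_ : (maxn N1 N2 <= m)%N)) ?geq_max ?m1 //; apply: step.
by rewrite nrmBC -(subnKC (_ : (maxn N1 N2 <= n)%N)) ?geq_max ?n1 //; apply: step.
Qed.

(* The integral of [s |-> S s x] over [0, t], as a limit of Riemann sums over the
   dyadic meshes [2^-N]; a junk value when [t < 0]. *)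
Definition integ t x : V :=
  xget 0 [set l | lims (fun N => rsum (mesh N) (cells t N) x) l].

Lemma integ_lims t x : 0 <= t ->
  lims (fun N => rsum (mesh N) (cells t N) x) (integ t x).
Proof.
move=> t0; have [l hl] := nrm_complete (rsum_cauchy x t0).
exact: (@xgetPex _ 0 [set l | lims (fun N => rsum (mesh N) (cells t N) x) l] (ex_intro _ l hl)).
Qed.

Lemma cells_lims t : 0 <= t -> forall e, 0 < e -> exists N, forall n, (N <= n)%N ->
  0 <= t - (cells t n)%:R * mesh n < e.
Proof.
move=> t0 e e0; have [N hN] := mesh_small e0; exists N => n /hN h.
by rewrite subr_ge0 cells_le //= (lt_trans (cells_gt n t0)).
Qed.

Lemma lims_app (B : nat -> V -> V) (u : nat -> V) (w z : V) (M : R) :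
  (forall n, is_linear (B n)) -> (forall n, opbound (B n) M) ->
  lims (fun n => B n z) w -> lims u z -> lims (fun n => B n (u n)) w.
Proof.
move=> lB hB hw hu e e0; have e2 : 0 < e / 2 by rewrite divr_gt0.
have M1 : 0 < `|M| + 1 by rewrite ltr_wpDl.
have [N hN] := hw _ e2; have [N' hN'] := hu _ (divr_gt0 e2 M1).
exists (maxn N N') => n; rewrite geq_max => /andP [h1 h2].
apply: le_trans (nrm_tri (B n z) _ _) _; rewrite (splitr e) lerD ?hN //.
rewrite -(linB (lB n)); apply: le_trans (hB n _) _.
apply: (@le_trans _ _ ((`|M| + 1) * nrm (u n - z))).
  by rewrite ler_wpM2r ?nrm_ge0 // (le_trans (ler_norm _)) // lerDl.
by rewrite mulrC -ler_pdivlMr //; apply: hN'.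
Qed.

Lemma rsum_lin h n : 0 <= h -> is_linear (rsum h n).
Proof.
move=> h0 a x y; rewrite /rsum scalerA mulrC -scalerA -scalerDr; congr (_ *: _).
rewrite scaler_sumr -big_split; apply: eq_bigr => i _.
by apply: slin; rewrite mulr_ge0.
Qed.

Lemma rsum_opbound t M N : 0 <= t -> 0 <= M -> (forall s, 0 <= s -> s <= t -> opbound (S s) M) ->
  opbound (rsum (mesh N) (cells t N)) (t * M).
Proof.
move=> t0 M0 hM x; have := @rsum_near (mesh N) (cells t N) x 0 (M * nrm x) (mesh_ge0 N).
rewrite scaler0 subr0 -(mulrA t M) => h; apply: le_trans (h _) _.
  move=> s s0 hs; rewrite subr0; apply: hM => //; exact: le_trans hs (cells_le N t0).
by rewrite ler_wpM2r ?mulr_ge0 ?nrm_ge0 // cells_le.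
Qed.

(** The grid times approach [t] from below, so the semigroup law and the local bound reduce the
    claim to continuity at [0]. *)
Lemma S_cells t x : 0 <= t -> lims (fun N => S ((cells t N)%:R * mesh N) x) (S t x).
Proof.
move=> t0 e e0; have [M M1 hM] := locb t; have M0 : 0 < M by apply: lt_le_trans M1.
have [d d0 hd] := cont0 x (divr_gt0 e0 M0).
have [N hN] := cells_lims t0 d0; exists N => n /hN /andP [h1 h2].
have c0 : 0 <= (cells t n)%:R * mesh n by rewrite mulr_ge0 // mesh_ge0.
have -> : S t x = S ((cells t n)%:R * mesh n) (S (t - (cells t n)%:R * mesh n) x).
  by rewrite -SD // addrC subrK.
rewrite nrmBC -(linB (slin c0)).
apply: le_trans (hM _ c0 (cells_le n t0) _) _.
by rewrite mulrC -ler_pdivlMr //; apply: hd.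
Qed.

Lemma lims_const x : lims (fun=> x) x.
Proof. by move=> e e0; exists 0 => n _; rewrite subrr nrm0 ltW. Qed.

(** Comparison with a constant function; the norm estimates of integrals are derived from it. *)
Lemma integ_near t x y e : 0 <= t ->
  (forall s, 0 <= s -> s <= t -> nrm (S s x - y) <= e) ->
  nrm (integ t x - t%:C *: y) <= t * e.
Proof.
move=> t0 h; have e0 : 0 <= e by apply: le_trans (nrm_ge0 _) (h 0 _ t0).
apply: (@lims_le _ _ (fun N => rsum (mesh N) (cells t N) x -
   ((cells t N)%:R * mesh N)%:C *: y)).
  rewrite -scaleN1r; apply: (lims_eq (u := fun N => rsum (mesh N) (cells t N) x +
     -1 *: (((cells t N)%:R * mesh N)%:C *: y))); first by move=> n; rewrite scaleN1r.
  apply: lims_add; first exact: integ_lims.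
  apply: lims_scale.
  have y1 : 0 < nrm y + 1 by rewrite ltr_wpDl ?nrm_ge0.
  move=> r r0; have [N hN] := cells_lims t0 (divr_gt0 r0 y1); exists N => n /hN /andP [h1 h2].
  rewrite nrmBC -scalerBl -rmorphB nrmZr ger0_norm //.
  apply: (@le_trans _ _ (r / (nrm y + 1) * (nrm y + 1))); last by rewrite divfK // lt0r_neq0.
  by apply: ler_pM => //; rewrite ?nrm_ge0 ?(ltW h2) ?lerDl.
move=> n; have /le_trans : nrm (rsum (mesh n) (cells t n) x - ((cells t n)%:R * mesh n)%:C *: y)
    <= (cells t n)%:R * mesh n * e.
  apply: rsum_near (mesh_ge0 n) _ => s s0 hs; apply: h => //.
  exact: le_trans hs (cells_le n t0).
by apply; rewrite ler_wpM2r // cells_le.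
Qed.

Lemma integ_opbound t M x : 0 <= t -> (forall s, 0 <= s -> s <= t -> nrm (S s x) <= M * nrm x) ->
  nrm (integ t x) <= t * M * nrm x.
Proof.
move=> t0 h; have := @integ_near t x 0 (M * nrm x) t0.
rewrite scaler0 subr0 -mulrA; apply => s s0 st; rewrite subr0; exact: h.
Qed.

Lemma integ_bdd t : 0 <= t -> exists2 C, 0 <= C & opbound (integ t) C.
Proof.
move=> t0; have [M M1 hM] := locb t.
have M0 : 0 <= M by apply: le_trans M1.
exists (t * M); first by rewrite mulr_ge0.
by move=> x; apply: integ_opbound => // s s0 st; apply: hM.
Qed.

Lemma integ_lin t : 0 <= t -> is_linear (integ t).
Proof.
move=> t0 a x y; apply: lims_unique (integ_lims _ t0) _.
apply: (lims_eq (u := fun N => a *: rsum (mesh N) (cells t N) x + rsum (mesh N) (cells t N) y)).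
  by move=> n; rewrite rsum_lin // mesh_ge0.
by apply: lims_add; [apply: lims_scale|]; apply: integ_lims.
Qed.

Lemma integ_comm (B : V -> V) C t x : 0 <= t -> is_linear B -> opbound B C ->
  (forall s, 0 <= s -> B (S s x) = S s (B x)) -> B (integ t x) = integ t (B x).
Proof.
move=> t0 lB hB hc; apply: lims_unique _ (integ_lims _ t0).
apply: lims_eq (opbound_lims lB hB (integ_lims x t0)) => n /=.
rewrite /rsum (linZ lB) (lin_sum lB); congr (_ *: _); apply: eq_bigr => i _.
by apply: hc; rewrite mulr_ge0 // mesh_ge0.
Qed.

Lemma SC s t x : 0 <= s -> 0 <= t -> S s (S t x) = S t (S s x).
Proof. by move=> s0 t0; rewrite -!SD // addrC. Qed.

Lemma integ_S s t x : 0 <= s -> 0 <= t -> S s (integ t x) = integ t (S s x).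
Proof.
move=> s0 t0; have [M _ hM] := locb s.
apply: (integ_comm (C := M)) => //; [exact: slin|exact: hM|].
by move=> r r0; apply: SC.
Qed.

(** Both sides are the integral over [[0, t + L]] minus those over [[0, t]] and [[0, L]]. It is the
    limit of [rsum_shift], with grid times in place of [t] and [L]. *)
Lemma integ_shift t L x : 0 <= t -> 0 <= L ->
  integ t (S L x - x) = S t (integ L x) - integ L x.
Proof.
move=> t0 L0; have [M M1 hM] := locb t; have M0 : 0 <= M by apply: le_trans M1.
have h1 : lims (fun N => rsum (mesh N) (cells t N) (S ((cells L N)%:R * mesh N) x - x))
    (integ t (S L x - x)).
  apply: (@lims_app (fun N => rsum (mesh N) (cells t N)) _ _ (S L x - x) (t * M)).
  - by move=> n; apply: rsum_lin; apply: mesh_ge0.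
  - by move=> n; apply: rsum_opbound.
  - exact: integ_lims.
  - by apply: lims_add; [apply: S_cells|apply: lims_const].
apply: (lims_unique h1).
apply: (lims_eq (u := fun N => S ((cells t N)%:R * mesh N) (rsum (mesh N) (cells L N) x)
    + - 1 *: rsum (mesh N) (cells L N) x)).
  by move=> n; rewrite rsum_shift ?mesh_ge0 // scaleN1r.
rewrite -[- integ L x]scaleN1r; apply: lims_add; last by apply/lims_scale/integ_lims.
apply: (@lims_app (fun N => S ((cells t N)%:R * mesh N)) _ _ (integ L x) M).
- by move=> n; apply: slin; rewrite mulr_ge0 // mesh_ge0.
- by move=> n; apply: hM; rewrite ?mulr_ge0 ?mesh_ge0 ?cells_le.
- exact: S_cells.
- exact: integ_lims.
Qed.

(** By [integ_shift] the difference quotient at [h] is the mean over [[0, h]] of the orbit of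
    [S L x - x]. *)
Lemma gen_integ L x : 0 <= L -> gen S (integ L x) (S L x - x).
Proof.
move=> L0 e e0; have [d d0 hd] := cont0 (S L x - x) e0; exists d => // h h0 hlt.
rewrite -integ_shift ?(ltW h0) //.
have -> : h^-1%:C *: integ h (S L x - x) - (S L x - x) =
    h^-1%:C *: (integ h (S L x - x) - h%:C *: (S L x - x)).
  by rewrite scalerBr scalerA -rmorphM mulVf ?scale1r // lt0r_neq0.
rewrite nrmZr gtr0_norm ?invr_gt0 // mulrC ler_pdivrMr // mulrC.
apply: integ_near; first exact: ltW.
by move=> s s0 sh; apply: hd => //; apply: le_lt_trans hlt.
Qed.

Lemma gen_map (B : V -> V) C x y : is_linear B -> opbound B C ->
  (forall s, 0 <= s -> B (S s x) = S s (B x)) -> gen S x y -> gen S (B x) (B y).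
Proof.
move=> lB hB hc hg e e0; have C1 : 0 < `|C| + 1 by rewrite ltr_wpDl.
have [d d0 hd] := hg _ (divr_gt0 e0 C1); exists d => // h h0 hlt.
rewrite -hc ?(ltW h0) // -(linB lB) -(linZ lB) -(linB lB).
apply: le_trans (hB _) _.
apply: (@le_trans _ _ ((`|C| + 1) * nrm (h^-1%:C *: (S h x - x) - y))).
  by rewrite ler_wpM2r ?nrm_ge0 // (le_trans (ler_norm _)) // lerDl.
by rewrite mulrC -ler_pdivlMr //; apply: hd.
Qed.

(** The fundamental theorem of calculus without derivatives of orbits: [integ S t] commutes with the
    semigroup and so maps the graph of the generator into itself, and [gen_integ] gives a second
    value of the generator at [integ S t x]. *)
Lemma integ_gen t x y : 0 <= t -> gen S x y -> integ t y = S t x - x.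
Proof.
move=> t0 hg; have [C _ hC] := integ_bdd t0.
apply: (@gen_unique S (integ t x)); last exact: gen_integ.
apply: (gen_map (C := C)) => //; first exact: integ_lin.
by move=> s s0; rewrite integ_S.
Qed.

Lemma gen_lin a x y x' y' : gen S x y -> gen S x' y' -> gen S (a *: x + x') (a *: y + y').
Proof.
move=> h h' e e0; have a1 : 0 < cabs a + 1 by rewrite ltr_wpDl ?cabs_ge0.
have e2 : 0 < e / 2 by rewrite divr_gt0.
have [d d0 hd] := h _ (divr_gt0 e2 a1); have [d' d0' hd'] := h' _ e2.
exists (Num.min d d'); first by rewrite lt_min d0.
move=> t t0; rewrite lt_min => /andP [t1 t2].
have -> : t^-1%:C *: (S t (a *: x + x') - (a *: x + x')) - (a *: y + y') =
  a *: (t^-1%:C *: (S t x - x) - y) + (t^-1%:C *: (S t x' - x') - y').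
  by rewrite (slin (ltW t0)); lmod.
apply: le_trans (nrmD _ _) _; rewrite (splitr e) lerD ?hd' // nrmZ.
apply: (@le_trans _ _ ((cabs a + 1) * nrm (t^-1%:C *: (S t x - x) - y))).
  by rewrite ler_wpM2r ?nrm_ge0 // lerDl.
by rewrite mulrC -ler_pdivlMr //; apply: hd.
Qed.

End Riemann.
End Semigroup.

(** * Uniform boundedness, Neumann series and resolvents *)

Section Operators.
Variables (R : realType) (V : completeNormedModType R[i]).
Implicit Types (x y z : V) (S T : R -> V -> V) (t s e d h L q : R) (l m : R[i]).

Ltac lmod := lmod_with R[i] V ltac:(try ring).

(** Two thirds of the operator norm [sup A] are reached on the unit ball, which gives the factor
    [3 / 2]. *)
Lemma almost_norming (F : V -> V) (C C' : R) : is_linear F -> opbound F C -> 0 <= C' -> ~ opbound F C' ->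
  exists y, [/\ nrm y <= 1, C' <= 3 / 2 * nrm (F y) & opbound F (3 / 2 * nrm (F y))].
Proof.
move=> lF hF C'0 nF; pose A := [set r | exists2 x, nrm x <= 1 & r = nrm (F x)].
have C0 : 0 <= C.
  rewrite leNgt; apply/negP => C0; apply: nF => x; have := hF x.
  have [-> _|x0] := eqVneq x 0; first by rewrite (lin0 lF) nrm0 mulr0.
  have xp : 0 < nrm x.
    rewrite lt_neqAle nrm_ge0 andbT; apply: contra_neqN x0 => // /eqP h.
    by apply: nrm0_eq.
  by have := nrm_ge0 (F x); nra.
have sA : has_sup A.
  split; first by exists (nrm (F 0)), 0; rewrite ?nrm0.
  exists C => _ [x x1 ->]; apply: le_trans (hF x) _.
  by rewrite -[leRHS]mulr1; apply: ler_wpM2l.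
have ubA x : nrm x <= 1 -> nrm (F x) <= sup A by move=> x1; apply: ub_le_sup; [case: sA|exists x].
have s0 : 0 <= sup A by apply: le_trans (ubA 0 _); rewrite ?nrm_ge0 // nrm0.
have hsF : opbound F (sup A).
  move=> x; have [x0|x0] := eqVneq (nrm x) 0.
    by rewrite (nrm0_eq x0) (lin0 lF) nrm0 mulr0.
  have xp : 0 < nrm x by rewrite lt_neqAle eq_sym x0 nrm_ge0.
  have := ubA ((nrm x)^-1%:C *: x).
  rewrite (linZ lF) !nrmZr gtr0_norm ?invr_gt0 // mulVf // => /(_ (lexx _)).
  by rewrite mulrC ler_pdivrMr.
have Cs : C' < sup A.
  rewrite ltNge; apply/negP => h; apply: nF; exact: opbound_le h hsF.
have sp : 0 < sup A by apply: le_lt_trans Cs.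
have s3 : 0 < sup A / 3 by rewrite divr_gt0.
have [_ [y y1 ->] hy] := sup_adherent s3 sA.
have hy' : sup A <= 3 / 2 * nrm (F y) by lra.
exists y; split => //; first by apply: le_trans (ltW Cs) _.
exact: opbound_le hy' hsF.
Qed.

(* Gliding hump: [u (n + 1) = u n +- 4^-n y n] with [y n] almost norming for an operator
   of norm at least [8^n]; the sign is chosen so that the hump survives. *)
Lemma uniform_boundedness (I : Type) (A : set I) (F : I -> V -> V) :
  (forall i, A i -> is_linear (F i) /\ exists C, opbound (F i) C) ->
  (forall x, exists C, forall i, A i -> nrm (F i x) <= C) ->
  exists2 C, 1 <= C & forall i, A i -> opbound (F i) C.
Proof.
move=> hF pb; apply: contrapT => nC.
have step (n : nat) : exists iy : I * V, [/\ A iy.1, nrm iy.2 <= 1,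
    8 ^+ n <= 3 / 2 * nrm (F iy.1 iy.2) & opbound (F iy.1) (3 / 2 * nrm (F iy.1 iy.2))].
  apply: contrapT => h; apply: nC; exists (8 ^+ n); first by rewrite exprn_ege1 // ler1n.
  move=> i Ai; apply: contrapT => nopb; have [li [C hC]] := hF i Ai.
  have [|y [y1 y2 y3]] := almost_norming li hC _ nopb; first by rewrite exprn_ge0.
  by apply: h; exists (i, y).
have [f hf] := choice step.
pose q : R := 4^-1.
pose u := fix u n := if n is k.+1 then
   if nrm (F (f k).1 (u k - (q ^+ k)%:C *: (f k).2)) <= nrm (F (f k).1 (u k + (q ^+ k)%:C *: (f k).2))
   then u k + (q ^+ k)%:C *: (f k).2 else u k - (q ^+ k)%:C *: (f k).2 else 0 : V.
have q0 : 0 < q by rewrite invr_gt0.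
have uS n : nrm (u n.+1 - u n) <= 1 * q ^+ n.
  have [_ y1 _ _] := hf n; rewrite /= mul1r.
  case: ifP => _; rewrite addrAC subrr add0r ?nrmN nrmZr ger0_norm ?exprn_ge0 ?(ltW q0) //;
  by rewrite -[leRHS]mulr1; apply: ler_wpM2l; rewrite ?exprn_ge0 ?(ltW q0).
have [|x hx hux] := @lims_geom _ _ 1 q u _ uS.
  by rewrite (ltW q0) /q invf_lt1 // ltr1n.
have big n : q ^+ n * nrm (F (f n).1 (f n).2) <= nrm (F (f n).1 (u n.+1)).
  have [Ai _ _ _] := hf n; have [li _] := hF _ Ai.
  have := nrmB (F (f n).1 (u n + (q ^+ n)%:C *: (f n).2)) (F (f n).1 (u n - (q ^+ n)%:C *: (f n).2)).
  rewrite -(linB li) (_ : _ - (u n - _) = (2 * q ^+ n)%:C *: (f n).2); last by lmod.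
  rewrite (linZ li) nrmZr ger0_norm ?mulr_ge0 ?exprn_ge0 ?(ltW q0) //=.
  by case: ifPn => [|/negbTE hle]; last move: hle; rewrite ?leNgt => *; lra.
have [C hC] := pb x.
(* The tail of the series has norm at most [q ^+ n / 3], so it destroys at most half of the hump,
   and what remains grows like [8 ^+ n * q ^+ n = 2 ^+ n]. *)
have key n : 2 ^+ n <= 3 * C.
  have [Ai y1 y2 y3] := hf n; have [li _] := hF _ Ai.
  have h1 := hux n.+1; have h2 := y3 (u n.+1 - x).
  have h3 := hC _ Ai; have h4 := big n.
  have h5 := nrm_sub_le (F (f n).1 (u n.+1)) (F (f n).1 x).
  move: h5; rewrite -(linB li) => h5.
  pose a := nrm (F (f n).1 (f n).2); rewrite -/a in y2 h2 h4.
  have a0 : 0 <= a by apply: nrm_ge0.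
  have qn0 : 0 < q ^+ n by rewrite exprn_gt0.
  have e1 : 2 ^+ n = 8 ^+ n * q ^+ n :> R by rewrite -exprMn; congr (_ ^+ n); rewrite /q; lra.
  have h6 : nrm (u n.+1 - x) <= q ^+ n / 3.
    apply: le_trans h1 _; rewrite exprS (_ : 1 * (q * q ^+ n) / (1 - q) = q ^+ n / 3) //.
    by rewrite /q; field.
  rewrite e1.
  have h7 : 3 / 2 * a * nrm (u n.+1 - x) <= 3 / 2 * a * (q ^+ n / 3).
    by apply: ler_wpM2l => //; rewrite mulr_ge0.
  have h8 : 8 ^+ n * q ^+ n <= 3 / 2 * a * q ^+ n by rewrite ler_wpM2r // ltW.
  lra.
have : 3 * C < 2 ^+ (Num.truncn (3 * C)).+1.
  apply: lt_le_trans (truncnS_gt _) _.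
  by rewrite -natrX ler_nat ltnW // ltn_expl.
by rewrite ltNge key.
Qed.

(** The last clause keeps the rate of the partial sums, because these become the Laurent expansion
    of the resolvent in [simple_pole]. *)
Lemma neumann (D : V -> V) q : is_linear D -> opbound D q -> 0 <= q -> q < 1 ->
  exists G : V -> V, [/\ is_linear G, opbound G (1 - q)^-1,
    forall x, G x - D (G x) = x, forall x, G (x - D x) = x &
    forall n x, nrm (\sum_(i < n) iter i D x - G x) <= q ^+ n / (1 - q) * nrm x].
Proof.
move=> lD hD q0 q1.
have hiter x i : nrm (iter i D x) <= nrm x * q ^+ i.
  elim: i => [|i IH]; first by rewrite mulr1.
  rewrite iterS exprS mulrCA; apply: le_trans (hD _) _; exact: ler_wpM2l.
have hex x : {l : V | lims (fun n => \sum_(i < n) iter i D x) l /\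
    forall n, nrm (\sum_(i < n) iter i D x - l) <= q ^+ n / (1 - q) * nrm x}.
  apply: cid.
  have [||l h1 h2] := @lims_geom R V (nrm x) q (fun n => \sum_(i < n) iter i D x).
  - by rewrite q0.
  - by move=> n; rewrite big_ord_recr /= addrAC subrr add0r.
  by exists l; split => // n; apply: le_trans (h2 n) _; rewrite -mulrA mulrC.
pose G x := projT1 (hex x).
have Gl x : lims (fun n => \sum_(i < n) iter i D x) (G x) by have [] := projT2 (hex x).
have Gb n x : nrm (\sum_(i < n) iter i D x - G x) <= q ^+ n / (1 - q) * nrm x.
  by have [] := projT2 (hex x).
have itlin i : is_linear (iter i D).
  by elim: i => [|i IH] a x y //=; rewrite IH lD.
have GD x : D (G x) = G (D x).
  apply: lims_unique (opbound_lims lD hD (Gl x)) _; apply: lims_eq (Gl (D x)) => n /=.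
  by rewrite (lin_sum lD); apply: eq_bigr => i _; rewrite -iterS iterSr.
have Glin : is_linear G.
  move=> a x y; apply: lims_unique (Gl _) _.
  apply: lims_eq (lims_add (lims_scale a (Gl x)) (Gl y)) => n.
  by rewrite scaler_sumr -big_split; apply: eq_bigr => i _; rewrite itlin.
have GDx x : G x - D (G x) = x.
  have h := lims_add (Gl x) (lims_scale (-1) (opbound_lims lD hD (Gl x))).
  rewrite -scaleN1r; apply: (lims_unique h) => e e0.
  have : (fun n => nrm x * q ^+ n) @ \oo --> (0 : R).
    by rewrite -(mulr0 (nrm x)); apply: cvgMr; apply: cvg_expr; rewrite ger0_norm.
  move/cvgrPdist_le => /(_ _ e0) [N _ hN]; exists N => n leNn /=.
  rewrite scaleN1r (lin_sum lD) -sumrB.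
  have -> : \sum_(i < n) (iter i D x - D (iter i D x)) = x - iter n D x.
    elim: n {leNn} => [|n IH]; first by rewrite big_ord0 subrr.
    by rewrite big_ord_recr /= IH addrA subrK.
  rewrite addrAC subrr add0r nrmN; apply: le_trans (hiter _ _) _.
  by have := hN n leNn; rewrite /= sub0r normrN; apply: le_trans; apply: ler_norm.
exists G; split => //.
  move=> x; have := Gb 0 x; rewrite big_ord0 sub0r nrmN expr0 mul1r; exact.
by move=> x; rewrite (linB Glin) -GD.
Qed.

Lemma neumann_comm (D G B : V -> V) : is_linear B -> is_linear G ->
  (forall x, G x - D (G x) = x) -> (forall x, G (x - D x) = x) ->
  (forall x, B (D x) = D (B x)) -> forall x, B (G x) = G (B x).
Proof.
move=> lB lG h1 h2 hc x.
by rewrite -{2}(h1 x) (linB lB) hc h2.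
Qed.

(** A complex exponent serves both to move the spectral bound to [0] and to cancel a rotation
    [e^{ibt}]. *)
Definition crescale S l : R -> V -> V := fun t x => cexp (- l) t *: S t x.

Lemma crescaleK S l : crescale (crescale S l) (- l) = S.
Proof.
apply/funext => t; apply/funext => x.
by rewrite /crescale scalerA opprK cexpN scale1r.
Qed.

Lemma rescaledE S (w : R) : rescaled S w = crescale S w%:C.
Proof.
apply/funext => t; apply/funext => x.
by rewrite /crescale /rescaled -rmorphN cexp_real mulNr.
Qed.

Lemma crescale_lb S l : lb_semigroup S -> lb_semigroup (crescale S l).
Proof.
case=> [h1 h2 h3 h4 h5]; split.
- by move=> t t0 a x y; rewrite /crescale (h1 t t0) scalerDr !scalerA mulrC.
- by move=> x; rewrite /crescale h2 cexp0 scale1r.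
- move=> t s x t0 s0; rewrite /crescale h3 // (linZ (h1 t t0)) scalerA cexpD //.
- move=> x e e0; have n1 : 0 < nrm x + 1 by rewrite ltr_wpDl ?nrm_ge0.
  have e4 : 0 < e / 4 by rewrite divr_gt0.
  have m0 : 0 < Num.min 1 (e / 2 / (nrm x + 1)) by rewrite lt_min ltr01 !divr_gt0.
  have [d d0 hd] := cexp_cont0 (- l) m0; have [d' d0' hd'] := h4 x _ e4.
  exists (Num.min d d'); first by rewrite lt_min d0.
  move=> h h0; rewrite lt_min => /andP [hd1 hd2].
  have := hd h h0 hd1; rewrite le_min => /andP [c1 c2].
  have -> : crescale S l h x - x = cexp (- l) h *: (S h x - x) + (cexp (- l) h - 1) *: x.
    by rewrite /crescale; lmod.
  apply: le_trans (nrmD _ _) _; rewrite !nrmZ (splitr e) lerD //.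
    have c3 : cabs (cexp (- l) h) <= 2.
      have := cabsD (cexp (- l) h - 1) 1; rewrite subrK => /le_trans; apply.
      by rewrite [cabs 1]cabs_real normr1 -[2]/(1 + 1) lerD2r.
    apply: (@le_trans _ _ (2 * (e / 4))); last by lra.
    by apply: ler_pM; rewrite ?cabs_ge0 ?nrm_ge0 // hd'.
  apply: (@le_trans _ _ (e / 2 / (nrm x + 1) * (nrm x + 1))); last by rewrite divfK // lt0r_neq0.
  by apply: ler_pM; rewrite ?cabs_ge0 ?nrm_ge0 // lerDl.
- move=> L; have [M M1 hM] := h5 L; exists (expR (`|complex.Re (- l)| * `|L|) * M).
    rewrite -[1]mulr1; apply: ler_pM => //; apply: le_trans (expR_ge1Dx _).
    by rewrite lerDl mulr_ge0.
  move=> t t0 tL x; rewrite /crescale nrmZ cabs_cexp -mulrA; apply: ler_pM; rewrite ?expR_ge0 ?nrm_ge0 //.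
    rewrite ler_expR; apply: le_trans (ler_norm _) _; rewrite normrM ler_wpM2l //.
    by rewrite ger0_norm // (le_trans tL) // ler_norm.
  exact: hM.
Qed.

Lemma gen_crescale S l x y : gen S x y -> gen (crescale S l) x (y - l *: x).
Proof.
move=> hg e e0; have n1 : 0 < nrm x + 1 by rewrite ltr_wpDl ?nrm_ge0.
have n2 : 0 < nrm y + 1 by rewrite ltr_wpDl ?nrm_ge0.
have e3 : 0 < e / 3 by rewrite divr_gt0.
have e6 : 0 < e / 6 by rewrite divr_gt0.
have m0 : 0 < Num.min 1 (e / 3 / (nrm y + 1)) by rewrite lt_min ltr01 !divr_gt0.
have [d1 d10 hd1] := cexp_cont0 (- l) m0.
have [d2 d20 hd2] := cexp_derive (- l) (divr_gt0 e3 n1).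
have [d3 d30 hd3] := hg _ e6.
exists (Num.min d1 (Num.min d2 d3)); first by rewrite !lt_min d10 d20.
move=> h h0; rewrite !lt_min => /and3P [t1 t2 t3].
have := hd1 h (ltW h0) t1; rewrite le_min => /andP [c1 c2].
have c3 : cabs (cexp (- l) h) <= 2.
  have := cabsD (cexp (- l) h - 1) 1; rewrite subrK => /le_trans; apply.
  by rewrite [cabs 1]cabs_real normr1 -[2]/(1 + 1) lerD2r.
have -> : h^-1%:C *: (crescale S l h x - x) - (y - l *: x) =
   cexp (- l) h *: (h^-1%:C *: (S h x - x) - y) + (cexp (- l) h - 1) *: y +
   (h^-1%:C * (cexp (- l) h - 1) - - l) *: x.
  by rewrite /crescale; lmod.
have -> : e = e / 3 + e / 3 + e / 3 by lra.
apply: le_trans (nrmD _ _) _; apply: lerD.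
  apply: le_trans (nrmD _ _) _; rewrite !nrmZ; apply: lerD.
    apply: (@le_trans _ _ (2 * (e / 6))); last by lra.
    by apply: ler_pM; rewrite ?cabs_ge0 ?nrm_ge0 // hd3.
  apply: (@le_trans _ _ (e / 3 / (nrm y + 1) * (nrm y + 1))); last by rewrite divfK // lt0r_neq0.
  by apply: ler_pM; rewrite ?cabs_ge0 ?nrm_ge0 // lerDl.
rewrite nrmZ; apply: (@le_trans _ _ (e / 3 / (nrm x + 1) * (nrm x + 1))); last by rewrite divfK // lt0r_neq0.
by apply: ler_pM; rewrite ?cabs_ge0 ?nrm_ge0 ?lerDl // hd2.
Qed.

Lemma gen_crescaleP S l x y : gen (crescale S l) x y <-> gen S x (y + l *: x).
Proof.
split=> h; last by have := gen_crescale l h; rewrite addrK.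
by have := gen_crescale (- l) h; rewrite crescaleK scaleNr opprK.
Qed.

Lemma is_resolvent_crescale S l m (Rl : V -> V) :
  is_resolvent (crescale S m) l Rl <-> is_resolvent S (l + m) Rl.
Proof.
split=> -[h1 h2 h3]; split => //.
- move=> y; apply/generatorP; have /generatorP := h2 y; move/gen_crescaleP.
  by rewrite scalerDl addrAC.
- move=> x y /generatorP hg; rewrite -{2}(h3 x (y - m *: x)).
    by congr (Rl _); lmod.
  by apply/generatorP; apply: gen_crescale.
- move=> y; apply/generatorP/gen_crescaleP; have /generatorP := h2 y.
  by rewrite scalerDl addrAC.
- move=> x y /generatorP /gen_crescaleP hg; rewrite -{2}(h3 x (y + m *: x)).
    by congr (Rl _); lmod.
  exact/generatorP.
Qed.

(** The integral over [[0, L]] maps into the domain, and the generator applied to it is [S L - 1].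
    Composed with the Neumann inverse of [1 - S L] it inverts the negative generator. *)
Lemma resolvent_contraction S L q : lb_semigroup S -> 0 < L -> 0 <= q -> q < 1 -> opbound (S L) q ->
  exists Rl, is_resolvent S 0 Rl.
Proof.
move=> sg L0 q0 q1 hq; have L0' := ltW L0.
have [slin _ _ _ _] := sg; have lS := slin L L0'.
have [G [lG bG GD DG _]] := neumann lS hq q0 q1.
have [C C0 hC] := integ_bdd sg L0'.
exists (fun y => integ S L (G y)); split.
- split; first by move=> a x y; rewrite lG (integ_lin sg).
  exists (C * (1 - q)^-1) => x; apply: le_trans (hC _) _; rewrite -mulrA.
  by apply: ler_wpM2l.
- move=> y; apply/generatorP; rewrite scale0r sub0r -{2}(GD y) opprB.
  exact: gen_integ.
- move=> x y /generatorP hg; rewrite scale0r sub0r.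
  have hc := neumann_comm (integ_lin sg L0') lG GD DG.
  rewrite hc; last by move=> z; rewrite (integ_S sg).
  by rewrite (linN (integ_lin sg L0')) (integ_gen sg L0' hg) opprB DG.
Qed.

Lemma resolvent_set_contraction S l L q : lb_semigroup S -> 0 < L -> 0 <= q -> q < 1 ->
  opbound (crescale S l L) q -> resolvent_set S l.
Proof.
move=> sg L0 q0 q1 hq; have [Rl hR] := resolvent_contraction (crescale_lb l sg) L0 q0 q1 hq.
by exists Rl; have /is_resolvent_crescale := hR; rewrite add0r.
Qed.

Lemma resolvent_set_growth S l (M w : R) : lb_semigroup S ->
  (forall t, 0 <= t -> opbound (S t) (M * expR (w * t))) -> w < complex.Re l ->
  resolvent_set S l.
Proof.
move=> sg hM wl; pose c := complex.Re l - w; have c0 : 0 < c by rewrite subr_gt0.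
(* For this [L], [expR (c * L) >= 1 + c * L = |M| + 2], which outweighs the constant [M]. *)
pose L := (`|M| + 1) / c; have L0 : 0 < L by rewrite divr_gt0 // ltr_wpDl.
have L0' := ltW L0.
apply: (@resolvent_set_contraction S l L (`|M| * expR (- (c * L)))) => //.
- rewrite expRN ltr_pdivrMr ?expR_gt0 // mul1r.
  apply: lt_le_trans (expR_ge1Dx _); rewrite /L mulrC divfK ?lt0r_neq0 //.
  by rewrite addrC -addrA ltrDl.
- move=> x; rewrite /crescale nrmZ cabs_cexp; apply: le_trans (ler_wpM2l (expR_ge0 _) (hM L L0' x)) _.
  clearbody L.
  have -> : - (c * L) = complex.Re (- l) * L + w * L by rewrite /c raddfN /=; ring.
  rewrite expRD [leLHS](_ : _ = M * (expR (complex.Re (- l) * L) * expR (w * L) * nrm x)); last by ring.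
  by rewrite -[leRHS]mulrA ler_wpM2r ?mulr_ge0 ?expR_ge0 ?nrm_ge0 // ler_norm.
Qed.

(** Orbits are continuous and thus bounded on the compact interval [[0, L]]; uniform boundedness
    turns these pointwise bounds into one for the operators. *)
Lemma C0_lb S : C0_semigroup S -> lb_semigroup S.
Proof.
move=> [h1 h2 h3 h4].
have hlin t : 0 <= t -> is_linear (S t) by move/h1 => [].
have cont x t0 e : 0 <= t0 -> 0 < e -> exists2 d, 0 < d &
    forall t, 0 <= t -> `|t - t0| < d -> nrm (S t x - S t0 x) <= e.
  move=> t00 e0; have /cvgrPdist_le /(_ e%:C) := h4 x t0 t00.
  rewrite ltcR => /(_ e0) [d /= d0 hd]; exists d => // t t1 td.
  by rewrite nrmBC nrm_le; apply: hd => //; rewrite /= distrC.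
split => //.
  move=> x e e0; have [d d0 hd] := cont x 0 e (lexx _) e0; exists d => // h hh hlt.
  by have := hd h hh; rewrite subr0 ger0_norm // h2; apply.
move=> L.
have [|x|C C1 hC] := @uniform_boundedness R [set t | 0 <= t <= L] S.
- by move=> t /andP [t0 _]; have [l [M hM]] := h1 t t0; split => //; exists M.
- have : compact `[0, L] by exact: segment_compact.
  move/compact_near_coveringP => /(_ R (pinfty_nbhs R) (fun M t => 0 <= t -> nrm (S t x) <= M)).
  case.
    move=> t /=; rewrite in_itv /= => /andP [t0 tL].
    have [d d0 hd] := cont x t 1 t0 ltr01.
    exists ([set s | `|s - t| < d], [set M | nrm (S t x) + 1 < M]).
      split; first by exists d => //= s /=; rewrite distrC.
      by exists (nrm (S t x) + 1); split => //; apply: num_real.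
    move=> [s M] [/= hs hM] s0; apply: le_trans (ltW hM).
    apply: le_trans (nrm_sub_le _ (S t x)) _; rewrite addrC lerD2l; exact: hd.
  move=> M [_ hM]; exists (M + 1) => t /andP [t0 tL].
  by apply: (hM (M + 1)) => //; rewrite ?ltrDl //= in_itv /= t0.
- by exists C => // t t0 tL; apply: hC; apply/andP.
Qed.

End Operators.

(** * Positivity excludes rotation *)

Section Lattice.
Variables (R : realType) (V : completeNormedModType R[i]) (Er P : set V).
Hypothesis lat : complex_banach_lattice Er P.
Implicit Types (x y z u v : V) (t s e : R).

Ltac lmod := lmod_with R[i] V ltac:(try ring).

Lemma Er0 : Er 0. Proof. by case: lat => [[]]. Qed.
Lemma ErD x y : Er x -> Er y -> Er (x + y). Proof. by case: lat => [[_ h _] _ _ _ _]; apply: h. Qed.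
Lemma ErZ (r : R) x : Er x -> Er (r%:C *: x). Proof. by case: lat => [[_ _ h] _ _ _ _]; apply: h. Qed.
Lemma ErN x : Er x -> Er (- x).
Proof. by move=> /(ErZ (-1)); rewrite rmorphN scaleN1r. Qed.
Lemma ErB x y : Er x -> Er y -> Er (x - y).
Proof. by move=> hx /ErN; apply: ErD. Qed.
Lemma PEr x : P x -> Er x. Proof. by case: lat => _ _ [h _ _ _] _ _; apply: h. Qed.
Lemma PD x y : P x -> P y -> P (x + y). Proof. by case: lat => _ _ [_ h _ _] _ _; apply: h. Qed.
Lemma PZ (r : R) x : 0 <= r -> P x -> P (r%:C *: x). Proof. by case: lat => _ _ [_ _ h _] _ _; apply: h. Qed.

(** The supremum of [0] and [0] lies in [P], and so does its multiple by [0]. *)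
Lemma P0 : P 0.
Proof.
case: lat => _ _ _ h _; have [m [_ [hm _]]] := h 0 0 Er0 Er0.
have /hm : [set (0 : V); 0] 0 by left.
by rewrite /lat_le subr0 => /(PZ (lexx 0)); rewrite scale0r.
Qed.

Lemma P_add v x y : P x -> P y -> v = x + y -> P v.
Proof. by move=> hx hy ->; apply: PD. Qed.

Lemma P_half x : P (x + x) -> P x.
Proof.
move=> h; have : P (2^-1%:C *: (x + x)) by apply: PZ h; rewrite invr_ge0.
by rewrite (_ : 2^-1%:C *: (x + x) = x) //; lmod; field.
Qed.

Lemma P_sum (n : nat) (f : nat -> V) : (forall i, (i < n)%N -> P (f i)) -> P (\sum_(i < n) f i).
Proof.
elim: n => [|n IH] h; first by rewrite big_ord0; apply: P0.
by rewrite big_ord_recr; apply: PD; [apply: IH => i /ltnW /h|apply: h].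
Qed.

(** The implication inside the existential makes the positive part [pos] total on [V], with an
    arbitrary value outside [Er]. *)
Lemma pos_ex x : exists p, Er x -> [/\ P p, P (p - x) &
  forall z, P z -> P (z - x) -> P (z - p)].
Proof.
have [hx|hx] := pselect (Er x); last by exists 0 => /hx.
case: lat => _ _ _ h _; have [m [_ [hm1 hm2]]] := h x 0 hx Er0.
exists m => _; split.
- by have := hm1 0 (or_intror erefl); rewrite /lat_le subr0.
- exact: (hm1 x (or_introl erefl)).
- move=> z hz hzx; apply: hm2; first exact: PEr.
  by move=> _ [->|->] //; rewrite /lat_le subr0.
Qed.

Definition pos x := projT1 (cid (pos_ex x)).
Lemma pos_ge0 x : Er x -> P (pos x). Proof. by move=> /(projT2 (cid (pos_ex x))) []. Qed.
Lemma pos_ge x : Er x -> P (pos x - x). Proof. by move=> /(projT2 (cid (pos_ex x))) []. Qed.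
Lemma pos_least x z : Er x -> P z -> P (z - x) -> P (z - pos x).
Proof. by move=> /(projT2 (cid (pos_ex x))) [_ _]; apply. Qed.

Lemma abs_ex x : exists a, Er x -> is_modulus Er P x a.
Proof.
have [hx|hx] := pselect (Er x); last by exists 0 => /hx.
by case: lat => _ _ _ h _; have [m hm] := h x (- x) hx (ErN hx); exists m.
Qed.

Definition abs x := projT1 (cid (abs_ex x)).
Lemma abs_mod x : Er x -> is_modulus Er P x (abs x).
Proof. exact: (projT2 (cid (abs_ex x))). Qed.

Lemma mod_ge x a : is_modulus Er P x a -> [/\ P (a - x), P (a + x) & P a].
Proof.
move=> [_ [h _]]; have h1 : P (a - x) by apply: (h x); left.
have h2 : P (a + x) by have := h (- x) (or_intror erefl); rewrite /lat_le opprK.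
by split => //; apply: P_half; apply: P_add h1 h2 _; lmod.
Qed.

Lemma abs_ge x : Er x -> P (abs x - x). Proof. by move/abs_mod/mod_ge => []. Qed.
Lemma abs_geN x : Er x -> P (abs x + x). Proof. by move/abs_mod/mod_ge => []. Qed.
Lemma abs_ge0 x : Er x -> P (abs x). Proof. by move/abs_mod/mod_ge => []. Qed.

Lemma mod_pos a : P a -> is_modulus Er P a a.
Proof.
move=> ha; split; first exact: PEr.
split=> [u [->|->]|b hb hu]; rewrite /lat_le ?subrr; first exact: P0.
  by rewrite opprK; apply: PD.
by apply: hu; left.
Qed.

Lemma nrm_mono x y a b : Er x -> Er y -> is_modulus Er P x a -> is_modulus Er P y b ->
  P (b - a) -> nrm x <= nrm y.
Proof. by case: lat => _ _ _ _ [h _]; apply: h. Qed.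

Lemma nrm_le_pos x y : P x -> P (y - x) -> nrm x <= nrm y.
Proof.
move=> hx hxy; have hy : P y by apply: P_add hx hxy _; lmod.
by apply: (nrm_mono (a := x) (b := y)) => //; try exact: PEr; apply: mod_pos.
Qed.

Lemma nrm_mod x a : Er x -> is_modulus Er P x a -> nrm a = nrm x.
Proof.
move=> hx ha; have [_ _ Pa] := mod_ge ha.
have aa := mod_pos Pa; have ea := PEr Pa.
have aa0 : P (a - a) by rewrite subrr; apply: P0.
by apply/eqP; rewrite eq_le (nrm_mono ea hx aa ha aa0) (nrm_mono hx ea ha aa aa0).
Qed.

Lemma nrm_abs x : Er x -> nrm (abs x) = nrm x.
Proof. by move=> hx; apply: nrm_mod => //; apply: abs_mod. Qed.

Lemma decomp_ex z : exists xy : V * V, [/\ Er xy.1, Er xy.2 & z = xy.1 + 'i *: xy.2].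
Proof. by case: lat => _ [h _] _ _ _; have [x [y ?]] := h z; exists (x, y). Qed.

Definition rp z := (projT1 (cid (decomp_ex z))).1.
Definition ip z := (projT1 (cid (decomp_ex z))).2.
Lemma rp_Er z : Er (rp z). Proof. by have [] := projT2 (cid (decomp_ex z)). Qed.
Lemma ip_Er z : Er (ip z). Proof. by have [] := projT2 (cid (decomp_ex z)). Qed.
Lemma rip z : z = rp z + 'i *: ip z. Proof. by have [] := projT2 (cid (decomp_ex z)). Qed.

Lemma decomp_unique x y x' y' : Er x -> Er y -> Er x' -> Er y' ->
  x + 'i *: y = x' + 'i *: y' -> x = x' /\ y = y'.
Proof.
case: lat => _ [_ h] _ _ _ h1 h2 h3 h4 heq.
have [] := h (x - x') (y - y') (ErB h1 h3) (ErB h2 h4).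
  have : x + 'i *: y - (x' + 'i *: y') = 0 by rewrite heq subrr.
  by move=> h0; rewrite -[RHS]h0; lmod.
by move=> /eqP; rewrite subr_eq0 => /eqP -> /eqP; rewrite subr_eq0 => /eqP ->.
Qed.

(** The angles [0] and [pi / 2] occur in the supremum that defines the complex norm. *)
Lemma nrm_real_parts x y : Er x -> Er y ->
  nrm x <= nrm (x + 'i *: y) /\ nrm y <= nrm (x + 'i *: y).
Proof.
move=> hx hy; case: lat => _ _ _ _ [_ h]; have [m [[Em [hm _]] ->]] := h x y hx hy.
have key v th : Er v -> (cos th)%:C *: x + (sin th)%:C *: y = v -> nrm v <= nrm m.
  move=> hv hth; have : P (m - abs v).
    by apply: hm; exists th; rewrite hth; apply: abs_mod.
  by move/(nrm_le_pos (abs_ge0 hv)); rewrite nrm_abs.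
split; first by apply: (key x 0) => //; rewrite cos0 sin0 scale1r scale0r addr0.
by apply: (key y (pi / 2)) => //; rewrite cos_pihalf sin_pihalf scale1r scale0r add0r.
Qed.

Lemma nrm_ip z : nrm (ip z) <= nrm z.
Proof. by rewrite [X in _ <= nrm X]rip; have [] := nrm_real_parts (rp_Er z) (ip_Er z). Qed.

Lemma nrm_rip z : nrm z <= nrm (rp z) + nrm (ip z).
Proof. by rewrite {1}[z]rip; apply: le_trans (nrmD _ _) _; rewrite nrmZ cabsi mul1r. Qed.

(** For [y] in [Er] the imaginary part of [x] is that of [x - y], hence arbitrarily small. *)
Lemma Er_closed x : (forall e, 0 < e -> exists2 y, Er y & nrm (x - y) <= e) -> Er x.
Proof.
move=> h; have ix : ip x = 0.
  apply: nrm_small => e /h [y Ey hy]; apply: le_trans hy.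
  have [_ ->] : rp (x - y) = rp x - y /\ ip x = ip (x - y); last exact: nrm_ip.
    have [] := @decomp_unique (rp (x - y)) (ip (x - y)) (rp x - y) (ip x).
    - exact: rp_Er.
    - exact: ip_Er.
    - by apply: ErB => //; apply: rp_Er.
    - exact: ip_Er.
    - by rewrite -rip {1}[x]rip addrAC.
    by [].
by rewrite [x]rip ix scaler0 addr0; apply: rp_Er.
Qed.

(** For [y] in [P] the negative part of [x] lies below the modulus of [y - x], hence it vanishes. *)
Lemma P_closed x : (forall e, 0 < e -> exists2 y, P y & nrm (x - y) <= e) -> P x.
Proof.
move=> h; have ex : Er x.
  by apply: Er_closed => e /h [y /PEr hy ?]; exists y.
have n0 : pos (- x) = 0.
  apply: nrm_small => e /h [y Py hy]; apply: le_trans hy.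
  have eyx : Er (y - x) by apply: ErB => //; apply: PEr.
  rewrite nrmBC -(nrm_abs eyx); apply: nrm_le_pos; first exact/pos_ge0/ErN.
  apply: pos_least; [exact: ErN|exact: abs_ge0|].
  by apply: P_add (abs_ge eyx) Py _; lmod.
by have := pos_ge (ErN ex); rewrite n0 sub0r opprK.
Qed.

Lemma fin_sup (f : nat -> V) (n : nat) : (forall i, Er (f i)) ->
  exists M, [/\ Er M, forall i, (i <= n)%N -> P (M - f i) &
    forall z, Er z -> (forall i, (i <= n)%N -> P (z - f i)) -> P (z - M)].
Proof.
move=> hf; elim: n => [|n [M [h1 h2 h3]]].
  exists (f 0); split => // [i|z _]; last by apply.
  by rewrite leqn0 => /eqP ->; rewrite subrr; apply: P0.
case: lat => _ _ _ h _; have [m [Em [hm1 hm2]]] := h M (f n.+1) h1 (hf _).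
exists m; split => // [i|z Ez hz].
  rewrite leq_eqVlt => /orP [/eqP ->|]; first by apply: hm1; right.
  rewrite ltnS => /h2 hi; have hM : P (m - M) by apply: (hm1 M); left.
  by apply: P_add hi hM _; lmod.
apply: hm2 => // _ [->|->]; last exact: hz.
by apply: h3 => // i /leqW; apply: hz.
Qed.

(* The only consequence of [u /\ v = 0] that the argument uses. *)
Definition disj u v := forall z, P z -> P (v + z - u) -> P (z - u).

(** [pos y] lies below the negative part [pos x - x] of [x]. So [pos x <= pos y + z] gives [x <= z],
    and with [z] positive [pos x <= z]. *)
Lemma disj_pos x y : Er x -> Er y -> P (- (x + y)) -> disj (pos x) (pos y).
Proof.
move=> hx hy hxy z hz hle; apply: pos_least => //.
have hq : P (pos x - x - pos y).
  apply: pos_least => //; first exact: pos_ge.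
  by apply: P_add (pos_ge0 hx) hxy _; lmod.
by apply: P_add hq hle _; lmod.
Qed.

Lemma disj_sum u (v : nat -> V) (n : nat) : (forall i, (i < n)%N -> P (v i)) ->
  (forall i, (i < n)%N -> disj u (v i)) -> disj u (\sum_(i < n) v i).
Proof.
elim: n => [|n IH] hv hd z hz; first by rewrite big_ord0 add0r.
rewrite big_ord_recr /= => hle; apply: (hd n (ltnSn n)) => //.
apply: IH => [i /ltnW|i /ltnW||]; [exact: hv|exact: hd| |].
  by apply: PD => //; apply: hv.
by rewrite addrA.
Qed.

(** A sum of disjoint elements behaves like their supremum. This keeps the later bounds free of the
    number of peaks. *)
Lemma disj_sum_le z (w : nat -> V) (n : nat) : P z ->
  (forall i, (i < n)%N -> P (w i)) -> (forall i, (i < n)%N -> P (z - w i)) ->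
  (forall i j, (i < j)%N -> (j < n)%N -> disj (w j) (w i)) -> P (z - \sum_(i < n) w i).
Proof.
move=> hz; elim: n => [|n IH] hw hzw hd; first by rewrite big_ord0 subr0.
have h : P (z - \sum_(i < n) w i).
  apply: IH => [i /ltnW|i /ltnW|i j hij /ltnW]; [exact: hw|exact: hzw|exact: hd].
rewrite big_ord_recr opprD addrA /=.
have hdj : disj (w n) (\sum_(i < n) w i).
  by apply: disj_sum => i hi; [apply: hw; apply: ltnW|apply: hd].
by apply: hdj => //; rewrite [X in P (X - _)]addrC subrK; apply: hzw.
Qed.

(** * Peaks of the rotated vectors *)

Section Rotation.
Variables (a b : V) (k : nat).
Hypotheses (Ea : Er a) (Eb : Er b) (k2 : (1 < k)%N).

(** A full circle has [4 * k] steps, so residues modulo [4] make sense on it, and [k] steps are a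
    quarter turn. *)
Definition step : R := pi / (2 * k)%:R.
(** The real part of [e^{i theta} (a + i b)] at the angle [theta = i * step]. *)
Definition rot (i : nat) : V := (cos (i%:R * step))%:C *: a - (sin (i%:R * step))%:C *: b.

Let k0 : (0 < 2 * k)%N. Proof. by rewrite muln_gt0 /= ltnW. Qed.

Lemma step_k : (2 * k)%:R * step = pi.
Proof. by rewrite /step mulrC divfK // pnatr_eq0 -lt0n. Qed.

Lemma step_gt0 : 0 < step.
Proof. by rewrite divr_gt0 ?pi_gt0 // ltr0n. Qed.

Lemma step_le : step <= pi / 4.
Proof.
rewrite ler_pM2l ?pi_gt0 // lef_pV2 ?posrE ?ltr0n //.
by rewrite (ler_nat R 4); lia.
Qed.

Lemma cos_step_gt0 : 0 < cos step.
Proof.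
apply: cos_gt0_pihalf; have := pi_gt0 R; have := step_le; have := step_gt0 => *; apply/andP; split; lra.
Qed.

Lemma cos_step_lt1 : cos step < 1.
Proof.
rewrite -cos0 ltr_cos ?in_itv /=; first exact: step_gt0.
  by rewrite lexx pi_ge0.
have := pi_gt0 R; have := step_le; have := step_gt0 => *; apply/andP; split; lra.
Qed.

Lemma rot_Er i : Er (rot i).
Proof. by apply: ErB; apply: ErZ. Qed.

Lemma rot_half i : rot (i + 2 * k) = - rot i.
Proof. by rewrite /rot natrD mulrDl step_k cosDpi sinDpi; lmod. Qed.

Lemma rot_full i : rot (i + 4 * k) = rot i.
Proof.
rewrite (_ : 4 * k = 2 * k + 2 * k)%N; last by lia.
by rewrite addnA !rot_half opprK.
Qed.

Lemma rot_fullM i n : rot (i + n * (4 * k)) = rot i.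
Proof. by elim: n => [|n IH]; rewrite ?addn0 // mulSn addnCA addnC rot_full. Qed.

(** The distance is even so that the midpoint is again a grid angle, where [M] is known to
    dominate. *)
Lemma rot_add i d : rot i + rot (i + 2 * d) = (2 * cos (d%:R * step))%:C *: rot (i + d).
Proof.
pose u := (i + d)%:R * step; pose v := d%:R * step.
have -> : rot i = (cos (u - v))%:C *: a - (sin (u - v))%:C *: b.
  by rewrite /rot /u /v natrD -mulrBl addrK.
have -> : rot (i + 2 * d) = (cos (u + v))%:C *: a - (sin (u + v))%:C *: b.
  by rewrite /rot /u /v -mulrDl -natrD -addnA addnn mul2n.
rewrite /rot -/u -/v cosB cosD sinB sinD; lmod.
Qed.

Lemma cos_mid d : (0 < d)%N -> (d < 2 * k)%N -> `|cos (d%:R * step)| <= cos step.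
Proof.
move=> d0 dk; have p0 := pi_gt0 R; have s0 := step_gt0; have sl := step_le.
have h1 : step <= d%:R * step by rewrite ler_peMl ?(ltW s0) // ler1n.
have h2 : d%:R * step <= pi - step.
  rewrite lerBrDr -{2}(mul1r step) -mulrDl -step_k ler_wpM2r ?(ltW s0) //.
  by rewrite natr1 ler_nat.
have mono (x y : R) : 0 <= x -> x <= y -> y <= pi -> cos y <= cos x.
  move=> x0 xy yp; rewrite leNgt ltr_cos ?in_itv /= ?x0 ?yp ?andbT -?leNgt //.
    exact: le_trans x0 xy.
  exact: le_trans xy yp.
rewrite ler_norml; apply/andP; split; last by apply: mono => //; lra.
rewrite lerNl (_ : - cos _ = cos (pi - d%:R * step)); first by apply: mono; lra.
by rewrite cosB cospi sinpi; ring.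
Qed.

Variable M : V.
Hypotheses (EM : Er M) (Mge : forall i, P (M - rot i))
  (Mle : forall z, Er z -> (forall i, (i < 4 * k)%N -> P (z - rot i)) -> P (z - M)).

Let c := cos step.
Let c0 : 0 < c. Proof. exact: cos_step_gt0. Qed.
Let c1 : c < 1. Proof. exact: cos_step_lt1. Qed.

(* [peak i] is the part of [rot i] within the fraction [1 - cos step] of the supremum [M];
   peaks at distance strictly between [0] and [2 k] are disjoint. *)
Definition peak (i : nat) : V := pos (rot i - c%:C *: M).
Definition comb (r : nat) : V := \sum_(l < k) peak (4 * l + r).

Lemma M_ge0 : P M.
Proof.
apply: P_half; apply: P_add (Mge 0) (Mge (0 + 2 * k)%N) _.
by rewrite rot_half; lmod.
Qed.

Lemma peak_arg_Er i : Er (rot i - c%:C *: M).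
Proof. by apply: ErB; [apply: rot_Er|apply: ErZ]. Qed.

Lemma peak_ge0 i : P (peak i).
Proof. exact/pos_ge0/peak_arg_Er. Qed.

Lemma peak_le i : P ((1 - c)%:C *: M - peak i).
Proof.
apply: pos_least; first exact: peak_arg_Er.
  by apply: PZ; [rewrite subr_ge0 ltW|apply: M_ge0].
by rewrite (_ : _ - _ = M - rot i) //; lmod.
Qed.

Lemma peak_full i : peak (i + 4 * k) = peak i.
Proof. by rewrite /peak rot_full. Qed.

Lemma comb_ge0 r : P (comb r).
Proof. by apply: (P_sum (f := fun l => peak (4 * l + r))) => i _; apply: peak_ge0. Qed.

Lemma comb_shift r : comb (r + 4) = comb r.
Proof.
rewrite /comb; case: k k2 peak_full => // n _ hfull.
rewrite big_ord_recr big_ord_recl /= muln0 add0n addrC; congr (_ + _).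
  by rewrite -(hfull r); congr peak; lia.
by apply: eq_bigr => i _; congr peak; rewrite /bump leq0n; lia.
Qed.

Lemma comb_shiftM r n : comb (r + 4 * n) = comb r.
Proof. by elim: n => [|n IH]; rewrite ?muln0 ?addn0 // mulnS addnCA addnC comb_shift. Qed.

(** The two rotated vectors add up to [2 q] times the one at the midpoint with [|q| <= c], hence to
    at most [2 c M]. So the arguments of the two positive parts have a sum below [0]. For [q < 0]
    the antipode of the midpoint is used. *)
Lemma peak_disj i d : (0 < d)%N -> (d < 2 * k)%N ->
  disj (peak i) (peak (i + 2 * d)) /\ disj (peak (i + 2 * d)) (peak i).
Proof.
move=> d0 dk; have hc := cos_mid d0 dk; set q := cos (d%:R * step) in hc.
have key : P (- ((rot i - c%:C *: M) + (rot (i + 2 * d) - c%:C *: M))).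
  have -> : - ((rot i - c%:C *: M) + (rot (i + 2 * d) - c%:C *: M)) =
      (2 * c)%:C *: M - (rot i + rot (i + 2 * d)) by lmod.
  rewrite rot_add -/q; have [q0|q0] := leP 0 q.
    have h1 : 0 <= 2 * (c - q) by move: hc; rewrite ger0_norm // -/c => ?; lra.
    apply: P_add (PZ h1 M_ge0) (PZ (mulr_ge0 (ler0n R 2) q0) (Mge (i + d)%N)) _; lmod.
  have h1 : 0 <= 2 * (c + q) by move: hc; rewrite ltr0_norm // -/c => ?; lra.
  have h2 : 0 <= 2 * (- q) by lra.
  have := Mge (i + d + 2 * k)%N; rewrite rot_half opprK => h3.
  by apply: P_add (PZ h1 M_ge0) (PZ h2 h3) _; lmod.
split; apply: disj_pos => //; try exact: peak_arg_Er.
by rewrite addrC.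
Qed.

(** Indices that agree modulo [4] give disjoint peaks, so the bound for one peak holds for their
    sum, without a factor [k]. *)
Lemma comb_le r : (r < 4)%N -> P ((1 - c)%:C *: M - comb r).
Proof.
move=> r4; apply: (disj_sum_le (w := fun l => peak (4 * l + r))).
- by apply: PZ; [rewrite subr_ge0 ltW|apply: M_ge0].
- by move=> i _; apply: peak_ge0.
- by move=> i _; apply: peak_le.
- move=> i j ij jk; have [||_] := @peak_disj (4 * i + r) (2 * (j - i)).
  + by rewrite muln_gt0 subn_gt0 ij.
  + by rewrite ltn_pmul2l // (leq_ltn_trans (leq_subr _ _)).
  rewrite (_ : 4 * i + r + 2 * (2 * (j - i)) = 4 * j + r)%N //.
  by rewrite mulnA addnAC -mulnDr subnKC // ltnW.
Qed.

Lemma peak_le_comb l r : (l < k)%N -> P (comb r - peak (4 * l + r)).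
Proof.
move=> lk; rewrite /comb (bigD1 (Ordinal lk)) //= addrAC subrr add0r.
elim/big_ind: _ => [|x y|i _]; [exact: P0|exact: PD|exact: peak_ge0].
Qed.

(** An index divisible by [4] and one that is [2] modulo [4] are distinct and at even distance, so
    the peaks of one group are disjoint from those of the other. *)
Lemma comb_disj : disj (comb 0) (comb 2).
Proof.
move=> z hz hle.
have dj i j : (i < k)%N -> (j < k)%N ->
    disj (peak (4 * i + 0)) (peak (4 * j + 2)).
  move=> ik jk; have [ij|ji] := leqP i j.
    have [||h _] := @peak_disj (4 * i + 0) (2 * (j - i) + 1).
    - by rewrite addn1.
    - by have := leq_subr i j; lia.
    by move: h; congr (disj _ (peak _)); lia.
  have [||_ h] := @peak_disj (4 * j + 2) (2 * (i - j) - 1).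
  - by lia.
  - by lia.
  by move: h; congr (disj (peak _) _); lia.
apply: (disj_sum_le (w := fun l => peak (4 * l + 0))) => //.
- by move=> i _; apply: peak_ge0.
- move=> i ik; have hd : disj (peak (4 * i + 0)) (comb 2).
    apply: (disj_sum (v := fun l => peak (4 * l + 2))) => j jk; first exact: peak_ge0.
    exact: dj.
  apply: hd => //; apply: P_add hle (peak_le_comb 0 ik) _; lmod.
- move=> i j ij jk; have [||_] := @peak_disj (4 * i + 0) (2 * (j - i)).
  + by rewrite muln_gt0 subn_gt0 ij.
  + by rewrite ltn_pmul2l // (leq_ltn_trans (leq_subr _ _)).
  rewrite (_ : 4 * i + 0 + 2 * (2 * (j - i)) = 4 * j + 0)%N //.
  by rewrite mulnA addnAC -mulnDr subnKC // ltnW.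
Qed.

(** The sum of all peaks plus [c M] dominates every rotated vector, hence also [M]. *)
Lemma comb_total : P (comb 0 + comb 1 + comb 2 + comb 3 - (1 - c)%:C *: M).
Proof.
set S := comb 0 + comb 1 + comb 2 + comb 3.
have PS : P S by do !apply: PD; apply: comb_ge0.
suff : P ((S + c%:C *: M) - M) by congr P; lmod.
apply: Mle; first by apply: ErD; [apply: PEr|apply: ErZ].
move=> i ik; pose l := (i %/ 4)%N; pose r := (i %% 4)%N.
have lk : (l < k)%N by rewrite ltn_divLR // mulnC.
have ei : i = (4 * l + r)%N by rewrite mulnC -divn_eq.
have h1 : P (S - comb r).
  have : (r < 4)%N by rewrite ltn_mod.
  have hp := comb_ge0.
  case: r {ei} => [|[|[|[|//]]]] _.
  - by apply: P_add (PD (hp 1%N) (hp 2%N)) (hp 3%N) _; rewrite /S; lmod.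
  - by apply: P_add (PD (hp 0%N) (hp 2%N)) (hp 3%N) _; rewrite /S; lmod.
  - by apply: P_add (PD (hp 0%N) (hp 1%N)) (hp 3%N) _; rewrite /S; lmod.
  - by apply: P_add (PD (hp 0%N) (hp 1%N)) (hp 2%N) _; rewrite /S; lmod.
have h2 := peak_le_comb r lk; rewrite -ei in h2.
have h3 := pos_ge (peak_arg_Er i); rewrite -/(peak i) in h3.
apply: P_add (PD h1 h2) h3 _; lmod.
Qed.

End Rotation.

(** * Eventually positive semigroups and their mean ergodic projection *)

Section Positive.
Variables (T : R -> V -> V) (Q : V -> V) (t0 N : R).
Hypotheses (sg : lb_semigroup T) (t00 : 0 <= t0) (Tpos : forall t, t0 <= t -> positive_op P (T t)).
Hypotheses (Qlin : is_linear Q) (N0 : 0 <= N) (Qbd : opbound Q N)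
  (QT : forall t x, 0 <= t -> Q (T t x) = Q x)
  (Qmean : forall e, 0 < e -> exists2 L, 0 < L & forall x, nrm (L^-1%:C *: integ T L x - Q x) <= e * nrm x).

Let Tlin t : 0 <= t -> is_linear (T t). Proof. by case: sg => + _ _ _ _; apply. Qed.
Let TD t s x : 0 <= t -> 0 <= s -> T (t + s) x = T t (T s x).
Proof. by case: sg => _ _ + _ _; apply. Qed.

(** A real vector is a difference of two positive ones, so reality is preserved from [t0] on. *)
Lemma T_Er t x : t0 <= t -> Er x -> Er (T t x).
Proof.
move=> ht hx; have h0 : 0 <= t by apply: le_trans ht.
rewrite (_ : x = pos x - (pos x - x)); last by lmod.
by rewrite (linB (Tlin h0)); apply: ErB; apply/PEr/Tpos => //; [apply: pos_ge0|apply: pos_ge].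
Qed.

(** The error [r] may depend on [t] in an arbitrary way and cannot be integrated. The inequality is
    summed over a Riemann grid instead, and the modulus of the discretisation error joins the new
    [r]. *)
Lemma integ_lower L v u (e : R) : 0 < L -> 0 <= e -> Er u -> (forall t, 0 <= t -> Er (T t v)) ->
  (forall t, 0 <= t -> t <= L -> exists r : V, [/\ P r, nrm r <= e & P (T t v - u + r)]) ->
  forall e', 0 < e' -> exists r : V, [/\ P r, nrm r <= L * e + e' & P (integ T L v - L%:C *: u + r)].
Proof.
move=> L0 e0 Eu Ev h e' e'0; have L0' := ltW L0.
have rE h' n : 0 <= h' -> Er (rsum T h' n v).
  move=> h'0; apply: ErZ; elim/big_ind: _ => [|x y|i _]; [exact: Er0|exact: ErD|].
  by apply: Ev; rewrite mulr_ge0.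
have EI : Er (integ T L v).
  apply: Er_closed => d d0; have [m hm] := integ_lims sg v L0' d0.
  exists (rsum T (mesh R m) (cells L m) v); first exact/rE/mesh_ge0.
  by rewrite nrmBC hm.
have u1 : 0 < nrm u + 1 by rewrite ltr_wpDl ?nrm_ge0.
have e2 : 0 < e' / 2 by rewrite divr_gt0.
have [m1 hm1] := integ_lims sg v L0' e2.
have [m2 hm2] := cells_lims L0' (divr_gt0 e2 u1).
pose m := maxn m1 m2; have := hm1 m (leq_maxl _ _); have := hm2 m (leq_maxr _ _).
set n := cells L m; set w := mesh R m; set I := integ T L v => /andP [g1 g2] g3.
have w0 : 0 <= w by apply: mesh_ge0.
have nL : n%:R * w <= L by apply: cells_le.
have hpt i : exists r, (i < n)%N -> [/\ P r, nrm r <= e & P (T (i%:R * w) v - u + r)].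
  have [ilt|_] := boolP (i < n)%N; last by exists 0.
  have [||r hr] := h (i%:R * w); last by exists r.
    by rewrite mulr_ge0.
  by apply: le_trans nL; rewrite ler_wpM2r // ler_nat ltnW.
have [r hr] := choice hpt.
pose r1 := w%:C *: \sum_(i < n) r i.
pose y := (I - rsum T w n v) - (L - n%:R * w)%:C *: u.
have Ey : Er y by apply: ErB; [apply: ErB => //; apply: rE|apply: ErZ].
have Pr1 : P r1 by apply: PZ => //; apply: P_sum => i /hr [].
exists (r1 + abs y); split.
- by apply: PD => //; apply: abs_ge0.
- apply: le_trans (nrmD _ _) _; apply: lerD.
    rewrite nrmZr ger0_norm //; apply: (@le_trans _ _ (w * (n%:R * e))).
      by apply: ler_wpM2l => //; apply: nrm_sum_le => i /hr [].
    by rewrite mulrA (mulrC w) ler_wpM2r.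
  rewrite nrm_abs // (splitr e'); apply: le_trans (nrmB _ _) _; apply: lerD.
    by rewrite nrmBC.
  rewrite nrmZr ger0_norm //; apply: (@le_trans _ _ (e' / 2 / (nrm u + 1) * (nrm u + 1))); last by rewrite divfK // lt0r_neq0.
  by apply: ler_pM => //; rewrite ?nrm_ge0 ?(ltW g2) ?lerDl.
have hs : P (w%:C *: \sum_(i < n) (T (i%:R * w) v - u + r i)).
  by apply: PZ => //; apply: (P_sum (f := fun i => T (i%:R * w) v - u + r i)) => i /hr [].
apply: P_add hs (abs_geN Ey) _.
have -> : \sum_(i < n) (T (i%:R * w) v - u + r i) =
    \sum_(i < n) T (i%:R * w) v - (n%:R)%:C *: u + \sum_(i < n) r i.
  by rewrite big_split sumrB big_const_ord iter_addr_0 rmorph_nat scaler_nat.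
rewrite /y /r1 /rsum; lmod.
Qed.

(** [Q x = Q (T t0 x)], and the orbit of [T t0 x] stays in the cone from time [0] on, so [Q x] is a
    limit of positive averages. *)
Lemma Q_pos : positive_op P Q.
Proof.
move=> x Px; rewrite -(QT x t00); set v := T t0 x.
have Pv t : 0 <= t -> P (T t v).
  by move=> ht; rewrite /v -TD //; apply: Tpos; rewrite ?lerDr // lerDl.
apply: P_closed => e e0; have v1 : 0 < nrm v + 1 by rewrite ltr_wpDl ?nrm_ge0.
have [L L0 hL] := Qmean (divr_gt0 e0 v1).
exists (L^-1%:C *: integ T L v).
  apply: PZ; first by rewrite invr_ge0 ltW.
  apply: P_closed => d d0.
  have [||//|t ht _|r [r1 r2 r3]] := @integ_lower L v 0 0 _ _ Er0 _ _ d d0 => //.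
  - by move=> t /Pv /PEr.
  - by exists 0; rewrite subr0 addr0 nrm0; split => //; [exact: P0|exact: Pv].
  exists (integ T L v + r); first by move: r3; rewrite scaler0 subr0.
  by rewrite opprD addrA subrr sub0r nrmN; move: r2; rewrite mulr0 add0r.
rewrite nrmBC; apply: le_trans (hL v) _.
apply: (@le_trans _ _ (e / (nrm v + 1) * (nrm v + 1))); last by rewrite divfK // lt0r_neq0.
by rewrite ler_wpM2l ?lerDl // ltW // divr_gt0.
Qed.

Section Core.
Variables (t1 dt eps g : R) (k J : nat) (L Tm kap MT c1 : R) (a b : V).
Hypotheses (eps0 : 0 <= eps) (Neps : 32 * N * eps <= 1)
  (Tcont : forall t s x, t1 <= t -> 0 <= s -> s < dt -> nrm (T (t + s) x - T t x) <= eps * nrm x)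
  (g0 : 0 < g) (k2 : (1 < k)%N).
Let c := cos (step k).
(** The time in which the rotation advances by one step. *)
Let h := step k / g.
Hypotheses (hdt : 2 * h < dt) (Jt : t0 <= J%:R * h) (Jt1 : t1 <= J%:R * h)
  (J4 : exists n, J = (4 * n)%N) (L0 : 0 < L) (MT0 : 0 < MT) (hMT : opbound (T t0) MT)
  (hL : forall x, nrm (L^-1%:C *: integ T L x - Q x) <= (4 * MT)^-1 * nrm x)
  (Tm1 : L + t0 <= Tm) (Tm2 : (J + 4)%:R * h <= Tm) (kap0 : 0 < kap).
Hypotheses (Ea : Er a) (Eb : Er b) (ab : c1 <= nrm a + nrm b)
  (rotT : forall t, t0 <= t -> t <= Tm ->
    nrm (T t a - ((cos (g * t))%:C *: a - (sin (g * t))%:C *: b)) <= kap /\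
    nrm (T t b - ((sin (g * t))%:C *: a + (cos (g * t))%:C *: b)) <= kap).

Let f := rot a b k.
Let S j := T (j%:R * h).
Let ok j := (t0 <= j%:R * h) && (j%:R * h <= Tm).

Let h0 : 0 < h. Proof. by rewrite divr_gt0 // step_gt0. Qed.
Let jh0 j : 0 <= j%:R * h. Proof. by rewrite mulr_ge0 // ltW. Qed.
Let Slin j : is_linear (S j). Proof. exact: Tlin. Qed.
Let fE i : Er (f i). Proof. exact: rot_Er. Qed.

Lemma rot_move i j : ok j -> nrm (S j (f i) - f (i + j)) <= 2 * kap.
Proof.
move=> /andP [j1 j2]; have [ha hb] := rotT j1 j2.
have gj : g * (j%:R * h) = j%:R * step k by rewrite /h mulrCA (mulrC g) divfK // lt0r_neq0.
rewrite gj in ha hb; pose th := i%:R * step k.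
set ea := S j a - _ in ha; set eb := S j b - _ in hb.
have -> : S j (f i) - f (i + j) = (cos th)%:C *: ea - (sin th)%:C *: eb.
  rewrite /f /rot (linB (Slin j)) !(linZ (Slin j)) natrD mulrDl -/th cosD sinD /ea /eb; lmod.
apply: le_trans (nrmB _ _) _; rewrite !nrmZr.
have q1 : `|cos th| <= 1 by rewrite ler_norml cos_geN1 cos_le1.
have q2 : `|sin th| <= 1 by rewrite ler_norml sin_geN1 sin_le1.
rewrite mulr_natl mulr2n; apply: lerD; rewrite -[leRHS]mul1r; apply: ler_pM; rewrite ?nrm_ge0 //.
Qed.

Let S_Er j x : ok j -> Er x -> Er (S j x).
Proof. by move=> /andP [j1 _]; apply: T_Er. Qed.
Let S_pos j x : ok j -> P x -> P (S j x).
Proof. by move=> /andP [j1 _]; apply: Tpos. Qed.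

Variable M : V.
Hypotheses (EM : Er M) (Mge : forall i, P (M - f i))
  (Mle : forall z, Er z -> (forall i, (i < 4 * k)%N -> P (z - f i)) -> P (z - M)).

Let PM : P M. Proof. exact: (M_ge0 k2 Mge). Qed.

(** [S j] moves the rotated vectors cyclically up to small errors, so [S j M] almost dominates all
    of them. The index [i' i] is the preimage of [i], as [i' i + j = i + 4 k j]. *)
Lemma M_move j : ok j -> exists r : V, [/\ P r, nrm r <= (4 * k)%:R * (2 * kap) & P (S j M + r - M)].
Proof.
move=> hj; pose i' i := (i + (4 * k - 1) * j)%N; pose d i := S j (f (i' i)) - f i.
have dE i : Er (d i) by apply: ErB => //; apply: S_Er.
have fi i : f (i' i + j) = f i.
  rewrite -[RHS](rot_fullM a b k2 i j) /i'; congr (rot _ _ _ _).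
  rewrite -addnA -mulSnr subn1 prednK ?muln_gt0 ?(ltnW k2) //.
  by rewrite [in RHS]mulnC.
pose r := \sum_(i < 4 * k) abs (d i).
have Pr : P r by apply: (P_sum (f := fun i => abs (d i))) => i _; apply: abs_ge0.
exists r; split => //.
  apply: (nrm_sum_le (g := fun i => abs (d i))) => i _; rewrite nrm_abs // /d -(fi i).
  exact: rot_move.
apply: Mle; first by apply: ErD; [apply: S_Er|apply: PEr].
move=> i ik; have p1 : P (S j (M - f (i' i))) by apply: S_pos.
have p2 : P (r - abs (d i)).
  rewrite /r (bigD1 (Ordinal ik)) //= addrAC subrr add0r.
  by elim/big_ind: _ => [|x y|l _]; [exact: P0|exact: PD|exact: abs_ge0].
apply: P_add (PD p1 p2) (abs_geN (dE i)) _.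
rewrite (linB (Slin j)) /d; lmod.
Qed.

Let w := peak a b k M.
Let W := comb a b k M.
Let wP i : P (w i). Proof. exact: peak_ge0. Qed.
Let WP r : P (W r). Proof. exact: comb_ge0. Qed.

Let Qr (r : V) (y : R) : P r -> nrm r <= y -> nrm (Q r) <= N * y.
Proof. by move=> _ hr; apply: le_trans (Qbd r) _; apply: ler_wpM2l. Qed.

Let QS j x : Q (S j x) = Q x. Proof. exact: QT. Qed.

(** The defect [S j M + r - M] in the error is positive but need not be small in norm. Its image
    under [Q] is that of [r], as [Q] absorbs [S j]; hence only [Q e] is estimated. *)
Lemma peak_move i j : ok j -> exists e : V, [/\ P e, nrm (Q e) <= N * (10 * k%:R * kap) &
  P (S j (w i) + e - w (i + j))].
Proof.
move=> hj; have [r [Pr nr hr]] := M_move hj.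
pose d := S j (f i) - f (i + j); have dE : Er d by apply: ErB => //; apply: S_Er.
have c0 : 0 < c := cos_step_gt0 k2; have c1' : c < 1 := cos_step_lt1 k2.
pose e := S j M + r - M.
exists (abs d + c%:C *: e); split.
- by apply: PD; [apply: abs_ge0|apply: PZ => //; apply: ltW].
- rewrite (linD Qlin) (linZ Qlin) /e (linB Qlin) (linD Qlin) QS addrAC subrr add0r.
  apply: le_trans (nrmD _ _) _.
  have q1 : nrm (Q (abs d)) <= N * (2 * kap).
    by apply: Qr; [apply: abs_ge0|rewrite nrm_abs //; apply: rot_move].
  have q2 : nrm (Q r) <= N * ((4 * k)%:R * (2 * kap)) by apply: Qr.
  have q3 : nrm (c%:C *: Q r) <= nrm (Q r).
    by rewrite nrmZr gtr0_norm // ler_piMl ?nrm_ge0 // ltW.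
  have k1 : 1 <= k%:R :> R by rewrite ler1n ltnW.
  apply: le_trans (lerD q1 (le_trans q3 q2)) _; rewrite -mulrDr; apply: ler_wpM2l => //.
  by have := ler_wpM2r (ltW kap0) k1; rewrite natrM; lra.
have hz : P (S j (w i) + (abs d + c%:C *: e)).
  apply: PD; first exact: S_pos.
  by apply: PD; [apply: abs_ge0|apply: PZ => //; apply: ltW].
apply: pos_least => //; first exact: peak_arg_Er.
have p1 : P (S j (w i - (f i - c%:C *: M))) by apply/S_pos => //; apply/pos_ge/peak_arg_Er.
have p2 : P (c%:C *: r) by apply: PZ => //; apply: ltW.
apply: P_add (PD p1 p2) (abs_geN dE) _.
rewrite (linB (Slin j) (w i)) (linB (Slin j) (f i)) (linZ (Slin j) _ M) /d /e -/f -/c; lmod.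
Qed.

Let K := k%:R * (N * (10 * k%:R * kap)).

Lemma comb_move r j : ok j -> exists e : V, [/\ P e, nrm (Q e) <= K & P (S j (W r) + e - W (r + j))].
Proof.
move=> hj; have [e he] := choice (fun l : nat => peak_move (4 * l + r) hj).
exists (\sum_(l < k) e l); split.
- by apply: P_sum => i _; have [] := he i.
- by rewrite (lin_sum Qlin); apply: (nrm_sum_le (g := fun l => Q (e l))) => i _; have [] := he i.
have : P (\sum_(l < k) (S j (w (4 * l + r)) + e l - w (4 * l + r + j))).
  by apply: (P_sum (f := fun l => S j (w (4 * l + r)) + e l - w (4 * l + r + j))) => i _; have [] := he i.
rewrite sumrB big_split -(lin_sum (Slin j)) /W /comb; congr (P (_ - _)).
by apply: eq_bigr => i _; rewrite addnA.
Qed.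

Let okJ d : (d <= 4)%N -> ok (J + d).
Proof.
move=> d4; apply/andP; split.
  by apply: le_trans Jt _; rewrite ler_wpM2r ?(ltW h0) // ler_nat leq_addr.
by apply: le_trans Tm2; rewrite ler_wpM2r ?(ltW h0) // ler_nat leq_add2l.
Qed.

Let WJ r d : W (r + (J + d)) = W (r + d).
Proof. by case: J4 => n ->; rewrite addnCA addnC /W comb_shiftM. Qed.

(** [W 0] lies below [S J (W 0)], which is close to [S (J + 2) (W 0)], and the latter is [W 2] plus
    the positive excess [e3], up to [e2]. As [W 0] is disjoint from [W 2], it lies below the errors
    alone. The excess is small under [Q], because [S (J + 2)] also carries [W 2] back over [W 0]. *)
Lemma Q_comb_bound : nrm (Q (W 0)) <= 3 * K + N * eps * ((1 - c) * nrm M).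
Proof.
have [e1 [Pe1 n1 p1]] := comb_move 0 (okJ (leq0n 4)); rewrite WJ !addn0 in p1.
have [e2 [Pe2 n2 p2]] := comb_move 0 (okJ (isT : (2 <= 4)%N)); rewrite WJ add0n in p2.
have [e4 [Pe4 n4 p4]] := comb_move 2 (okJ (isT : (2 <= 4)%N)); rewrite WJ in p4.
have W4 : W (2 + 2) = W 0 by apply: (comb_shift a b k2 M 0).
rewrite W4 in p4.
pose D := S J (W 0) - S (J + 2) (W 0).
have ok0 := okJ (leq0n 4); rewrite addn0 in ok0.
have DE : Er D by apply: ErB; apply: S_Er => //; [apply: PEr|exact: okJ|apply: PEr].
pose e3 := S (J + 2) (W 0) - W 2 + e2.
have Pe3 : P e3 by move: p2; congr P; rewrite /e3; lmod.
have hW : P (e3 + abs D + e1 - W 0).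
  have dj : disj (W 0) (W 2) by apply: comb_disj.
  apply: dj; first by apply: PD => //; apply: PD => //; apply: abs_ge0.
  apply: P_add (PD p1 Pe2) (abs_ge DE) _; rewrite /e3 /D; lmod.
have QP := Q_pos.
have nQ : nrm (Q (W 0)) <= nrm (Q (e3 + abs D + e1)).
  apply: nrm_le_pos; first exact: QP.
  by rewrite -(linB Qlin); apply: QP.
apply: le_trans nQ _; rewrite (linD Qlin (e3 + abs D)) (linD Qlin e3).
have nD : nrm (abs D) <= eps * ((1 - c) * nrm M).
  rewrite nrm_abs //; apply: (@le_trans _ _ (eps * nrm (W 0))).
    by rewrite /D /S natrD mulrDl nrmBC; apply: Tcont => //; rewrite mulr_ge0 // ltW.
  apply: ler_wpM2l => //; have : P ((1 - c)%:C *: M - W 0) by apply: comb_le.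
  move/(nrm_le_pos (WP 0)); rewrite nrmZr ger0_norm // subr_ge0 ltW //; exact: cos_step_lt1.
have nQD : nrm (Q (abs D)) <= N * eps * ((1 - c) * nrm M).
  by rewrite -mulrA; apply: Qr => //; apply: abs_ge0.
have n3 : nrm (Q e3) <= 2 * K.
  apply: (@le_trans _ _ (nrm (Q e4 + Q e2))).
    apply: nrm_le_pos; first exact: QP.
    have := QP _ p4; rewrite /e3 !(linB Qlin, linD Qlin) !QS.
    by congr P; lmod.
  by apply: le_trans (nrmD _ _) _; lra.
apply: le_trans (nrmD _ _) _; apply: le_trans (lerD (nrmD _ _) (lexx _)) _; lra.
Qed.

(** Up to small errors [W 0] is carried over each other group, so under [Q] none of the four groups
    is essentially larger than [W 0], while together they exceed [(1 - c) M]. *)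
Lemma QM_upper : (1 - c) * nrm (Q M) <= 4 * nrm (Q (W 0)) + 3 * K.
Proof.
have [e1 [Pe1 n1 p1]] := comb_move 0 (okJ (isT : (1 <= 4)%N)); rewrite WJ add0n in p1.
have [e2 [Pe2 n2 p2]] := comb_move 0 (okJ (isT : (2 <= 4)%N)); rewrite WJ add0n in p2.
have [e3 [Pe3 n3 p3]] := comb_move 0 (okJ (isT : (3 <= 4)%N)); rewrite WJ add0n in p3.
have pt : P (W 0 + W 1 + W 2 + W 3 - (1 - c)%:C *: M) by apply: comb_total.
have QP := Q_pos.
have := PD (QP _ pt) (PD (QP _ p1) (PD (QP _ p2) (QP _ p3))).
rewrite !(linB Qlin, linD Qlin, linN Qlin, linZ Qlin) !QS => hp.
have c1' : 0 <= 1 - c by rewrite subr_ge0 ltW //; exact: cos_step_lt1.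
have hp' : P (4%:R%:C *: Q (W 0) + (Q e1 + Q e2 + Q e3) - (1 - c)%:C *: Q M).
  by move: hp; congr P; lmod.
have := nrm_le_pos (PZ c1' (QP _ PM)) hp'.
rewrite nrmZr ger0_norm // => /le_trans; apply.
apply: le_trans (nrmD _ _) _; rewrite nrmZr ger0_norm //; apply: lerD => //.
apply: le_trans (nrmD _ _) _; apply: le_trans (lerD (nrmD _ _) (lexx _)) _; lra.
Qed.

(** At time [s] the images of [a] and [b] are nearly the rotated pair [A], [B], so [T s M] almost
    dominates [A], [-A], [B] and [-B]. Each [rot i] is a combination of [A] and [B] with
    coefficients in [[-1, 1]], hence nearly below [2 T s M], and so is [M]. Averaging in time gives
    about half of [M]; replacing the mean by [Q] costs another quarter of its norm. *)
Lemma QM_lower : nrm M / 4 <= nrm (Q M) + 3 * kap.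
Proof.
pose v := T t0 M; have L0' := ltW L0.
have Ev t : 0 <= t -> Er (T t v).
  by move=> ht; rewrite /v -TD //; apply: T_Er => //; rewrite lerDr.
have low t : 0 <= t -> t <= L -> exists r : V, [/\ P r, nrm r <= 2 * kap & P (T t v - 2^-1%:C *: M + r)].
  move=> ht tL; pose s := t + t0; have s0 : t0 <= s by rewrite lerDr.
  have s0' : 0 <= s by apply: le_trans s0.
  have sT : s <= Tm by apply: le_trans Tm1; rewrite lerD2r.
  have [] := rotT s0 sT; pose C := cos (g * s); pose D := sin (g * s); rewrite -/C -/D.
  set ea := T s a - _; set eb := T s b - _ => na nb.
  have Ts : T t v = T s M by rewrite /v -TD.
  have Eea : Er ea by apply: ErB; [apply: T_Er|apply: ErB; apply: ErZ].
  have Eeb : Er eb by apply: ErB; [apply: T_Er|apply: ErD; apply: ErZ].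
  pose r := abs ea + abs eb.
  have Pr : P r by apply: PD; apply: abs_ge0.
  exists r; split => //.
    by apply: le_trans (nrmD _ _) _; rewrite !nrm_abs //; lra.
  rewrite Ts; pose A := C%:C *: a - D%:C *: b; pose B := D%:C *: a + C%:C *: b.
  have TM : P (T s M) by apply: Tpos.
  have f0 : f 0 = a by rewrite /f /rot mul0r cos0 sin0; lmod.
  have fk : f k = - b.
    rewrite /f /rot (_ : k%:R * step k = pi / 2) ?cos_pihalf ?sin_pihalf; first by lmod.
    by rewrite -(step_k k2) natrM; field.
  have f2k : f (2 * k)%N = - a by rewrite /f -[(2 * k)%N]add0n rot_half // -/f f0.
  have f3k : f (k + 2 * k)%N = b by rewrite /f rot_half // -/f fk opprK.
  have lT := Tlin s0'.
  have A1 : P (T s M + r - A).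
    have := Tpos s0 (Mge 0%N); rewrite f0 (linB lT) => q.
    by apply: P_add (PD q (abs_ge0 Eeb)) (abs_geN Eea) _; rewrite /r /ea /A; lmod.
  have A2 : P (T s M + r + A).
    have := Tpos s0 (Mge (2 * k)%N); rewrite f2k opprK (linD lT) => q.
    by apply: P_add (PD q (abs_ge0 Eeb)) (abs_ge Eea) _; rewrite /r /ea /A; lmod.
  have B1 : P (T s M + r - B).
    have := Tpos s0 (Mge (k + 2 * k)%N); rewrite f3k (linB lT) => q.
    by apply: P_add (PD q (abs_ge0 Eea)) (abs_geN Eeb) _; rewrite /r /eb /B; lmod.
  have B2 : P (T s M + r + B).
    have := Tpos s0 (Mge k); rewrite fk opprK (linD lT) => q.
    by apply: P_add (PD q (abs_ge0 Eea)) (abs_ge Eeb) _; rewrite /r /eb /B; lmod.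
  have dom (p : R) X Y : `|p| <= 1 -> P X -> P (X - Y) -> P (X + Y) -> P (X - p%:C *: Y).
    move=> hp PX h1 h2; have [p0|p0] := leP 0 p.
      have p1 : 0 <= 1 - p by move: hp; rewrite ger0_norm // => ?; lra.
      by apply: P_add (PZ p0 h1) (PZ p1 PX) _; lmod.
    have p1 : 0 <= 1 + p by move: hp; rewrite ltr0_norm // => ?; lra.
    have p2 : 0 <= - p by lra.
    by apply: P_add (PZ p2 h2) (PZ p1 PX) _; lmod.
  suff hM : P ((T s M + r) + (T s M + r) - M).
    have half : 0 <= 2^-1 :> R by rewrite invr_ge0.
    by have := PZ half hM; congr P; lmod; field.
  have PX : P (T s M + r) by apply: PD.
  apply: Mle; first by apply: ErD; apply: PEr.
  move=> i _; pose th := i%:R * step k.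
  have hf : f i = (cos (th - g * s))%:C *: A - (sin (th - g * s))%:C *: B.
    have ha : a = C%:C *: A + D%:C *: B.
      transitivity ((C ^+ 2 + D ^+ 2)%:C *: a); first by rewrite cos2Dsin2 scale1r.
      by rewrite /A /B; lmod.
    have hb : b = C%:C *: B - D%:C *: A.
      transitivity ((C ^+ 2 + D ^+ 2)%:C *: b); first by rewrite cos2Dsin2 scale1r.
      by rewrite /A /B; lmod.
    transitivity ((cos th)%:C *: (C%:C *: A + D%:C *: B) - (sin th)%:C *: (C%:C *: B - D%:C *: A)).
      by rewrite -ha -hb.
    by rewrite cosB sinB -/C -/D; lmod.
  have q1 : `|cos (th - g * s)| <= 1 by rewrite ler_norml cos_geN1 cos_le1.
  have q2 : `|- sin (th - g * s)| <= 1 by rewrite normrN ler_norml sin_geN1 sin_le1.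
  by apply: P_add (dom _ _ _ q1 PX A1 A2) (dom _ _ _ q2 PX B1 B2) _; rewrite hf; lmod.
have EM2 : Er (2^-1%:C *: M) by apply: ErZ.
have kap2 : 0 <= 2 * kap by rewrite mulr_ge0 // ltW.
have [r [Pr nr hr]] := integ_lower L0 kap2 EM2 Ev low (mulr_gt0 L0 kap0).
have EI : Er (integ T L v).
  rewrite (_ : integ T L v = (integ T L v - L%:C *: (2^-1%:C *: M) + r) + (L%:C *: (2^-1%:C *: M) - r)); last by lmod.
  by apply: ErD; [apply: PEr|apply: ErB; [apply: ErZ|apply: PEr]].
pose C := L^-1%:C *: integ T L v; pose D := C - Q v.
have Qv : Q v = Q M by apply: QT.
have QMP : P (Q M) by apply: Q_pos.
have DE : Er D by apply: ErB; [apply: ErZ|rewrite Qv; apply: PEr].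
have Li : 0 <= L^-1 by rewrite invr_ge0.
have Lne : L != 0 by rewrite lt0r_neq0.
have low' : P (Q M + L^-1%:C *: r + abs D - 2^-1%:C *: M).
  have hs : P (C - 2^-1%:C *: M + L^-1%:C *: r).
    by have := PZ Li hr; rewrite scalerDr scalerBr (scalerA L^-1%:C L%:C) -rmorphM mulVf // scale1r.
  by apply: P_add hs (abs_ge DE) _; rewrite /D Qv; lmod.
have nD : nrm D <= nrm M / 4.
  apply: le_trans (hL v) _; apply: (@le_trans _ _ ((4 * MT)^-1 * (MT * nrm M))).
    by apply: ler_wpM2l; [rewrite invr_ge0 mulr_ge0 // ltW|apply: hMT].
  rewrite invfM mulrA -(mulrA 4^-1) mulVf ?lt0r_neq0 // mulr1 mulrC //.
have half0 : 0 <= 2^-1 :> R by rewrite invr_ge0.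
have := nrm_le_pos (PZ half0 PM) low'.
rewrite nrmZr ger0_norm // => h1.
have h2 : nrm (Q M + L^-1%:C *: r + abs D) <= nrm (Q M) + 3 * kap + nrm M / 4.
  apply: le_trans (nrmD _ _) _; apply: lerD; last by rewrite nrm_abs.
  apply: le_trans (nrmD _ _) _; apply: lerD => //; rewrite nrmZr ger0_norm //.
  rewrite mulrC ler_pdivrMr //; lra.
lra.
Qed.

Lemma M_lower : c1 / 2 <= nrm M.
Proof.
have f0 : f 0 = a by rewrite /f /rot mul0r cos0 sin0; lmod.
have fk : f k = - b.
  rewrite /f /rot (_ : k%:R * step k = pi / 2) ?cos_pihalf ?sin_pihalf; first by lmod.
  by rewrite -(step_k k2) natrM; field.
have dom x : Er x -> P (M - x) -> P (M + x) -> nrm x <= nrm M.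
  move=> Ex h1 h2; rewrite -(nrm_abs Ex); apply: nrm_le_pos; first exact: abs_ge0.
  have [_ [_ hl]] := abs_mod Ex; apply: hl => // _ [->|->]; rewrite /lat_le //.
  by rewrite opprK.
have na : nrm a <= nrm M.
  apply: dom => //; first by rewrite -f0.
  by have := Mge (0 + 2 * k)%N; rewrite /f rot_half // opprK -/f f0.
have nb : nrm b <= nrm M.
  apply: dom => //; last by have := Mge k; rewrite fk opprK.
  by have := Mge (k + 2 * k)%N; rewrite /f rot_half // -/f fk opprK.
have := ab; lra.
Qed.

Lemma core_bound : (1 - c) * c1 <= (2400 * (N * k%:R ^+ 2) + 48) * kap.
Proof.
have h1 := Q_comb_bound; have h2 := QM_upper; have h3 := QM_lower; have h4 := M_lower.
have c1' : c < 1 := cos_step_lt1 k2; have c0 : 0 < c := cos_step_gt0 k2.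
(* Here the constant [32] enters: the term with [eps] takes at most half of the quarter provided by
   [QM_lower]. *)
have h5 : 4 * (N * eps * ((1 - c) * nrm M)) <= (1 - c) * nrm M / 8.
  have hX : 0 <= (1 - c) * nrm M by rewrite mulr_ge0 ?nrm_ge0 // subr_ge0 ltW.
  have := ler_wpM2r hX Neps; lra.
have h6 : (1 - c) * (nrm M / 4) <= (1 - c) * nrm (Q M) + 3 * kap.
  have c2 : 0 <= 1 - c by rewrite subr_ge0 ltW.
  have h3' := ler_wpM2l c2 h3.
  have := ltW (mulr_gt0 c0 kap0); lra.
have h7 : (1 - c) * (c1 / 2) <= (1 - c) * nrm M by rewrite ler_pM2l // subr_gt0.
have KE : K = 10 * (N * k%:R ^+ 2) * kap by rewrite /K; ring.
have h8 : (1 - c) * nrm M / 8 <= 15 * K + 3 * kap by lra.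
rewrite KE in h8; lra.
Qed.

End Core.

(* If [a + i b] were an approximate eigenvector for [i g], then [T] would rotate
   the vectors [rot a b k i] cyclically up to a small error. Comparing the disjoint
   parts [comb r] at the times [J h] and [(J + 2) h] contradicts [Tcont], since
   positivity bounds [Q M] below. *)
Lemma no_rotation (t1 dt eps g c1 : R) : 0 <= t1 -> 0 < dt -> 0 <= eps -> 32 * N * eps <= 1 ->
  (forall t s x, t1 <= t -> 0 <= s -> s < dt -> nrm (T (t + s) x - T t x) <= eps * nrm x) ->
  0 < g -> 0 < c1 ->
  (forall eta, 0 < eta -> exists a b, [/\ Er a, Er b, c1 <= nrm a + nrm b & forall t, t0 <= t ->
    nrm (T t a - ((cos (g * t))%:C *: a - (sin (g * t))%:C *: b)) <= t * eta /\
    nrm (T t b - ((sin (g * t))%:C *: a + (cos (g * t))%:C *: b)) <= t * eta]) -> False.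
Proof.
move=> t10 dt0 eps0 Neps Tcont g0 c10 app.
(* This gives [2 * h = pi / (g * k) < dt]; [.+2] rather than [.+1] ensures [1 < k]. *)
pose k := (Num.truncn (pi / (g * dt))).+2.
have k2 : (1 < k)%N by [].
pose h := step k / g.
have s0 : 0 < step k := step_gt0 k2.
have h0 : 0 < h by rewrite divr_gt0.
have hdt : 2 * h < dt.
  have kg : pi / (g * dt) < k%:R.
    by apply: lt_trans (truncnS_gt _) _; rewrite ltr_nat.
  have -> : 2 * h = pi / g / k%:R.
    have kn : k%:R != 0 :> R by rewrite pnatr_eq0.
    have gn : g != 0 by rewrite lt0r_neq0.
    by clearbody k; rewrite /h /step natrM; field; rewrite ?kn ?gn.
  rewrite ltr_pdivrMr ?ltr0n // ltr_pdivrMr // mulrAC mulrC.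
  by move: kg; rewrite ltr_pdivrMr ?mulr_gt0 // (mulrC g).
(* Divisible by [4], so that [J] steps return each group to itself, and late enough for positivity
   and norm continuity. *)
pose J := (4 * (Num.truncn ((t0 + t1) / h)).+1)%N.
have Jh : t0 + t1 <= J%:R * h.
  rewrite -ler_pdivrMr //; apply: le_trans (ltW (truncnS_gt _)) _.
  by rewrite ler_nat leq_pmull.
have [MT MT1 hMT] := (let: And5 _ _ _ _ h := sg in h) t0.
have MT0 : 0 < MT by apply: lt_le_trans MT1.
have [|L L0 hL] := Qmean (_ : 0 < (4 * MT)^-1).
  by rewrite invr_gt0 mulr_gt0.
pose Tm := L + t0 + (J + 4)%:R * h.
have J40 : 0 < (J + 4)%:R * h by rewrite mulr_gt0 // ltr0n addn_gt0 orbT.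
have Tm0 : 0 < Tm by rewrite /Tm ltr_wpDl // addr_ge0 // ltW.
pose c := cos (step k).
have c1' : c < 1 := cos_step_lt1 k2.
pose K := 2400 * (N * k%:R ^+ 2) + 48.
have Nk : 0 <= N * k%:R ^+ 2 by rewrite mulr_ge0 // exprn_ge0.
have K0 : 0 < K by rewrite /K; lra.
(* With this error [core_bound] would say [(1 - c) * c1 <= (1 - c) * c1 / 2]. *)
pose kap := (1 - c) * c1 / (2 * K).
have kap0 : 0 < kap by rewrite divr_gt0 ?mulr_gt0 // subr_gt0.
have [a [b [Ea Eb ab hab]]] := app _ (divr_gt0 kap0 Tm0).
have k4 : (4 * k).-1.+1 = (4 * k)%N by rewrite prednK.
have [M [EM Mge Mle]] := fin_sup (4 * k).-1 (rot_Er k Ea Eb).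
have Mge' i : P (M - rot a b k i).
  rewrite (divn_eq i (4 * k)) addnC rot_fullM //; apply: Mge.
  by rewrite -ltnS k4 ltn_mod.
have : (1 - c) * c1 <= K * kap.
  apply: (core_bound (J := J) (Tm := Tm) eps0 Neps Tcont g0 k2 hdt
    _ _ _ L0 MT0 _ hL _ _ kap0 Ea Eb ab _ EM Mge' _) => //.
  - by apply: le_trans Jh; rewrite lerDl.
  - by apply: le_trans Jh; rewrite lerDr.
  - by eexists.
  - by apply: hMT.
  - by rewrite /Tm lerDl ltW.
  - by rewrite /Tm lerDr addr_ge0 // ltW.
  - move=> t h1 h2; have t00' : 0 <= t by apply: le_trans h1.
    have te : t * (kap / Tm) <= kap.
      by rewrite mulrCA ler_piMr ?(ltW kap0) // ler_pdivrMr // mul1r.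
    by have [q1 q2] := hab t h1; split; [apply: le_trans q1 te|apply: le_trans q2 te].
have X0 : 0 < (1 - c) * c1 by rewrite mulr_gt0 // subr_gt0.
have -> : K * kap = (1 - c) * c1 / 2 by rewrite /kap; field; rewrite lt0r_neq0.
lra.
Qed.

End Positive.
End Lattice.

(** * The residue of the resolvent at the pole *)

Section Laurent.
Variables (R : realType) (V : completeNormedModType R[i]).
Implicit Types (x y z : V) (l e : R).

Ltac lmod := lmod_with R[i] V ltac:(try ring).

Lemma expz_sub (a : R[i]) (n k : nat) : a != 0 -> a ^ (n%:Z - k%:Z) = a ^+ n / a ^+ k.
Proof. by move=> a0; rewrite expfzDr // -exprnN. Qed.

Variables (r : R) (k : nat) (U : nat -> V -> V) (F : R -> V -> V) (C : R).
Hypotheses (r0 : 0 < r) (Ubd : forall n, bdd_linear (U n))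
  (Fbd : forall l, 0 < l -> l < r -> opbound (F l) (C / l))
  (Fsum : forall l, 0 < l -> l < r -> forall e, 0 < e -> exists N, forall n, (N <= n)%N ->
     opbound (fun x => F l x - \sum_(i < n) ((l ^+ i / l ^+ k)%:C *: U i x)) e).

Let Ulin n : is_linear (U n). Proof. by case: (Ubd n). Qed.

(** Cauchy estimates without contour integrals: late partial sums at [rho] are within [1] of
    [F rho], so each late term has norm at most [2]. The finitely many early coefficients are
    bounded separately. *)
Lemma coef_bound (rho : R) : 0 < rho -> rho < r ->
  exists2 B, 0 <= B & forall n, opbound (U n) (B / rho ^+ n).
Proof.
move=> p0 pr; have [N hN] := Fsum p0 pr ltr01.
have hU n : exists c, opbound (U n) c by case: (Ubd n).
have [c hc] := choice hU.
pose B := \sum_(i < N) `|c i| * rho ^+ i + 2 * rho ^+ k.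
have pn n : 0 < rho ^+ n by rewrite exprn_gt0.
have B0 : 0 <= \sum_(i < N) `|c i| * rho ^+ i.
  by apply: sumr_ge0 => i _; rewrite mulr_ge0 // ltW.
exists B; first by rewrite addr_ge0 // mulr_ge0 // ltW.
move=> n x; have [nN|Nn] := ltnP n N.
  apply: le_trans (hc n x) _; apply: ler_wpM2r; first exact: nrm_ge0.
  rewrite ler_pdivlMr //; apply: (@le_trans _ _ (`|c n| * rho ^+ n)).
    by rewrite ler_wpM2r ?(ltW (pn _)) // ler_norm.
  rewrite /B (bigD1 (Ordinal nN)) //= -addrA lerDl addr_ge0 //.
    by apply: sumr_ge0 => i _; rewrite mulr_ge0 // ltW.
  by rewrite mulr_ge0 // ltW.
have h1 := hN n Nn x; have h2 := hN n.+1 (leqW Nn) x.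
rewrite big_ord_recr /= in h2.
set s := \sum_(i < n) _ in h1 h2; set t := _ *: U n x in h2.
have ht : nrm t <= 2 * nrm x.
  rewrite (_ : t = (F rho x - s) - (F rho x - (s + t))); last by lmod.
  by apply: le_trans (nrmB _ _) _; lra.
move: ht; rewrite /t nrmZr ger0_norm ?divr_ge0 ?(ltW (pn _)) // => ht.
have -> : B / rho ^+ n * nrm x = B * nrm x / rho ^+ n by rewrite mulrAC.
rewrite ler_pdivlMr //.
have h3 : rho ^+ n * nrm (U n x) <= 2 * rho ^+ k * nrm x.
  move: ht; rewrite mulrAC ler_pdivrMr //; lra.
rewrite mulrC; apply: le_trans h3 _; apply: ler_wpM2r; first exact: nrm_ge0.
by rewrite lerDr.
Qed.

(** Multiplied by [l ^+ k] the expansion is a power series. For [2 * l <= rho] its tail is dominated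
    by a geometric series of ratio one half, whence the factor [2]. *)
Lemma laurent_tail : exists2 B, 0 <= B & exists2 rho, 0 < rho & forall l m, 0 < l -> l < r -> 2 * l <= rho ->
  opbound (fun x => (l ^+ k)%:C *: F l x - \sum_(i < m) ((l ^+ i)%:C *: U i x)) (B * (l / rho) ^+ m).
Proof.
pose rho := r / 2; have p0 : 0 < rho by rewrite divr_gt0.
have pr : rho < r by have := r0; rewrite /rho; lra.
have [B B0 hB] := coef_bound p0 pr.
exists (2 * B); first by rewrite mulr_ge0.
exists rho => // l m l0 lr l2 x.
have q0 : 0 <= l / rho by rewrite divr_ge0 // ltW.
have q1 : l / rho <= 2^-1 by rewrite ler_pdivrMr // mulrC ler_pdivlMr // mulrC.
have lk : 0 < l ^+ k by rewrite exprn_gt0.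
set q := l / rho in q0 q1 *.
have part n : nrm (\sum_(i < n) ((l ^+ (m + i))%:C *: U (m + i)%N x)) <= 2 * B * q ^+ m * nrm x * (1 - 2^-1 ^+ n).
  elim: n => [|n IH]; first by rewrite big_ord0 nrm0 expr0 subrr mulr0.
  rewrite big_ord_recr /=; apply: le_trans (nrmD _ _) _.
  have h1 : nrm ((l ^+ (m + n))%:C *: U (m + n)%N x) <= B * q ^+ m * nrm x * 2^-1 ^+ n.
    rewrite nrmZr ger0_norm ?exprn_ge0 ?(ltW l0) //.
    apply: (@le_trans _ _ (l ^+ (m + n) * (B / rho ^+ (m + n) * nrm x))).
      by apply: ler_wpM2l; [rewrite exprn_ge0 // ltW|apply: hB].
    have -> : l ^+ (m + n) * (B / rho ^+ (m + n) * nrm x) = B * q ^+ m * nrm x * q ^+ n.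
      rewrite /q !expr_div_n !exprD; field; by rewrite !expf_neq0 ?lt0r_neq0.
    apply: ler_wpM2l; first by rewrite !mulr_ge0 ?exprn_ge0 ?nrm_ge0.
    by apply: lerXn2r; rewrite ?nnegrE ?invr_ge0.
  apply: le_trans (lerD IH h1) _; rewrite exprS; lra.
apply/ler_addgt0Pr => e e0.
have x1 : 0 < (nrm x + 1) * l ^+ k by rewrite mulr_gt0 // ltr_wpDl ?nrm_ge0.
have [N hN] := Fsum l0 lr (divr_gt0 e0 x1).
have := hN (m + N)%N (leq_addl _ _) x; rewrite big_split_ord /= => h.
have := part N; set tl := \sum_(i < N) _ => hp.
rewrite (_ : _ - _ = (l ^+ k)%:C *: (F l x - (\sum_(i < m) ((l ^+ i / l ^+ k)%:C *: U i x) +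
   \sum_(i < N) ((l ^+ (m + i) / l ^+ k)%:C *: U (m + i)%N x))) + tl); last first.
  have sc n (g : nat -> V) (h' : nat -> R) : (l ^+ k)%:C *: \sum_(i < n) ((h' i / l ^+ k)%:C *: g i) =
      \sum_(i < n) ((h' i)%:C *: g i).
    rewrite scaler_sumr; apply: eq_bigr => i _.
    by rewrite scalerA -rmorphM mulrC divfK // lt0r_neq0.
  rewrite scalerBr scalerDr (sc m (fun i => U i x) (fun i => l ^+ i)).
  rewrite (sc N (fun i => U (m + i)%N x) (fun i => l ^+ (m + i))) /= -/tl; lmod.
apply: le_trans (nrmD _ _) _; rewrite [leRHS]addrC; apply: lerD; last first.
  apply: le_trans hp _; rewrite -[leRHS]mulr1; apply: ler_wpM2l.
    by rewrite !mulr_ge0 ?exprn_ge0 ?nrm_ge0.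
  by rewrite gerBl exprn_ge0 // invr_ge0.
rewrite nrmZr ger0_norm ?(ltW lk) // mulrC -ler_pdivlMr //; apply: le_trans h _.
rewrite invfM mulrA mulrAC ler_wpM2r ?invr_ge0 ?(ltW lk) //.
rewrite mulrAC ler_pdivrMr ?ltr_wpDl ?nrm_ge0 // ler_wpM2l ?lerDl // ltW //.
Qed.

(* As [l F l] is bounded near [0], the coefficients below [k - 1] vanish one after the
   other and [Q] is the coefficient of index [k - 1]. *)
Lemma laurent_limit : exists Q, [/\ is_linear Q, exists C', opbound Q C' &
  forall e, 0 < e -> exists l, [/\ 0 < l, l < r, l < e & opbound (fun x => l%:C *: F l x - Q x) e]].
Proof.
have [B B0 [rho p0 tl]] := laurent_tail.
have small e : 0 < e -> forall c, 0 <= c -> exists l, [/\ 0 < l, l < r, l < e, 2 * l <= rho & c * l <= e] /\ l <= 1.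
  move=> e0 c c0; have c1 : 0 < c + 1 by rewrite ltr_wpDl.
  pose l := Num.min (Num.min (r / 2) (e / 2)) (Num.min (Num.min (rho / 2) 1) (e / (c + 1))).
  have l0 : 0 < l by rewrite !lt_min ltr01 !divr_gt0.
  have r0' := r0.
  exists l; have : l <= l by []; rewrite {2}/l !le_min => /andP [/andP [a1 a2] /andP [/andP [a3 a4] a5]].
  split => //; split => //; try lra.
  rewrite mulrC; move: a5; rewrite ler_pdivlMr // => a5; nra.
case: k tl Fsum => [|k'] tl _.
  (* Without negative powers [F l] stays bounded, so [l F l] tends to [0]. *)
  exists (fun=> 0); split.
  - by move=> a x y; rewrite scaler0 addr0.
  - by exists 0 => x; rewrite nrm0 mul0r.
  - move=> e e0; have [l [[l0 lr le l2 cl] _]] := small e e0 B B0.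
    exists l; split => // x; have := tl l 0%N l0 lr l2 x.
    rewrite big_ord0 !expr0 scale1r !subr0 mulr1 nrmZr gtr0_norm // => h.
    have := nrm_ge0 x; have := nrm_ge0 (F l x) => *; nra.
have Fb l x : 0 < l -> l < r -> nrm ((l ^+ k'.+1)%:C *: F l x) <= `|C| * l ^+ k' * nrm x.
  move=> l0 lr; rewrite nrmZr ger0_norm ?exprn_ge0 ?(ltW l0) //.
  apply: (@le_trans _ _ (l ^+ k'.+1 * (C / l * nrm x))).
    by rewrite ler_wpM2l ?exprn_ge0 ?(ltW l0) // Fbd.
  rewrite exprS (_ : l * l ^+ k' * (C / l * nrm x) = C * (l ^+ k' * nrm x)); last by field; rewrite lt0r_neq0.
  by rewrite -mulrA ler_wpM2r ?mulr_ge0 ?exprn_ge0 ?nrm_ge0 ?(ltW l0) // ler_norm.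
have U0 n : (n < k')%N -> forall x, U n x = 0.
  elim/ltn_ind: n => n IH nk x; apply: nrm_small => e e0.
  pose c := (`|C| + B / rho ^+ n.+1) * nrm x.
  have c0 : 0 <= c.
    by rewrite mulr_ge0 ?nrm_ge0 // addr_ge0 // divr_ge0 // exprn_ge0 // ltW.
  have [l [[l0 lr le l2 cl] l1]] := small e e0 c c0.
  have ln : 0 < l ^+ n by rewrite exprn_gt0.
  have := tl l n.+1 l0 lr l2 x.
  rewrite big_ord_recr /= big1 ?add0r; last first.
    by move=> i _; rewrite IH ?scaler0 // (ltn_trans (ltn_ord i)).
  move=> h1; have h2 := Fb l x l0 lr.
  have h3 : nrm ((l ^+ n)%:C *: U n x) <= `|C| * l ^+ k' * nrm x + B * (l / rho) ^+ n.+1 * nrm x.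
    apply: le_trans (nrm_sub_le _ ((l ^+ k'.+1)%:C *: F l x)) _.
    by rewrite nrmBC addrC; apply: lerD.
  have h4 : l ^+ k' <= l ^+ n.+1 by rewrite ler_wiXn2l ?(ltW l0).
  apply: le_trans cl; rewrite /c; move: h3; rewrite nrmZr ger0_norm ?(ltW ln) //.
  rewrite -(ler_pM2l ln) => /le_trans; apply.
  have -> : l ^+ n * ((`|C| + B / rho ^+ n.+1) * nrm x * l) =
     `|C| * l ^+ n.+1 * nrm x + B * (l / rho) ^+ n.+1 * nrm x.
    by rewrite expr_div_n [l ^+ n.+1]exprS; ring.
  rewrite lerD2r; apply: ler_wpM2r; first exact: nrm_ge0.
  exact: ler_wpM2l.
exists (U k'); split => //; first by case: (Ubd k').
move=> e e0; have c0 : 0 <= B / rho ^+ k'.+1 by rewrite divr_ge0 // exprn_ge0 // ltW.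
have [l [[l0 lr le l2 cl] _]] := small e e0 _ c0.
exists l; split => // x; have lk : 0 < l ^+ k' by rewrite exprn_gt0.
have := tl l k'.+1 l0 lr l2 x.
rewrite big_ord_recr /= big1 ?add0r; last by move=> i _; rewrite U0 ?scaler0.
rewrite exprS mulrC rmorphM -scalerA -scalerBr nrmZr ger0_norm ?(ltW lk) // => h.
rewrite -(ler_pM2l lk); apply: le_trans h _.
have -> : B * (l / rho) ^+ k'.+1 * nrm x = l ^+ k' * (B / rho ^+ k'.+1 * l * nrm x).
  by rewrite expr_div_n [l ^+ k'.+1]exprS; ring.
by apply: ler_wpM2l; rewrite ?(ltW lk) // ler_wpM2r ?nrm_ge0.
Qed.

End Laurent.

(** * The residue as mean ergodic projection *)

Section Mean.
Variables (R : realType) (V : completeNormedModType R[i]) (T : R -> V -> V) (M : R).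
Implicit Types (x y z : V) (t s l e : R).
Hypotheses (sg : lb_semigroup T) (M1 : 1 <= M) (TM : forall t, 0 <= t -> opbound (T t) M).

Ltac lmod := lmod_with R[i] V ltac:(try ring).

Let Tlin t : 0 <= t -> is_linear (T t). Proof. by case: sg => + _ _ _ _; apply. Qed.
Let TD t s x : 0 <= t -> 0 <= s -> T (t + s) x = T t (T s x).
Proof. by case: sg => _ _ + _ _; apply. Qed.
Let M0 : 0 < M. Proof. exact: lt_le_trans M1. Qed.

Lemma nrm_crescale l t x : nrm (crescale T l%:C t x) = expR (- (l * t)) * nrm (T t x).
Proof. by rewrite /crescale nrmZ cabs_cexp raddfN /= mulNr. Qed.

Lemma integ_M t x : 0 <= t -> nrm (integ T t x) <= t * M * nrm x.
Proof. by move=> t0; apply: (integ_opbound sg) => // s s0 _; apply: TM. Qed.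

(** Instead of a Laplace integral over the half line, an integral over [[0, t]] with [t = 2 * M / l]
    is used. At this time the rescaled operator has norm at most one half, and that term is absorbed
    on the left. *)
Lemma resolvent_bound l (Rl : V -> V) : 0 < l -> is_resolvent T l%:C Rl -> opbound Rl (4 * M ^+ 2 / l).
Proof.
move=> l0 [_ h2 _] x; set y := Rl x.
have hg : gen (crescale T l%:C) y (- x).
  have /generatorP /(gen_crescale l%:C) := h2 x.
  by rewrite -/y (_ : _ - _ - _ = - x) //; lmod.
pose t := 2 * M / l; have t0 : 0 < t by rewrite !divr_gt0 // mulr_gt0.
have := integ_gen (crescale_lb l%:C sg) (ltW t0) hg => hi.
have n1 : nrm (crescale T l%:C t y) <= 2^-1 * nrm y.
  rewrite nrm_crescale; apply: (@le_trans _ _ (expR (- (l * t)) * (M * nrm y))).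
    by rewrite ler_wpM2l ?expR_ge0 // TM // ltW.
  rewrite mulrA ler_wpM2r ?nrm_ge0 // expRN mulrC ler_pdivrMr ?expR_gt0 //.
  have := expR_ge1Dx (l * t); rewrite /t mulrC divfK ?lt0r_neq0 //; lra.
have n2 : nrm (integ (crescale T l%:C) t (- x)) <= t * M * nrm x.
  rewrite -(nrmN x); apply: (integ_opbound (crescale_lb l%:C sg)); first exact: ltW.
  move=> s s0 _; rewrite nrm_crescale; apply: le_trans (TM s0 _).
  by rewrite ler_piMl ?nrm_ge0 // -expR0 ler_expR oppr_le0 mulr_ge0 // ltW.
have : nrm y <= nrm (crescale T l%:C t y) + nrm (integ (crescale T l%:C) t (- x)).
  by rewrite hi -(nrmN (_ - y)) opprB; apply: le_trans (nrm_sub_le _ (crescale T l%:C t y)) _; rewrite addrC.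
move=> h; have : nrm y <= 2 * (t * M * nrm x) by lra.
move/le_trans; apply; rewrite le_eqVlt; apply/orP; left; apply/eqP.
by rewrite /t; field; rewrite lt0r_neq0.
Qed.

Lemma resolvent_comm l (Rl : V -> V) t x : 0 <= t -> is_resolvent T l%:C Rl -> Rl (T t x) = T t (Rl x).
Proof.
move=> t0 [[lR _] h2 h3]; have /generatorP hg := h2 x.
have : gen T (T t (Rl x)) (T t (l%:C *: Rl x - x)).
  apply: (gen_map (C := M)) hg => //; [exact: Tlin|exact: TM|].
  by move=> s s0; rewrite (SC sg).
move/generatorP/h3 => <-; congr (Rl _); rewrite (linB (Tlin t0)) (linZ (Tlin t0)); lmod.
Qed.

Variables (Q : V -> V) (F : R -> V -> V) (r C' : R).
Hypotheses (Qlin : is_linear Q) (Qb : opbound Q C') (F_res : forall l, 0 < l -> l < r -> is_resolvent T l%:C (F l))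
  (Flim : forall e, 0 < e -> exists l, [/\ 0 < l, l < r, l < e & opbound (fun x => l%:C *: F l x - Q x) e]).

Let C := 4 * M ^+ 2.
Let C0 : 0 <= C. Proof. by rewrite mulr_ge0 // exprn_ge0 // ltW. Qed.

Lemma F_bound l x : 0 < l -> l < r -> nrm (l%:C *: F l x) <= C * nrm x.
Proof.
move=> l0 lr; rewrite nrmZr gtr0_norm //; have := resolvent_bound l0 (F_res l0 lr) x.
move=> h; apply: (@le_trans _ _ (l * (C / l * nrm x))); first by rewrite ler_pM2l.
by rewrite mulrA mulrCA mulfV ?mulr1 // lt0r_neq0.
Qed.

Lemma F_gen l x t : 0 < l -> l < r -> 0 <= t ->
  nrm (T t (F l x) - F l x) <= t * (M * (C + 1) * nrm x).
Proof.
move=> l0 lr t0; have [_ h2 _] := F_res l0 lr; have /generatorP hg := h2 x.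
rewrite -(integ_gen sg t0 hg).
apply: le_trans (integ_M _ t0) _.
rewrite -!mulrA ler_wpM2l // ler_wpM2l ?(ltW M0) //.
by apply: le_trans (nrmB _ _) _; rewrite mulrDl mul1r lerD2r F_bound.
Qed.

(** The generator maps [F l x] to the bounded vector [l F l x - x], so [T t] moves [l F l x] only by
    [O(l)]. *)
Lemma T_residue t x : 0 <= t -> T t (Q x) = Q x.
Proof.
move=> t0; apply: eq_nrm_small => e e0.
pose K := M * nrm x + nrm x + t * (M * (C + 1) * nrm x) + 1.
have K0 : 0 < K by rewrite ltr_wpDl // !addr_ge0 ?mulr_ge0 ?nrm_ge0 ?addr_ge0 ?(ltW M0).
have [l [l0 lr le hl]] := Flim (divr_gt0 e0 K0).
have -> : T t (Q x) - Q x = - T t (l%:C *: F l x - Q x) + (l%:C *: F l x - Q x) +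
   l%:C *: (T t (F l x) - F l x).
  by rewrite (linB (Tlin t0)) (linZ (Tlin t0)); lmod.
apply: (@le_trans _ _ (e / K * (M * nrm x) + e / K * nrm x + e / K * (t * (M * (C + 1) * nrm x)))).
  apply: le_trans (nrmD _ _) _; apply: lerD.
    apply: le_trans (nrmD _ _) _; apply: lerD; last exact: hl.
    by rewrite nrmN; apply: le_trans (TM t0 _) _; rewrite mulrCA ler_wpM2l ?(ltW M0).
  rewrite nrmZr gtr0_norm //; apply: ler_pM; rewrite ?nrm_ge0 ?(ltW l0) ?(ltW le) //.
  exact: F_gen.
rewrite -!mulrDr mulrAC ler_pdivrMr // ler_wpM2l ?(ltW e0) // lerDl //.
Qed.

Lemma residue_T t x : 0 <= t -> Q (T t x) = Q x.
Proof.
move=> t0; rewrite -[RHS](T_residue x t0); apply: eq_nrm_small => e e0.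
pose K := M * nrm x + M * nrm x + 1.
have K0 : 0 < K by rewrite ltr_wpDl // !addr_ge0 ?mulr_ge0 ?nrm_ge0 ?(ltW M0).
have [l [l0 lr le hl]] := Flim (divr_gt0 e0 K0).
have -> : Q (T t x) - T t (Q x) = - (l%:C *: F l (T t x) - Q (T t x)) + T t (l%:C *: F l x - Q x).
  by rewrite (resolvent_comm x t0 (F_res l0 lr)) (linB (Tlin t0)) (linZ (Tlin t0)); lmod.
apply: (@le_trans _ _ (e / K * (M * nrm x) + e / K * (M * nrm x))).
  apply: le_trans (nrmD _ _) _; apply: lerD.
    rewrite nrmN; apply: le_trans (hl _) _; apply: ler_wpM2l; last exact: TM.
    by rewrite ltW // divr_gt0.
  by apply: le_trans (TM t0 _) _; rewrite mulrCA ler_wpM2l ?(ltW M0).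
rewrite -(mulrDr (e / K)) mulrAC ler_pdivrMr // ler_wpM2l ?(ltW e0) // lerDl //.
Qed.

Lemma integ_residue t x : 0 <= t -> integ T t (Q x) = t%:C *: Q x.
Proof.
move=> t0; apply/eqP; rewrite -subr_eq0; apply/eqP/nrm_small => e e0.
have := @integ_near _ _ _ sg t (Q x) (Q x) 0 t0; rewrite mulr0 => h.
apply: le_trans (ltW e0); apply: h => s s0 _; by rewrite T_residue // subrr nrm0.
Qed.

(** [l F l x] is uniformly close to [Q x], which equals its own mean. The vector [x - l F l x] is
    minus the generator applied to [F l x], so its mean over [[0, L]] is [O(1 / L)] for fixed [l].
    Hence [l] is fixed before [L]. *)
Lemma mean_ergodic e : 0 < e -> exists2 L, 0 < L & forall x, nrm (L^-1%:C *: integ T L x - Q x) <= e * nrm x.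
Proof.
move=> e0; have e2 : 0 < e / (2 * M) by rewrite divr_gt0 // mulr_gt0.
have [l [l0 lr le hl]] := Flim e2.
pose B := (M + 1) * C / l.
have B0 : 0 <= B by rewrite !mulr_ge0 ?invr_ge0 ?addr_ge0 ?(ltW M0) ?(ltW l0).
pose L := (B + 1) * 2 / e; have L0 : 0 < L by rewrite divr_gt0 // mulr_gt0 // ltr_wpDl.
exists L => // x; have L0' := ltW L0; have lJ := integ_lin sg L0'.
have [_ h2 _] := F_res l0 lr; have /generatorP hg := h2 x.
have hi := integ_gen sg L0' hg.
have Lne : L != 0 by rewrite lt0r_neq0.
have -> : L^-1%:C *: integ T L x - Q x =
   - (L^-1%:C *: (T L (F l x) - F l x)) + L^-1%:C *: integ T L (l%:C *: F l x - Q x).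
  rewrite -hi !(linB lJ) (integ_residue x L0').
  have eq1 : Q x = L^-1%:C *: (L%:C *: Q x) by rewrite scalerA -rmorphM mulVf // scale1r.
  by rewrite [in LHS]eq1; lmod.
have n1 : nrm (L^-1%:C *: (T L (F l x) - F l x)) <= e / 2 * nrm x.
  rewrite nrmZr gtr0_norm ?invr_gt0 //.
  have hF : nrm (F l x) <= C / l * nrm x := resolvent_bound l0 (F_res l0 lr) x.
  have : nrm (T L (F l x) - F l x) <= B * nrm x.
    apply: le_trans (nrmB _ _) _; apply: (@le_trans _ _ (M * nrm (F l x) + nrm (F l x))).
      by rewrite lerD2r TM.
    have -> : B * nrm x = (M + 1) * (C / l * nrm x) by rewrite /B; ring.
    by rewrite -{2}(mul1r (nrm (F l x))) -mulrDl ler_wpM2l ?addr_ge0 ?(ltW M0).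
  move=> hB; rewrite mulrC ler_pdivrMr //; apply: le_trans hB _.
  have -> : e / 2 * nrm x * L = (B + 1) * nrm x by rewrite /L; field; rewrite lt0r_neq0.
  by rewrite ler_wpM2r ?nrm_ge0 // lerDl.
have n2 : nrm (L^-1%:C *: integ T L (l%:C *: F l x - Q x)) <= e / 2 * nrm x.
  rewrite nrmZr gtr0_norm ?invr_gt0 // mulrC ler_pdivrMr //.
  apply: le_trans (integ_M _ L0') _.
  apply: (@le_trans _ _ (L * M * (e / (2 * M) * nrm x))).
    by apply: ler_wpM2l; [rewrite mulr_ge0 // ltW|apply: hl].
  by rewrite (_ : L * M * (e / (2 * M) * nrm x) = e / 2 * nrm x * L) //; field; rewrite lt0r_neq0.
apply: le_trans (nrmD _ _) _; rewrite nrmN; lra.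
Qed.

(** As a limit of means [Q] inherits the bound of the semigroup, in place of the unspecified
    [C']. *)
Lemma residue_bound : opbound Q M.
Proof.
move=> x; apply/ler_addgt0Pr => e e0.
have x1 : 0 < nrm x + 1 by rewrite ltr_wpDl ?nrm_ge0.
have [L L0 hL] := mean_ergodic (divr_gt0 e0 x1).
apply: le_trans (nrm_sub_le _ (L^-1%:C *: integ T L x)) _; rewrite addrC; apply: lerD.
  rewrite nrmZr gtr0_norm ?invr_gt0 // mulrC ler_pdivrMr //.
  by have := integ_M x (ltW L0); rewrite -mulrA [leRHS]mulrC.
rewrite nrmBC; apply: le_trans (hL x) _; rewrite mulrAC ler_pdivrMr //.
by rewrite ler_wpM2l ?lerDl // ltW.
Qed.

Lemma residue_idem x : Q (Q x) = Q x.
Proof.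
apply: eq_nrm_small => e e0.
have x1 : 0 < nrm (Q x) + 1 by rewrite ltr_wpDl ?nrm_ge0.
have [L L0 hL] := mean_ergodic (divr_gt0 e0 x1).
have := hL (Q x); rewrite (integ_residue x (ltW L0)) scalerA -rmorphM mulVf ?lt0r_neq0 // scale1r nrmBC.
move/le_trans; apply; rewrite mulrAC ler_pdivrMr //.
by rewrite ler_wpM2l ?lerDl // ltW.
Qed.

End Mean.

(** * Decay of powers from uniform lower bounds *)

Section Decay.
Variables (R : realType) (V : completeNormedModType R[i]) (B : V -> V) (N : set V) (M K : R).
Implicit Types (x y z : V) (s t : R).
Hypotheses (Blin : is_linear B) (N_B : forall x, N x -> N (B x))
  (NZ : forall (a : R[i]) x, N x -> N (a *: x)) (N_D : forall x y, N x -> N y -> N (x + y)) (N_0 : N 0)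
  (BM : forall n x, nrm (iter n B x) <= M * nrm x) (M0 : 0 <= M) (K0 : 0 <= K)
  (BK : forall t x, N x -> nrm x <= K * nrm (x - cis t *: B x)).

Ltac lmod := lmod_with R[i] V ltac:(try ring).

Let iterlin n : is_linear (iter n B).
Proof. by elim: n => [|n IH] a x y //=; rewrite IH Blin. Qed.
Let N_iter n x : N x -> N (iter n B x).
Proof. by move=> h; elim: n => [|n IH] //=; apply: N_B. Qed.

Definition geo_sum (n : nat) t x := \sum_(i < n) cis (i%:R * t) *: iter i B x.

Lemma geo_sum_in n t x : N x -> N (geo_sum n t x).
Proof.
move=> h; rewrite /geo_sum; elim/big_ind: _ => [//|u v|i _]; first exact: N_D.
by apply: NZ; apply: N_iter.
Qed.

(** Applying [1 - e^{it} B] telescopes the sum to [x - e^{int} B^n x], which is bounded in [n]. *)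
Lemma geo_sum_bound n t x : N x -> nrm (geo_sum n t x) <= K * (1 + M) * nrm x.
Proof.
move=> h; apply: le_trans (BK t (geo_sum_in n t h)) _; rewrite -mulrA ler_wpM2l //.
have -> : geo_sum n t x - cis t *: B (geo_sum n t x) = x - cis (n%:R * t) *: iter n B x.
  rewrite /geo_sum (lin_sum Blin) scaler_sumr -sumrB.
  elim: n => [|n IH]; first by rewrite big_ord0 mul0r cis0 scale1r subrr.
  rewrite big_ord_recr /= IH (linZ Blin) scalerA -cisD -natr1 mulrDl mul1r [t + _]addrC; lmod.
apply: le_trans (nrmB _ _) _; rewrite nrmZ cabs_cis mul1r mulrDl mul1r lerD2l; exact: BM.
Qed.

Lemma cis_neq1 t : 0 < t -> t < pi *+ 2 -> cis t != 1.
Proof.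
move=> t0 t2; apply/eqP => h; have := cabs_cis_sub1 t.
rewrite h subrr /cabs normr0 expr0n /= => hc.
have s0 : 0 < sin (t / 2).
  by apply: sin_gt0_pi; rewrite divr_gt0 //= ltr_pdivrMr // mulr_natr.
have := cosD (t / 2) (t / 2); rewrite -splitr.
have := cos2Dsin2 (t / 2); have := mulr_gt0 s0 s0; rewrite !expr2; lra.
Qed.

Lemma cis_2pi n : cis (pi *+ 2 *+ n) = 1 :> R[i].
Proof.
elim: n => [|n IH]; first by rewrite mulr0n cis0.
rewrite mulrSr cisD IH mul1r /cis (_ : pi *+ 2 = 0 + pi *+ 2) ?add0r // -[pi *+ 2]add0r.
by rewrite (cosD2pi) (sinD2pi) cos0 sin0 mulr0 addr0.
Qed.

(** Orthogonality of the characters of a cyclic group of order [D]; a finite sum replaces the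
    integral over the circle when coefficients are extracted. *)
Lemma cis_orthogonality (D p q : nat) : (p < D)%N -> (q < D)%N ->
  \sum_(l < D) cis (p%:R * (pi *+ 2 / D%:R * l%:R)) * cis (- (q%:R * (pi *+ 2 / D%:R * l%:R))) =
  (if p == q then D%:R else 0) :> R[i].
Proof.
move=> pD qD; have D0 : (0 < D)%N by apply: leq_ltn_trans pD.
have Dn : D%:R != 0 :> R by rewrite pnatr_eq0 -lt0n.
pose u := (p%:R - q%:R) * (pi *+ 2 / D%:R) : R.
have e l : cis (p%:R * (pi *+ 2 / D%:R * l%:R)) * cis (- (q%:R * (pi *+ 2 / D%:R * l%:R))) = cis u ^+ l.
  rewrite -cisD (_ : _ + _ = u * l%:R); last by rewrite /u; ring.
  by elim: l => [|l IH]; rewrite ?mulr0 ?cis0 // -natr1 mulrDr mulr1 cisD IH exprSr.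
under eq_bigr => l _ do rewrite e.
have [pq|pq] := eqVneq p q.
  rewrite /u pq subrr mul0r cis0; under eq_bigr do rewrite expr1n.
  by rewrite sumr_const card_ord.
have u1 : cis u != 1.
  have gen (m : R) : 0 < m -> m < D%:R -> cis (m * (pi *+ 2 / D%:R)) != 1.
    move=> m0 mD; apply: cis_neq1; first by rewrite mulr_gt0 // divr_gt0 ?ltr0n // pmulrn_lgt0 // pi_gt0.
    by rewrite mulrA ltr_pdivrMr ?ltr0n // mulrC ltr_pM2l // pmulrn_lgt0 // pi_gt0.
  have [lt|] := ltnP q p.
    apply: gen; first by rewrite subr_gt0 ltr_nat.
    by apply: le_lt_trans (_ : _ <= p%:R) _; rewrite ?ltr_nat // gerBl.
  rewrite leq_eqVlt (negbTE pq) /= => lt.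
  have h : cis (- u) != 1.
    rewrite /u -mulNr opprB; apply: gen; first by rewrite subr_gt0 ltr_nat.
    by apply: le_lt_trans (_ : _ <= q%:R) _; rewrite ?ltr_nat // gerBl.
  by apply: contraNneq h => h1; have := cisN u; rewrite h1 mul1r => ->.
have uD : cis u ^+ D = 1.
  have -> : cis u ^+ D = cis (u * D%:R).
    elim: D {pD qD D0 Dn e u1 u} (u) => [|D IH] u; first by rewrite mulr0 cis0.
    by rewrite -natr1 mulrDr mulr1 cisD -IH exprSr.
  have -> : u * D%:R = pi *+ 2 *+ p - pi *+ 2 *+ q.
    by rewrite /u -[in RHS]mulr_natr -[pi *+ 2 *+ q]mulr_natr; field.
  have := cisN (pi *+ 2 *+ q : R); rewrite cisD !cis_2pi !mul1r //.
have : (cis u - 1) * \sum_(l < D) cis u ^+ l = 0.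
  by rewrite -subrX1 uD subrr.
by move/eqP; rewrite mulf_eq0 subr_eq0 (negbTE u1) /= => /eqP.
Qed.

(* Compare the coefficient of order [j] in the square of the geometric sum. *)
Lemma iter_decay j x : N x -> j.+1%:R * nrm (iter j B x) <= (K * (1 + M)) ^+ 2 * nrm x.
Proof.
(* The exponents [p + q] are at most [2 * j < D], so distinct exponents are not confused modulo
   [D]. *)
move=> Nx; pose D := (2 * j.+1)%N; pose n := j.+1.
pose th (l : nat) : R := pi *+ 2 / D%:R * l%:R.
have Dn : (0 < D)%N by [].
have key : \sum_(l < D) (cis (- (j%:R * th l)) *: geo_sum n (th l) (geo_sum n (th l) x)) =
    (D%:R * n%:R) *: iter j B x.
  have e l : cis (- (j%:R * th l)) *: geo_sum n (th l) (geo_sum n (th l) x) =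
     \sum_(p < n) \sum_(q < n) (cis ((p + q)%:R * th l) * cis (- (j%:R * th l))) *: iter (p + q) B x.
    rewrite /geo_sum scaler_sumr; apply: eq_bigr => p _.
    rewrite (lin_sum (iterlin p)) !scaler_sumr; apply: eq_bigr => q _.
    rewrite (linZ (iterlin p)) !scalerA iterD; congr (_ *: _).
    by rewrite (natrD _ p q) (mulrDl p%:R q%:R) cisD; ring.
  under eq_bigr => l _ do rewrite e.
  rewrite exchange_big /=.
  (* For each [p <= j] only [q = j - p] survives, which yields [j + 1] equal terms. *)
  transitivity (\sum_(p < n) D%:R *: iter j B x).
    apply: eq_bigr => p _; rewrite exchange_big /=.
    have hp : (p <= j)%N by rewrite -ltnS.
    have hq : (j - p < n)%N by rewrite ltnS leq_subr.
    rewrite (bigD1 (Ordinal hq)) //= [X in _ + X]big1 ?addr0; last first.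
      move=> q nq; rewrite -scaler_suml cis_orthogonality //.
      - rewrite ifF ?scale0r //; apply: contraNF nq => /eqP h.
        by apply/eqP/val_inj => /=; rewrite -h addKn.
      - by rewrite /D mul2n -addnn addSn ltnS leq_add // ltnW.
      - by rewrite /D mul2n -addnn ltn_addr.
    rewrite -scaler_suml cis_orthogonality; first by rewrite subnKC // eqxx.
      by rewrite subnKC // /D mul2n -addnn ltn_addr.
    by rewrite /D mul2n -addnn ltn_addr.
  by rewrite sumr_const card_ord -scaler_nat scalerA mulrC.
have b l : nrm (cis (- (j%:R * th l)) *: geo_sum n (th l) (geo_sum n (th l) x)) <= (K * (1 + M)) ^+ 2 * nrm x.
  rewrite nrmZ cabs_cis mul1r; apply: le_trans (geo_sum_bound _ _ (geo_sum_in _ _ Nx)) _.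
  rewrite expr2 -(mulrA (K * (1 + M))); apply: ler_wpM2l; last exact: geo_sum_bound.
  by rewrite mulr_ge0 // addr_ge0.
have := nrm_sum_le (n := D) (fun l _ => b l).
rewrite key -natrM -(rmorph_nat (real_complex R)) nrmZr ger0_norm // natrM -mulrA ler_pM2l ?ltr0n //.
Qed.

End Decay.

(** * Convergence of the semigroup *)

Section Convergence.
Variables (R : realType) (V : completeNormedModType R[i]) (Er P : set V).
Variables (T : R -> V -> V) (Q : V -> V) (M t0 : R).
Implicit Types (x y z : V) (t s e : R).
Hypotheses (lat : complex_banach_lattice Er P) (sg : lb_semigroup T) (t00 : 0 <= t0)
  (Tpos : forall t, t0 <= t -> positive_op P (T t))
  (M1 : 1 <= M) (TM : forall t, 0 <= t -> opbound (T t) M)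
  (Qlin : is_linear Q) (QM : opbound Q M)
  (QT : forall t x, 0 <= t -> Q (T t x) = Q x) (TQ : forall t x, 0 <= t -> T t (Q x) = Q x)
  (QQ : forall x, Q (Q x) = Q x)
  (Qmean : forall e, 0 < e -> exists2 L, 0 < L & forall x, nrm (L^-1%:C *: integ T L x - Q x) <= e * nrm x)
  (Tnc : forall e, 0 < e -> exists t1 d, [/\ 0 <= t1, 0 < d & forall t s x, t1 <= t -> 0 <= s -> s < d ->
     nrm (T (t + s) x - T t x) <= e * nrm x]).

Ltac lmod := lmod_with R[i] V ltac:(try ring).

Let Tlin t : 0 <= t -> is_linear (T t). Proof. by case: sg => + _ _ _ _; apply. Qed.
Let TD t s x : 0 <= t -> 0 <= s -> T (t + s) x = T t (T s x).
Proof. by case: sg => _ _ + _ _; apply. Qed.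
Let M0 : 0 < M. Proof. exact: lt_le_trans M1. Qed.

(** The error may grow like [t * eta], because in both cases only a bounded range of times, fixed
    before [eta], is inspected. *)
Lemma no_approx_eigenvector (b c1 : R) : 0 < c1 ->
  (forall eta, 0 < eta -> exists y, [/\ Q y = 0, c1 <= nrm y &
     forall t, 0 <= t -> nrm (T t y - cis (b * t) *: y) <= t * eta]) -> False.
Proof.
move=> c10 app; have [b0|b0] := eqVneq b 0.
  have half0 : 0 < 2^-1 :> R by rewrite invr_gt0.
  have [L L0 hL] := Qmean half0.
  (* The mean of [y] over [[0, L]] is within [c1 / 4] of [y] and has norm at most [nrm y / 2], since
     [Q y = 0]. This contradicts [c1 <= nrm y]. *)
  have eta0 : 0 < c1 / (4 * L) by rewrite divr_gt0 // mulr_gt0.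
  have [y [Qy cy hy]] := app _ eta0.
  have n1 : nrm (integ T L y - L%:C *: y) <= L * (L * (c1 / (4 * L))).
    apply: (integ_near sg (ltW L0)) => s s0 sL.
    have := hy s s0; rewrite b0 mul0r cis0 scale1r => /le_trans; apply.
    by rewrite ler_wpM2r // divr_ge0 ?mulr_ge0 // ltW.
  have := hL y; rewrite Qy subr0 => n2.
  have : nrm (L%:C *: y) <= nrm (L%:C *: y - integ T L y) + nrm (integ T L y) by apply: nrm_sub_le.
  rewrite nrmBC nrmZr gtr0_norm // => n3.
  move: n2; rewrite nrmZr gtr0_norm ?invr_gt0 // mulrC ler_pdivrMr // => n2.
  have e1 : L * (L * (c1 / (4 * L))) = L * (c1 / 4) by field; rewrite lt0r_neq0.
  have : L * nrm y <= L * (c1 / 4 + 2^-1 * nrm y) by rewrite e1 in n1; lra.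
  rewrite ler_pM2l //; lra.
pose g := `|b|; have g0 : 0 < g by rewrite normr_gt0.
pose eps := (32 * M)^-1.
have eps0 : 0 < eps by rewrite invr_gt0 mulr_gt0.
have [t1 [d [t10 d0 hd]]] := Tnc eps0.
have Me : 32 * M * eps <= 1 by rewrite mulfV // lt0r_neq0 // mulr_gt0.
apply: (no_rotation lat sg t00 Tpos Qlin (ltW M0) QM QT Qmean t10 d0 (ltW eps0) Me hd g0 c10).
move=> eta eta0; have [y [Qy cy hy]] := app eta eta0.
have key t : t0 <= t -> 0 <= t ->
   nrm (T t (rp lat y) - ((cos (b * t))%:C *: rp lat y - (sin (b * t))%:C *: ip lat y)) <= t * eta /\
   nrm (T t (ip lat y) - ((sin (b * t))%:C *: rp lat y + (cos (b * t))%:C *: ip lat y)) <= t * eta.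
  move=> tt0 t0'; have lT := Tlin t0'; set a := rp lat y; set c := ip lat y.
  have Ea : Er a by apply: rp_Er.
  have Ec : Er c by apply: ip_Er.
  set u := T t a - _; set v := T t c - _.
  have Eu : Er u by apply: (ErB lat); [apply: (T_Er lat sg t00 Tpos)|apply: (ErB lat); apply: (ErZ lat)].
  have Ev : Er v by apply: (ErB lat); [apply: (T_Er lat sg t00 Tpos)|apply: (ErD lat); apply: (ErZ lat)].
  have e1 : T t y - cis (b * t) *: y = u + 'i *: v.
    have i2 : ('i : R[i]) * 'i = -1 by rewrite -expr2 sqrCi.
    rewrite [in LHS](rip lat y) -/a -/c (linD lT) (linZ lT) /cis /u /v; lmod_with R[i] V ltac:(try ring: i2).
  have [h1 h2] := nrm_real_parts lat Eu Ev; have := hy t t0'; rewrite e1 => h3.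
  by split; [apply: le_trans h1 h3|apply: le_trans h2 h3].
have nab : c1 <= nrm (rp lat y) + nrm (ip lat y) by apply: le_trans cy (nrm_rip lat y).
have [bp|bn] := leP 0 b.
  exists (rp lat y), (ip lat y); split; [exact: rp_Er|exact: ip_Er|by []|].
  by move=> t tt0; rewrite /g ger0_norm //; apply: key => //; apply: le_trans tt0.
(* For negative [b] the complex conjugate of [y] rotates in the opposite direction. *)
exists (rp lat y), (- ip lat y); split; [exact: rp_Er|by apply: (ErN lat); exact: ip_Er|by rewrite nrmN|].
move=> t tt0; have t0' : 0 <= t by apply: le_trans tt0.
have [h1 h2] := key t tt0 t0'; rewrite /g ltr0_norm // mulNr cosN sinN; split.
  by move: h1; congr (nrm _ <= _); lmod.
by rewrite -nrmN; move: h2; congr (nrm _ <= _); rewrite (linN (Tlin t0')); lmod.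
Qed.

Variables (tau eps t1 : R).
Hypotheses (tau0 : 0 < tau) (eps0 : 0 < eps) (Meps : 12 * M * eps <= 1)
  (Ttau : forall t s x, t1 <= t -> 0 <= s -> s <= tau -> nrm (T (t + s) x - T t x) <= eps * nrm x).

Lemma cabs_cis_norm (u : R) : cabs (cis u - 1) = cabs (cis `|u| - 1).
Proof.
have [u0|u0] := leP 0 u; [by rewrite ger0_norm|rewrite ltr0_norm //].
have -> : cis u - 1 = - (cis u * (cis (- u) - 1)) by rewrite mulrBr mulr1 cisN opprB.
by rewrite cabsN cabsM cabs_cis mul1r.
Qed.

(** The chord from [1] to [e^{i theta}] grows with the angle up to [pi], which is why [al] is kept
    in [[-pi, pi]]. *)
Lemma cabs_cis_mono (al s : R) : `|al| <= pi -> 0 <= s -> s <= 1 ->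
  cabs (cis (- (al * s)) - 1) <= cabs (cis al - 1).
Proof.
move=> ha s0 s1.
rewrite -(@ler_pXn2r _ 2) ?nnegrE ?cabs_ge0 // !cabs_cis_sub1 cosN lerD2l lerN2 ler_pM2l //.
have e (v : R) : cos v = cos `|v|.
  by have [v0|v0] := leP 0 v; [rewrite ger0_norm|rewrite ltr0_norm // cosN].
rewrite (e al) (e (al * s)) normrM (ger0_norm s0).
have h : `|al| * s <= `|al| by rewrite ler_piMr.
rewrite leNgt ltr_cos ?in_itv /= ?normr_ge0 ?ha ?mulr_ge0 //= -?leNgt //.
exact: le_trans h ha.
Qed.

(* Otherwise [e^(-i al) T tau] almost fixes some [x] in [ker Q], and then
   [y = \int_0^tau e^(-i b s) T s x ds] with [b = al / tau] is an approximate eigenvector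
   for all times; norm continuity keeps [y] away from [0]. *)
Lemma unit_lower_bound (al : R) : `|al| <= pi ->
  exists2 K, 0 < K & forall x, Q x = 0 -> nrm x <= K * nrm (x - cis (- al) *: T tau x).
Proof.
move=> hal; apply: contrapT => nK.
have bad eta : 0 < eta -> exists x, [/\ Q x = 0, 0 < nrm x & nrm (x - cis (- al) *: T tau x) <= eta * nrm x].
  move=> e0; apply: contrapT => h; apply: nK; exists eta^-1; first by rewrite invr_gt0.
  move=> x Qx; rewrite leNgt; apply/negP => hx; apply: h; exists x; split => //.
    by apply: le_lt_trans hx; rewrite mulr_ge0 ?nrm_ge0 // invr_ge0 ltW.
  by rewrite mulrC -ler_pdivrMr //; apply: ltW; rewrite mulrC.
have tau0' := ltW tau0.
pose b := al / tau; have btau : b * tau = al by rewrite /b divfK // lt0r_neq0.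
pose S := crescale T ('i * b%:C).
have sgS : lb_semigroup S by apply: crescale_lb.
have SE t x : S t x = cis (- (b * t)) *: T t x.
  by rewrite /S /crescale -mulrN -rmorphN cexp_imag mulNr.
have SM t x : 0 <= t -> nrm (S t x) <= M * nrm x.
  by move=> tt; rewrite SE nrmZ cabs_cis mul1r; apply: TM.
have Slin t : 0 <= t -> is_linear (S t) by case: sgS => + _ _ _ _; apply.
have SD t s x : 0 <= t -> 0 <= s -> S (t + s) x = S t (S s x) by case: sgS => _ _ + _ _; apply.
pose J := (Num.truncn (t1 / tau)).+1.
have Jt : t1 <= J%:R * tau.
  by rewrite -ler_pdivrMr // ltW // truncnS_gt.
have Jt0 : 0 <= J%:R * tau by rewrite mulr_ge0.
have pow n x : nrm (S (n%:R * tau) x - x) <= n%:R * (M * nrm (S tau x - x)).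
  elim: n => [|n IH].
    by rewrite !mul0r; case: sgS => _ -> _ _ _; rewrite subrr nrm0.
  have n0 : 0 <= n%:R * tau by rewrite mulr_ge0.
  rewrite -natr1 !mulrDl !mul1r SD //.
  have -> : S (n%:R * tau) (S tau x) - x = S (n%:R * tau) (S tau x - x) + (S (n%:R * tau) x - x).
    by rewrite (linB (Slin _ n0)); lmod.
  by apply: le_trans (nrmD _ _) _; rewrite addrC; apply: lerD => //; apply: SM.
apply: (@no_approx_eigenvector b (tau / (4 * M))); first by rewrite divr_gt0 // mulr_gt0.
move=> eta eta0.
(* The first bound makes [y] an eigenvector up to [eta]; the second keeps [S (n tau) x] within
   [eps / 2 * nrm x] of [x] for [n <= J + 1]. *)
pose e1 := Num.min (eta / M) (eps / (2 * J.+1%:R * M)).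
have den : 0 < 2 * J.+1%:R * M by rewrite !mulr_gt0.
have e10 : 0 < e1 by rewrite lt_min !divr_gt0.
have [x [Qx x0 hx]] := bad _ e10.
have Sx : nrm (S tau x - x) <= e1 * nrm x by rewrite nrmBC SE btau.
have e1a : M * e1 <= eta by rewrite mulrC -ler_pdivlMr // ge_min lexx.
have e1b : J.+1%:R * (M * e1) <= eps / 2.
  have : e1 <= eps / (2 * J.+1%:R * M) by rewrite ge_min lexx orbT.
  by rewrite ler_pdivlMr // => h; lra.
have close n : (n <= J.+1)%N -> nrm (S (n%:R * tau) x - x) <= eps / 2 * nrm x.
  move=> nJ; apply: le_trans (pow n x) _.
  apply: (@le_trans _ _ (J.+1%:R * (M * (e1 * nrm x)))).
    by apply: ler_pM; rewrite ?mulr_ge0 ?nrm_ge0 ?(ltW M0) ?ler_nat // ler_pM2l.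
  by rewrite mulrA mulrA -(mulrA J.+1%:R) ler_wpM2r ?nrm_ge0.
(* From [J tau] to [(J + 1) tau] norm continuity allows only a change of size [eps], yet on [x] the
   step is nearly multiplication by [e^{i al}]. So [e^{i al}] is itself close to [1]. *)
have step1 : cabs (cis al - 1) <= 2 * eps.
  have h1 := close J (leqnSn _); have h2 := close J.+1 (leqnn _).
  have h3 := Ttau x Jt tau0' (lexx _).
  have h4 : nrm (S (J.+1%:R * tau) x - cis (- al) *: S (J%:R * tau) x) <= eps * nrm x.
    rewrite !SE scalerA -cisD -(natr1 J) mulrDl mul1r (mulrDr b) btau opprD [- al + _]addrC -scalerBr.
    by rewrite nrmZ cabs_cis mul1r.
  have e2 : cabs (cis al - 1) = cabs (1 - cis (- al)).
    have -> : cis al - 1 = cis al * (1 - cis (- al)) by rewrite mulrBr mulr1 cisN.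
    by rewrite cabsM cabs_cis mul1r.
  rewrite e2 -(ler_pM2r x0) -nrmZ.
  have -> : (1 - cis (- al)) *: x = - (S (J.+1%:R * tau) x - x) +
     (S (J.+1%:R * tau) x - cis (- al) *: S (J%:R * tau) x) + cis (- al) *: (S (J%:R * tau) x - x).
    lmod.
  apply: le_trans (nrmD _ _) _; rewrite nrmZ cabs_cis mul1r.
  apply: le_trans (lerD (nrmD _ _) (lexx _)) _; rewrite nrmN; lra.
(* Norm continuity acts only after [J tau], so [y] is bounded below through [S (J tau) y], an
   integral whose integrand is nearly the constant [z]. *)
pose z := S (J%:R * tau) x; pose y := integ S tau x.
have zx : nrm x / 2 <= nrm z.
  have := nrm_sub_le x z; rewrite nrmBC => h; have h1 := close J (leqnSn _); rewrite -/z in h1.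
  have : eps / 2 * nrm x <= nrm x / 2.
    rewrite mulrAC ler_pM2r ?invr_gt0 // ler_piMl ?(ltW x0) //.
    by have := ler_wpM2r (ltW eps0) M1; have := Meps; lra.
  lra.
have yz : nrm (S (J%:R * tau) y - tau%:C *: z) <= tau * (3 * M * eps * nrm x).
  rewrite /y (integ_S sgS) //; apply: (integ_near sgS) => // s s0 st.
  rewrite /z -SD // [s + _]addrC !SE mulrDr opprD cisD.
  have -> : (cis (- (b * (J%:R * tau))) * cis (- (b * s))) *: T (J%:R * tau + s) x -
     cis (- (b * (J%:R * tau))) *: T (J%:R * tau) x =
     cis (- (b * (J%:R * tau))) *: (cis (- (b * s)) *: (T (J%:R * tau + s) x - T (J%:R * tau) x) +
     (cis (- (b * s)) - 1) *: T (J%:R * tau) x) by lmod.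
  rewrite nrmZ cabs_cis mul1r; apply: le_trans (nrmD _ _) _; rewrite !nrmZ cabs_cis mul1r.
  have h1 := Ttau x Jt s0 st.
  have h2 : cabs (cis (- (b * s)) - 1) <= 2 * eps.
    apply: le_trans step1; have -> : b * s = al * (s / tau) by rewrite /b; ring.
    by apply: cabs_cis_mono => //; rewrite ?divr_ge0 // ler_pdivrMr // mul1r.
  have h3 : cabs (cis (- (b * s)) - 1) * nrm (T (J%:R * tau) x) <= 2 * eps * (M * nrm x).
    by apply: ler_pM; rewrite ?cabs_ge0 ?nrm_ge0 //; apply: TM.
  have h4 : eps * nrm x <= M * (eps * nrm x) by rewrite ler_peMl // mulr_ge0 ?nrm_ge0 // ltW.
  lra.
have ybig : tau / (4 * M) * nrm x <= nrm y.
  have h1 : nrm (S (J%:R * tau) y) <= M * nrm y by apply: SM.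
  have h2 := nrm_sub_le (tau%:C *: z) (S (J%:R * tau) y).
  rewrite nrmBC nrmZr gtr0_norm // in h2.
  have h3 : 3 * M * eps * nrm x <= nrm x / 4.
    by have := ler_wpM2r (ltW x0) Meps; lra.
  have h4 : tau * (nrm x / 2) <= tau * nrm z by rewrite ler_pM2l.
  have h5 : tau * (3 * M * eps * nrm x) <= tau * (nrm x / 4) by rewrite ler_pM2l.
  have h6 : tau * nrm x / 4 <= M * nrm y by lra.
  have -> : tau / (4 * M) * nrm x = (tau * nrm x / 4) / M by field; rewrite lt0r_neq0.
  by rewrite ler_pdivrMr // [leRHS]mulrC.
have Qy : Q y = 0.
  have e t w : 0 <= t -> Q w = 0 -> Q (T t w) = 0 by move=> tt; rewrite QT.
  apply: lims_unique (opbound_lims Qlin QM (integ_lims sgS x tau0')) _.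
  move=> d d0; exists 0%N => n _ /=; rewrite subr0 /rsum (linZ Qlin) (lin_sum Qlin) big1 ?scaler0 ?nrm0 ?ltW //.
  by move=> i _; rewrite SE (linZ Qlin) e ?scaler0 // mulr_ge0 // mesh_ge0.
have Sy t : 0 <= t -> nrm (S t y - y) <= t * (eta * nrm x).
  move=> tt; rewrite /y -(integ_shift sgS) //.
  have h1 := @integ_opbound _ _ _ sgS t M (S tau x - x) tt (fun s hs _ => SM s _ hs).
  apply: le_trans h1 _; rewrite -mulrA ler_wpM2l //.
  apply: (@le_trans _ _ (M * (e1 * nrm x))); first by rewrite ler_pM2l.
  by rewrite mulrA ler_wpM2r ?nrm_ge0.
exists ((nrm x)^-1%:C *: y); split.
- by rewrite (linZ Qlin) Qy scaler0.
- by rewrite nrmZr gtr0_norm ?invr_gt0 // [leRHS]mulrC ler_pdivlMr.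
- move=> t tt; rewrite (linZ (Tlin tt)).
  have -> : (nrm x)^-1%:C *: T t y - cis (b * t) *: ((nrm x)^-1%:C *: y) =
     (cis (b * t) * (nrm x)^-1%:C) *: (S t y - y).
    have c1 := cisN (b * t).
    rewrite SE -[X in X *: T t y]mul1r -c1; lmod.
  rewrite nrmZ cabsM cabs_cis mul1r cabs_real gtr0_norm ?invr_gt0 // mulrC ler_pdivrMr //.
  by rewrite -mulrA; apply: Sy.
Qed.

(** The constant [K] found at [al] becomes [2 K] while [e^{i al}] moves by at most [1 / (2 K M)];
    compactness of [[-pi, pi]] makes it uniform. *)
Lemma uniform_lower_bound : exists2 K, 0 < K & forall al x, `|al| <= pi -> Q x = 0 ->
  nrm x <= K * nrm (x - cis (- al) *: T tau x).
Proof.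
have tau0' := ltW tau0.
have cpt : compact `[(- pi : R), pi] by exact: segment_compact.
move/compact_near_coveringP: cpt => /(_ R (pinfty_nbhs R) (fun K al => 0 < K /\ forall x, Q x = 0 ->
  nrm x <= K * nrm (x - cis (- al) *: T tau x))).
case=> [al|K [_ hK]].
  rewrite /= in_itv /= => hal.
  have [|K K0 hK] := @unit_lower_bound al; first by rewrite ler_norml.
  have e0 : 0 < (2 * K * M)^-1 by rewrite invr_gt0 !mulr_gt0.
  have [d d0 hd] := cexp_cont0 ('i * 1%:C) e0.
  exists ([set s | `|s - al| < d], [set K' | 2 * K < K']).
    split; first by exists d => //= s /=; rewrite distrC.
    by exists (2 * K); split => //; apply: num_real.
  move=> [s K'] [/= hs hK']; split; first by apply: lt_trans hK'; rewrite mulr_gt0.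
  move=> x Qx.
  have close : cabs (cis (- s) - cis (- al)) <= (2 * K * M)^-1.
    have -> : cis (- s) - cis (- al) = cis (- al) * (cis (al - s) - 1).
      by rewrite mulrBr mulr1 -cisD addrA addNr add0r.
    rewrite cabsM cabs_cis mul1r cabs_cis_norm -(mul1r `|al - s|) -cexp_imag distrC.
    exact: hd.
  have h1 := hK x Qx.
  have h2 : nrm (x - cis (- al) *: T tau x) <= nrm (x - cis (- s) *: T tau x) + (2 * K * M)^-1 * (M * nrm x).
    have -> : x - cis (- al) *: T tau x = (x - cis (- s) *: T tau x) + (cis (- s) - cis (- al)) *: T tau x by lmod.
    apply: le_trans (nrmD _ _) _; rewrite nrmZ lerD2l.
    by apply: ler_pM; rewrite ?cabs_ge0 ?nrm_ge0 //; apply: TM.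
  have h3 : (2 * K * M)^-1 * (M * nrm x) = nrm x / (2 * K) by field; rewrite !lt0r_neq0.
  rewrite h3 in h2.
  have h4 : K * nrm (x - cis (- al) *: T tau x) <= K * (nrm (x - cis (- s) *: T tau x) + nrm x / (2 * K)).
    by rewrite ler_pM2l.
  have h5 : K * (nrm x / (2 * K)) = nrm x / 2 by field; rewrite lt0r_neq0.
  rewrite mulrDr h5 in h4.
  have h6 : nrm x <= 2 * K * nrm (x - cis (- s) *: T tau x) by lra.
  by apply: le_trans h6 _; rewrite ler_wpM2r ?nrm_ge0 // ltW.
have K1 : K < `|K| + 1 by rewrite ltr_pwDr // ler_norm.
have h al : `|al| <= pi -> 0 < `|K| + 1 /\ forall x, Q x = 0 -> nrm x <= (`|K| + 1) * nrm (x - cis (- al) *: T tau x).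
  by move=> hal; apply: (hK (`|K| + 1)) => //=; rewrite in_itv /= -ler_norml.
exists (`|K| + 1); first by rewrite ltr_wpDl.
by move=> al x hal; have [_] := h al hal; apply.
Qed.

Lemma full_lower_bound : exists2 K, 0 < K & forall t x, Q x = 0 -> nrm x <= K * nrm (x - cis t *: T tau x).
Proof.
have [K K0 hK] := uniform_lower_bound; exists K => // t x Qx.
have [n hn] : exists n : int, `|t - n%:~R * (pi *+ 2)| <= pi.
  have p0 := pi_gt0 R; pose u := t / (pi *+ 2) + 2^-1.
  exists (Num.floor u); have /andP [] := floor_itv u; rewrite rmorphD /= => h1 h2.
  have tu : t = (u - 2^-1) * (pi *+ 2).
    by rewrite /u addrK divfK // lt0r_neq0 // pmulrn_lgt0.
  rewrite {1}tu -mulrBl normrM (ger0_norm (_ : 0 <= pi *+ 2)); last by rewrite ltW // pmulrn_lgt0.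
  have hu : `|u - 2^-1 - (Num.floor u)%:~R| <= 2^-1.
    by rewrite ler_norml; apply/andP; split; lra.
  have e : 2^-1 * (pi *+ 2) = pi :> R by rewrite -[pi *+ 2]mulr_natl mulKf.
  by rewrite -[leRHS]e ler_pM2r // pmulrn_lgt0.
have -> : cis t = cis (- (- (t - n%:~R * (pi *+ 2)))).
  rewrite opprK cisD; case: n {hn} => n.
    have := cisN (pi *+ 2 *+ n : R); rewrite cis_2pi mul1r -[pi *+ 2 *+ n]mulr_natl => ->.
    by rewrite mulr1.
  by rewrite NegzE rmorphN mulNr opprK /= mulr_natl cis_2pi mulr1.
by apply: hK; rewrite // normrN.
Qed.

(** The semigroup fixes [Q x], and [x - Q x] lies in the kernel of [Q], where the power of order
    [j.+1] decays like [1 / j.+2]. *)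
Lemma semigroup_converges : exists2 C, 0 <= C & forall j x, nrm (T (j.+1%:R * tau) x - Q x) <= C / j.+2%:R * nrm x.
Proof.
have [K K0 hK] := full_lower_bound; have tau0' := ltW tau0.
have it n x : iter n (T tau) x = T (n%:R * tau) x.
  elim: n => [|n IH]; first by rewrite mul0r; case: sg => _ -> _ _ _.
  by rewrite iterS IH -TD ?mulr_ge0 // -natr1 mulrDl mul1r addrC.
pose N := [set x | Q x = 0].
have dec j x : N x -> j.+1%:R * nrm (iter j (T tau) x) <= (K * (1 + M)) ^+ 2 * nrm x.
  apply: (iter_decay (N := N) (Tlin tau0')).
  - by move=> y hy; rewrite /N /= QT.
  - by move=> a y hy; rewrite /N /= (linZ Qlin) hy scaler0.
  - by move=> y z hy hz; rewrite /N /= (linD Qlin) hy hz addr0.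
  - by rewrite /N /= (lin0 Qlin).
  - by move=> n y; rewrite it; apply: TM; rewrite mulr_ge0.
  - exact: ltW.
  - exact: ltW.
  - by move=> t y; apply: hK.
exists ((K * (1 + M)) ^+ 2 * (1 + M)).
  by rewrite mulr_ge0 ?addr_ge0 ?(ltW M0) // exprn_ge0 // mulr_ge0 ?addr_ge0 ?ltW.
move=> j x; have jt : 0 <= j.+1%:R * tau by rewrite mulr_ge0.
have Nx : N (x - Q x) by rewrite /N /= (linB Qlin) QQ subrr.
have := dec j.+1 _ Nx; rewrite it (linB (Tlin jt)) TQ // => h.
rewrite mulrAC ler_pdivlMr ?ltr0n // mulrC; apply: le_trans h _.
rewrite -(mulrA _ (1 + M)); apply: ler_wpM2l; first by rewrite exprn_ge0 // mulr_ge0 ?addr_ge0 ?ltW.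
by apply: le_trans (nrmB _ _) _; rewrite mulrDl mul1r lerD2l; apply: QM.
Qed.

End Convergence.

(** * The two implications *)

Section Bounds.
Variables (R : realType) (V : completeNormedModType R[i]).
Implicit Types (x y z : V) (S T : R -> V -> V) (t s e w M : R).

Ltac lmod := lmod_with R[i] V ltac:(try ring).

Lemma opnorm_cvgP (I : Type) (F : set_system I) (FF : Filter F) (f : I -> V -> V) :
  (\forall i \near F, is_linear (f i)) ->
  ((fun i => opnorm (f i)) @ F --> (0 : \bar R)%E <->
   forall e, 0 < e -> \forall i \near F, opbound (f i) e).
Proof.
move=> lf; split=> [hf e e0|hf].
  have : \forall i \near F, (opnorm (f i) < e%:E)%E.
    by apply: (hf _ (open_ereal_lt' _)); rewrite lte_fin.
  by apply: filterS2 lf => i li /ltW /opnorm_le; apply=> //; apply: ltW.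
apply/fine_cvgP; split.
  apply: filterS2 lf (hf 1 ltr01) => i li /(opnorm_le (ltW ltr01) li) h.
  by rewrite ge0_fin_numE ?opnorm_ge0 // (le_lt_trans h) // ltry.
apply/cvgrPdist_le => e e0; apply: filterS2 lf (hf e e0) => i li /(opnorm_le (ltW e0) li) h.
have h0 := opnorm_ge0 li; rewrite /= sub0r normrN ger0_norm ?fine_ge0 // -lee_fin fineK //.
by rewrite ge0_fin_numE // (le_lt_trans h) // ltry.
Qed.

(** Every admissible growth exponent dominates the spectral bound, and boundedness makes [w]
    admissible. So norm continuity, stated with the growth bound, concerns the same rescaling as the
    other conditions. The value [+oo], which [fine] would send to [0], is excluded on the way. *)
Lemma bounded_bounds T w : lb_semigroup T ->
  (exists M, forall t, 0 <= t -> opbound (crescale T w%:C t) M) ->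
  (-oo < spectral_bound T)%E -> w = fine (spectral_bound T) ->
  spectral_bound T = w%:E /\ growth_bound T = w%:E.
Proof.
move=> sg [M hM] s_gt ws.
have lin t : 0 <= t -> is_linear (T t) by case: sg => + _ _ _ _; apply.
have adm u : (exists M', forall t, 0 <= t -> (opnorm (T t) <= (M' * expR (u * t))%:E)%E) ->
    (spectral_bound T <= u%:E)%E.
  move=> [M' hM']; apply: ge_ereal_sup => _ [l hl <-]; rewrite lee_fin leNgt; apply/negP => ul.
  apply: hl; apply: (@resolvent_set_growth _ _ T l M' u sg) => // t t0.
  apply/opnorm_le; [|exact: lin|exact: hM'].
  by rewrite -lee_fin; apply: le_trans (opnorm_ge0 (lin t t0)) (hM' t t0).
have aw : exists M', forall t, 0 <= t -> (opnorm (T t) <= (M' * expR (w * t))%:E)%E.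
  exists `|M| => t t0; apply/opnorm_le; [by rewrite mulr_ge0 ?expR_ge0|exact: lin|].
  move=> x; have := hM t t0 x; rewrite /crescale nrmZ cabs_cexp raddfN /= mulNr expRN mulrC.
  rewrite ler_pdivrMr ?expR_gt0 // => /le_trans; apply.
  by rewrite mulrAC !ler_wpM2r ?expR_ge0 ?nrm_ge0 ?ler_norm.
have sE : spectral_bound T = w%:E.
  rewrite ws fineK // fin_numE -ltNye s_gt /=.
  by have := adm w aw; case: (spectral_bound T).
split => //; apply/eqP; rewrite eq_le; apply/andP; split.
  by apply: ereal_inf_lbound; exists w.
by apply: le_ereal_inf_tmp => _ [u hu <-]; rewrite -sE; apply: adm.
Qed.

End Bounds.

Section Sufficiency.
Variables (R : realType) (V : completeNormedModType R[i]) (Er P : set V) (T : R -> V -> V).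
Implicit Types (x y z : V) (t e : R).
Hypotheses (lat : complex_banach_lattice Er P) (T_C0 : C0_semigroup T)
  (T_pos : unif_eventually_positive P T) (s_gt : (-oo < spectral_bound T)%E).

Let s := fine (spectral_bound T).
Let S := crescale T s%:C.

Let sgT : lb_semigroup T. Proof. exact: C0_lb. Qed.
Let sgS : lb_semigroup S. Proof. exact: crescale_lb. Qed.
Let S_lin t : 0 <= t -> is_linear (S t). Proof. by case: sgS => + _ _ _ _; apply. Qed.
Let SD t u x : 0 <= t -> 0 <= u -> S (t + u) x = S t (S u x).
Proof. by case: sgS => _ _ + _ _; apply. Qed.

Lemma balancing_sufficient : norm_continuous_at_infinity T ->
  bounded_semigroup (rescaled T s) -> pole_of_resolvent T s%:C -> unif_exp_balancing T.
Proof.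
rewrite /norm_continuous_at_infinity /unif_exp_balancing /bounded_semigroup !rescaledE -/S.
move=> [_ Tnc] [M' hM'] [_ [r [k [U [r0 [Ubd hU]]]]]].
pose M := Num.max 1 M'; have M1 : 1 <= M by rewrite le_max lexx.
have M0 : 0 < M by apply: lt_le_trans M1.
have SM t : 0 <= t -> opbound (S t) M.
  move=> t0; apply/opnorm_le; [exact: ltW|exact: S_lin|apply: le_trans (hM' t t0) _].
  by rewrite lee_fin le_max lexx orbT.
have [_ gb] : spectral_bound T = s%:E /\ growth_bound T = s%:E.
  by apply: bounded_bounds => //; exists M.
move: Tnc; rewrite gb /= -/S => Tnc.
(* Only real points in [(0, r)] matter; elsewhere the identity is a default value that makes the
   choice total. *)
have hex l : exists Rl, 0 < l -> l < r -> is_resolvent S l%:C Rl /\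
    forall e, 0 < e -> exists N, forall n, (N <= n)%N ->
     opbound (fun x => Rl x - \sum_(i < n) ((l ^+ i / l ^+ k)%:C *: U i x)) e.
  have [l0|l0] := leP l 0; first by exists id.
  have [lr|lr] := ltP l r; last by exists id.
  have dE : l%:C + s%:C - s%:C = l%:C by rewrite addrK.
  have nE : `|l%:C| = l%:C by rewrite cabsE cabs_real gtr0_norm.
  have [||Rl [hRl hc]] := hU (l%:C + s%:C).
  - by rewrite dE nE ltcR.
  - by rewrite dE nE ltcR.
  exists Rl => _ _; split; first exact/is_resolvent_crescale.
  have Rlin : is_linear Rl by case: hRl => -[].
  move: hc => /opnorm_cvgP hc e e0; have [|N _ hN] := hc _ e e0.
    apply: filterE => n a x y; rewrite Rlin scalerBr addrACA -opprD; congr (_ - _).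
    rewrite scaler_sumr -big_split /=; apply: eq_bigr => i _.
    by have [Ul _] := Ubd i; rewrite Ul scalerDr !scalerA mulrC.
  exists N => n /hN h x; have := h x; congr (nrm (_ - _) <= _); apply: eq_bigr => i _.
  rewrite dE expz_sub ?rmorphM ?fmorphV ?rmorphXn //.
  by rewrite -(rmorph0 (real_complex R)) (inj_eq (@complexI _)) lt0r_neq0.
have [F hF] := choice hex.
have F_res l : 0 < l -> l < r -> is_resolvent S l%:C (F l) by move=> l0 lr; case: (hF l l0 lr).
have [|l l0 lr|Q [Qlin [C' Qb] Flim]] := @laurent_limit _ _ r k U F (4 * M ^+ 2) r0 Ubd.
- by move=> l l0 lr; apply: (resolvent_bound sgS M1 SM l0); apply: F_res.
- by case: (hF l l0 lr).
(* Norm continuity at infinity yields a [d] that depends on the time. Boundedness carries the one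
   found at [t2] to all later times. *)
have ncS e : 0 < e -> exists t1 d, [/\ 0 <= t1, 0 < d & forall t u x, t1 <= t -> 0 <= u -> u < d ->
     nrm (S (t + u) x - S t x) <= e * nrm x].
  move=> e0; have [t1 ht1] := Tnc _ (divr_gt0 e0 M0).
  pose t2 := Num.max t1 0; have t20 : 0 <= t2 by rewrite le_max lexx orbT.
  have [|d [d0 hd]] := ht1 t2; first by rewrite le_max lexx.
  exists t2, d; split => // t u x tt u0 ud.
  have t2u : 0 <= t2 + u by rewrite addr_ge0.
  have tm : 0 <= t - t2 by rewrite subr_ge0.
  have -> : S (t + u) x - S t x = S (t - t2) (S (t2 + u) x - S t2 x).
    by rewrite (linB (S_lin tm)) -!SD // addrA subrK.
  apply: le_trans (SM _ tm _) _; rewrite -ler_pdivlMl // mulrA [_ * e]mulrC nrmBC.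
  have /opnorm_le : (opnorm (fun x => (S t2 x - S (t2 + u) x)%R) <= (e / M)%:E)%E.
    by apply: hd => //; rewrite ger0_norm.
  apply => //; first by rewrite divr_ge0 // ltW.
  by move=> a v w; rewrite (S_lin t20) (S_lin t2u) scalerBr opprD addrACA.
have [t0 [t00 Tp]] := T_pos.
have Sp t : t0 <= t -> positive_op P (S t).
  move=> tt x Px; rewrite /S /crescale -rmorphN cexp_real.
  by case: lat => _ _ [_ _ + _] _ _; apply; [exact: expR_ge0|apply: Tp].
have eps0 : 0 < (12 * M)^-1 by rewrite invr_gt0 mulr_gt0.
have [t1 [d [t10 d0 hd]]] := ncS _ eps0.
have tau0 : 0 < d / 2 by rewrite divr_gt0.
have [||C C0 hC] := @semigroup_converges _ _ _ _ _ Q _ _ lat sgS t00 Sp M1 SM Qlin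
  (residue_bound sgS M1 SM F_res Flim) (fun t x => residue_T sgS M1 SM F_res Flim x) (fun t x => T_residue sgS M1 SM F_res Flim x)
  (residue_idem sgS M1 SM F_res Flim) (mean_ergodic sgS M1 SM F_res Flim) ncS (d / 2) (12 * M)^-1 t1 tau0 eps0.
- by rewrite mulfV // lt0r_neq0 // mulr_gt0.
- by move=> t u x tt u0 ud; apply: hd => //; apply: le_lt_trans ud _; rewrite ltr_pdivrMr // mulr_natr mulr2n ltrDl.
split=> //; exists Q; split; first by split => //; exists C'.
apply/opnorm_cvgP.
  exists 0; split; [exact: num_real|move=> t /= /ltW t0' a x y].
  by rewrite (S_lin t0') Qlin scalerBr opprD addrACA.
(* This makes [M * C / j.+2 <= e]; the factor [M] pays for the passage from the grid time to a later
   [t]. *)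
move=> e e0; pose j := Num.truncn (M * C / e).
exists (j.+1%:R * (d / 2)); split; [exact: num_real|move=> t /= /ltW ht x].
have j0 : 0 <= j.+1%:R * (d / 2) by rewrite mulr_ge0 // ltW.
have tj : 0 <= t - j.+1%:R * (d / 2) by rewrite subr_ge0.
have -> : S t x - Q x = S (t - j.+1%:R * (d / 2)) (S (j.+1%:R * (d / 2)) x - Q x).
  by rewrite (linB (S_lin tj)) -SD // subrK (T_residue sgS M1 SM F_res Flim).
apply: le_trans (SM _ tj _) _; apply: (@le_trans _ _ (M * (C / j.+2%:R * nrm x))).
  by rewrite ler_pM2l.
rewrite !mulrA ler_wpM2r ?nrm_ge0 // ler_pdivrMr ?ltr0n // [leRHS]mulrC -(ler_pdivrMr _ _ e0).
by apply: le_trans (ltW (truncnS_gt _)) _; rewrite ler_nat.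
Qed.

End Sufficiency.

(** * Norm convergent semigroups *)

Section Convergent.
Variables (R : realType) (V : completeNormedModType R[i]) (S : R -> V -> V) (Q : V -> V).
Implicit Types (x y z : V) (t e : R) (m : R[i]).
Hypotheses (sg : lb_semigroup S) (Qbl : bdd_linear Q)
  (S_Q : forall e, 0 < e -> exists t0, forall t, t0 <= t -> opbound (fun x => S t x - Q x) e).

Ltac lmod := lmod_with R[i] V ltac:(try ring).

Let S_lin t : 0 <= t -> is_linear (S t). Proof. by case: sg => + _ _ _ _; apply. Qed.
Let SD t u x : 0 <= t -> 0 <= u -> S (t + u) x = S t (S u x).
Proof. by case: sg => _ _ + _ _; apply. Qed.
Let Q_lin : is_linear Q. Proof. by case: Qbl. Qed.

Lemma limit_time e : 0 < e -> exists2 t0, 0 < t0 & forall t, t0 <= t -> opbound (fun x => S t x - Q x) e.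
Proof.
move=> e0; have [t0 h] := S_Q e0; exists (Num.max 1 t0); first by rewrite lt_max ltr01.
by move=> t; rewrite ge_max => /andP [_ /h].
Qed.

Lemma convergent_bounded : exists2 M, 1 <= M & forall t, 0 <= t -> opbound (S t) M.
Proof.
have [t0 t00 h0] := limit_time ltr01; have [M M1 hM] := (let: And5 _ _ _ _ h := sg in h) t0.
have [C hC] := Qbl.2; exists (Num.max M (1 + C)); first by rewrite le_max M1.
move=> t tt; have [tl|tl] := leP t t0; first by apply: opbound_le (hM t tt tl); rewrite le_max lexx.
apply: (@opbound_le _ _ _ (1 + C)); first by rewrite le_max lexx orbT.
move=> x; apply: le_trans (nrm_sub_le _ (Q x)) _; rewrite mulrDl; apply: lerD; last exact: hC.
exact: h0 (ltW tl) x.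
Qed.

Let split_eps (a b e : R) : 0 <= a -> 0 <= b -> 0 < e -> a * (e / (a + b + 1)) + b * (e / (a + b + 1)) <= e.
Proof.
move=> a0 b0 e0; rewrite -mulrDl mulrA ler_pdivrMr ?ltr_wpDl ?addr_ge0 //.
by rewrite [e * _]mulrC ler_wpM2r ?lerDl // ltW.
Qed.

Lemma S_limit t x : 0 <= t -> S t (Q x) = Q x.
Proof.
move=> t0; have [M M1 hM] := convergent_bounded; have M0 : 0 <= M by apply: le_trans M1.
apply: eq_nrm_small => e e0.
have d0 : 0 < M * nrm x + nrm x + 1 by rewrite ltr_wpDl // addr_ge0 ?mulr_ge0 ?nrm_ge0.
have [r r0 hr] := limit_time (divr_gt0 e0 d0).
have r0' := ltW r0.
have -> : S t (Q x) - Q x = - S t (S r x - Q x) + (S (t + r) x - Q x).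
  by rewrite (linB (S_lin t0)) SD //; lmod.
apply: le_trans (split_eps (mulr_ge0 M0 (nrm_ge0 x)) (nrm_ge0 x) e0).
apply: le_trans (nrmD _ _) _; rewrite nrmN; apply: lerD.
  apply: le_trans (hM t t0 _) _; rewrite -mulrA; apply: ler_wpM2l => //.
  by rewrite mulrC; apply: hr.
by rewrite mulrC; apply: hr; rewrite lerDr.
Qed.

Lemma limit_S t x : 0 <= t -> Q (S t x) = Q x.
Proof.
move=> t0; have [M M1 hM] := convergent_bounded; have M0 : 0 <= M by apply: le_trans M1.
apply: eq_nrm_small => e e0.
have d0 : 0 < M * nrm x + nrm x + 1 by rewrite ltr_wpDl // addr_ge0 ?mulr_ge0 ?nrm_ge0.
have [r r0 hr] := limit_time (divr_gt0 e0 d0).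
have r0' := ltW r0.
have -> : Q (S t x) - Q x = - (S r (S t x) - Q (S t x)) + (S (r + t) x - Q x).
  by rewrite SD //; lmod.
apply: le_trans (split_eps (mulr_ge0 M0 (nrm_ge0 x)) (nrm_ge0 x) e0).
apply: le_trans (nrmD _ _) _; rewrite nrmN; apply: lerD.
  apply: le_trans (hr r (lexx _) _) _; rewrite mulrC.
  by apply: ler_wpM2r; [rewrite ltW // divr_gt0|apply: hM].
by rewrite mulrC; apply: hr; rewrite lerDl.
Qed.

Lemma limit_idem x : Q (Q x) = Q x.
Proof.
apply: eq_nrm_small => e e0; have d0 : 0 < nrm (Q x) + 1 by rewrite ltr_wpDl ?nrm_ge0.
have [r r0 hr] := limit_time (divr_gt0 e0 d0).
have := hr r (lexx _) (Q x); rewrite S_limit ?(ltW r0) // nrmBC => /le_trans; apply.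
by rewrite mulrAC ler_pdivrMr // ler_wpM2l ?lerDl // ltW.
Qed.

Lemma gen_limit x : gen S (Q x) 0.
Proof.
move=> e e0; exists 1 => // h h0 _.
by rewrite S_limit ?(ltW h0) // subrr scaler0 subr0 nrm0 ltW.
Qed.

Lemma limit_gen x y : gen S x y -> Q y = 0.
Proof.
move=> h; have [C hC] := Qbl.2; apply: (gen_unique (S := S) (x := Q x)); last exact: gen_limit.
by apply: (gen_map Q_lin hC) => // t t0; rewrite S_limit // limit_S.
Qed.

(* If [0] were a regular value, then [A Q = 0] would give [Q = 0]. *)
Lemma regular_contraction : resolvent_set S 0 -> exists2 L, 0 < L & opbound (S L) 2^-1.
Proof.
move=> [Rl [[Rlin _] _ h3]].
have Q0 x : Q x = 0.
  have /generatorP/h3 := gen_limit x.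
  by rewrite scale0r subr0 (lin0 Rlin).
have [|L L0 hL] := @limit_time 2^-1; first by rewrite invr_gt0.
by exists L => // x; have := hL L (lexx _) x; rewrite Q0 subr0.
Qed.

(* The generator is invertible on [ker Q], with inverse [- R0] for
   [R0 = integ S L (1 - Q) (1 - (S L - Q))^-1] and [S L - Q] a contraction. *)
Lemma reduced_resolvent : exists R0 : V -> V, [/\ bdd_linear R0,
  forall x, gen S (R0 x) (Q x - x), forall x y, gen S x y -> R0 y = Q x - x,
  forall x, Q (R0 x) = 0 & forall x, R0 (Q x) = 0].
Proof.
have half0 : 0 < 2^-1 :> R by rewrite invr_gt0.
have [L L0 hL] := limit_time half0; have L0' := ltW L0.
pose D x := S L x - Q x.
have Dlin : is_linear D.
  by move=> a x y; rewrite /D (S_lin L0') Q_lin scalerBr opprD addrACA.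
have DQ x : D (Q x) = 0 by rewrite /D S_limit // limit_idem subrr.
have QD x : Q (D x) = 0 by rewrite /D (linB Q_lin) limit_S // limit_idem subrr.
have [|G [Glin Gb GD DG _]] := neumann Dlin (hL L (lexx _)) (ltW half0).
  by rewrite invf_lt1 // ltr1n.
have GQ x : G (Q x) = Q x by have := DG (Q x); rewrite DQ subr0.
have QG x : Q (G x) = Q x by have := congr1 Q (GD x); rewrite (linB Q_lin) QD subr0.
have GS t x : 0 <= t -> G (S t x) = S t (G x).
  move=> t0; rewrite -(neumann_comm (S_lin t0) Glin GD DG) // => z.
  by rewrite /D (linB (S_lin t0)) S_limit // limit_S // -!SD // (addrC t).
have [C C0 hC] := integ_bdd sg L0'; have Jlin := integ_lin sg L0'.
have [q hq] := Qbl.2.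
exists (fun x => integ S L (G x - Q x)); split.
- split; first by move=> a x y; rewrite -Jlin; congr (integ S L _); rewrite Glin Q_lin; lmod.
  exists (C * ((1 - 2^-1)^-1 + q)) => x; apply: le_trans (hC _) _; rewrite -mulrA ler_wpM2l //.
  by apply: le_trans (nrmB _ _) _; rewrite mulrDl lerD.
- move=> x; have := gen_integ sg (G x - Q x) L0'; rewrite (linB (S_lin L0')) S_limit //.
  suff <- : Q x - x = S L (G x) - Q x - (G x - Q x) by [].
  by have := GD x; rewrite /D QG => h; rewrite -[X in _ - X = _]h; lmod.
- move=> x y hg; rewrite (limit_gen hg) subr0 -(integ_comm sg L0' Glin Gb) => [|u u0]; last exact: GS.
  rewrite (integ_gen sg L0' hg).
  have -> : S L x - x = Q x - (x - D x) by rewrite /D; lmod.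
  by rewrite (linB Glin) GQ DG.
- move=> x; rewrite (integ_comm sg L0' Q_lin hq) => [|u u0]; last by rewrite limit_S // S_limit.
  by rewrite (linB Q_lin) QG limit_idem subrr (lin0 Jlin).
- by move=> x; rewrite GQ limit_idem subrr (lin0 Jlin).
Qed.

Lemma simple_pole : exists r (U : nat -> V -> V), 0 < r /\ (forall n, bdd_linear (U n)) /\
  forall m, 0 < cabs m -> cabs m < r -> exists2 Rl, is_resolvent S m Rl &
    forall e, 0 < e -> exists N, forall n, (N <= n)%N ->
      opbound (fun x => Rl x - \sum_(i < n) (m ^ (i%:Z - 1%:Z)) *: U i x) e.
Proof.
have [R0 [[Rlin [c hc]] gR Rg QR RQ]] := reduced_resolvent.
pose C := `|c| + 1; have C0 : 0 < C by rewrite ltr_wpDl.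
have RC : opbound R0 C by apply: opbound_le hc; rewrite (le_trans (ler_norm _)) // lerDl.
have itlin n : is_linear (iter n R0).
  by elim: n => [|n IH] a x y //=; rewrite IH Rlin.
(* Index [0] belongs to the power [-1], so the coefficient of [m ^+ k] stands at index [k + 1].
   Within this radius [- m R0] has norm at most one half. *)
exists (2 * C)^-1, (fun n => if n is k.+1 then fun x => (-1) ^+ k *: iter k.+1 R0 x else Q).
have r0 : 0 < (2 * C)^-1 by rewrite invr_gt0 mulr_gt0.
split => //; split.
  case=> [|n]; first exact: Qbl.
  split; first by move=> a x y; rewrite itlin scalerDr !scalerA mulrC.
  exists (C ^+ n.+1) => x; rewrite nrmZ.
  have -> : cabs ((-1) ^+ n : R[i]) = 1 by apply: realc_inj; rewrite -cabsE normrX normrN1 expr1n.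
  rewrite mul1r; elim: n.+1 => [|k IH]; first by rewrite mul1r.
  rewrite iterS exprS -mulrA; apply: le_trans (RC _) _; apply: ler_wpM2l => //; exact: ltW.
move=> m m0 mr; have mC : cabs m * C <= 2^-1.
  by rewrite -ler_pdivlMr // -invfM ltW.
have mne : m != 0 by apply: contraTneq m0 => ->; rewrite /cabs normr0 ltxx.
pose E x := - m *: R0 x.
have Elin : is_linear E by move=> a x y; rewrite /E Rlin; lmod.
have Eb : opbound E 2^-1.
  move=> x; rewrite /E nrmZ cabsN; apply: le_trans (ler_wpM2r (nrm_ge0 x) mC).
  by rewrite -mulrA; apply: ler_wpM2l (RC x); apply: cabs_ge0.
have h20 : 0 <= 2^-1 :> R by rewrite invr_ge0.
have h21 : 2^-1 < 1 :> R by rewrite invf_lt1 // ltr1n.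
have [H [Hlin Hb HE EH Hsum]] := neumann Elin Eb h20 h21.
have HQ x : H (Q x) = Q x by have := EH (Q x); rewrite /E RQ scaler0 subr0.
have QH x : Q (H x) = Q x.
  by have := congr1 Q (HE x); rewrite /E (linB Q_lin) (linZ Q_lin) QR scaler0 subr0.
have RH x : R0 (H x) = H (R0 x).
  by apply: (neumann_comm Rlin Hlin HE EH) => z; rewrite /E (linZ Rlin).
have [q hq] := Qbl.2.
exists (fun x => m^-1 *: Q x + R0 (H x)).
  split.
  - split; first by move=> a x y; rewrite Q_lin Hlin Rlin; lmod.
    exists (cabs m^-1 * q + C * (1 - 2^-1)^-1) => x; apply: le_trans (nrmD _ _) _.
    rewrite nrmZ mulrDl -!mulrA; apply: lerD; first by apply: ler_wpM2l (hq x); apply: cabs_ge0.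
    by apply: le_trans (RC _) _; apply: ler_wpM2l (Hb x); apply: ltW.
  - move=> y; apply/generatorP.
    have -> : m *: (m^-1 *: Q y + R0 (H y)) - y = m^-1 *: 0 + (Q (H y) - H y).
      by rewrite scaler0 add0r scalerDr scalerA mulfV // scale1r -[X in _ - X = _](HE y) QH /E; lmod.
    exact: (gen_lin sg m^-1 (gen_limit y) (gR (H y))).
  - move=> x y /generatorP hg; rewrite (linB Q_lin) (linZ Q_lin) (limit_gen hg) subr0 scalerA mulVf // scale1r.
    rewrite RH (linB Rlin) (linZ Rlin) (Rg _ _ hg).
    have -> : m *: R0 x - (Q x - x) = (x - E x) - Q x by rewrite /E; lmod.
    by rewrite (linB Hlin) EH HQ addrC subrK.
move=> e e0; have : (fun n => C * ((2^-1 : R) ^+ n / (1 - 2^-1))) @ \oo --> (0 : R).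
  rewrite -(mulr0 C); apply: cvgMr; rewrite -(mul0r (1 - 2^-1)^-1); apply: cvgMl.
  by apply: cvg_expr; rewrite ger0_norm.
move/cvgrPdist_le => /(_ _ e0) [N _ hN]; exists N.+1 => -[//|n]; rewrite ltnS => Nn x.
rewrite big_ord_recl /= -exprN1 [_ - _](_ : _ = R0 (H x - \sum_(i < n) iter i E x)); last first.
  rewrite opprD addrACA subrr add0r (linB Rlin) (lin_sum Rlin); congr (_ - _).
  apply: eq_bigr => i _; rewrite expz_sub // /bump /= add1n exprS expr1 mulrAC mulfV // mul1r.
  rewrite scalerA -exprMn mulrN1.
  have -> : iter i E x = (- m) ^+ i *: iter i R0 x.
    by elim: (nat_of_ord i) => [|j IH]; rewrite ?scale1r //= IH /E (linZ Rlin) scalerA -exprS.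
  by rewrite (linZ Rlin).
apply: le_trans (RC _) _; rewrite nrmBC.
apply: (@le_trans _ _ (C * (2^-1 ^+ n / (1 - 2^-1) * nrm x))); first by rewrite ler_pM2l.
rewrite mulrA ler_wpM2r ?nrm_ge0 //; have := hN n Nn; rewrite /= sub0r normrN.
by apply: le_trans; apply: ler_norm.
Qed.

End Convergent.

Section Necessity.
Variables (R : realType) (V : completeNormedModType R[i]) (T : R -> V -> V).
Implicit Types (x y z : V) (t e : R).
Hypotheses (T_C0 : C0_semigroup T) (s_gt : (-oo < spectral_bound T)%E).

Let s := fine (spectral_bound T).
Let S := crescale T s%:C.

Let sgT : lb_semigroup T. Proof. exact: C0_lb. Qed.
Let sgS : lb_semigroup S. Proof. exact: crescale_lb. Qed.
Let S_lin t : 0 <= t -> is_linear (S t). Proof. by case: sgS => + _ _ _ _; apply. Qed.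

Lemma balancing_necessary : unif_exp_balancing T ->
  [/\ norm_continuous_at_infinity T, bounded_semigroup (rescaled T s) & pole_of_resolvent T s%:C].
Proof.
rewrite /norm_continuous_at_infinity /unif_exp_balancing /bounded_semigroup !rescaledE -/S.
move=> [_ [Q [Qbl S_cvg]]]; have [Qlin _] := Qbl.
have S_Q e : 0 < e -> exists t0, forall t, t0 <= t -> opbound (fun x => S t x - Q x) e.
  move=> e0; move: S_cvg => /opnorm_cvgP h; have [|t0 [_ ht0]] := h _ e e0.
    exists 0; split; [exact: num_real|move=> t /= /ltW t0 a x y].
    by rewrite (S_lin t0) Qlin scalerBr opprD addrACA.
  by exists (t0 + 1) => t tt; apply: ht0 => /=; apply: lt_le_trans tt; rewrite ltrDl.
have [M M1 SM] := convergent_bounded sgS Qbl S_Q; have M0 : 0 <= M by apply: le_trans M1.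
have [sE gb] : spectral_bound T = s%:E /\ growth_bound T = s%:E.
  by apply: bounded_bounds => //; exists M.
split.
- rewrite gb /= -/S; split; first exact: ltNyr.
  move=> e e0; have [t0 t00 ht0] := limit_time S_Q (divr_gt0 e0 (ltr0n _ 2)).
  (* For shifts below [1] both [t] and [t + u] stay beyond [t0]. *)
  exists (t0 + 1) => t tt; exists 1; split => // u; rewrite ltr_norml => /andP [u1 u2] tu.
  have t0' : 0 <= t by apply: le_trans tt; rewrite addr_ge0 // ltW.
  apply/opnorm_le => [||x]; first exact: ltW.
    by move=> a x y; rewrite (S_lin t0') (S_lin tu) scalerBr opprD addrACA.
  apply: le_trans (nrm_tri (Q x) _ _) _; rewrite (splitr e) mulrDl; apply: lerD.
    by apply: ht0; apply: le_trans tt; rewrite lerDl.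
  by rewrite nrmBC; apply: ht0; lra.
- by exists M => t t0; apply/opnorm_le; [|exact: S_lin|exact: SM].
split.
  move=> [Rl hRl]; have [L L0 hL] : exists2 L, 0 < L & opbound (S L) 2^-1.
    by apply: (regular_contraction sgS Qbl S_Q); exists Rl; apply/is_resolvent_crescale; rewrite add0r.
  (* To the right of [s - e] the factor gained in rescaling is at most [expR (1 / 4) <= 4 / 3], so
     the contraction constant [1 / 2] becomes at most [2 / 3] and the half plane is free of
     spectrum, which contradicts the spectral bound [s]. *)
  pose e := (4 * L)^-1; have e0 : 0 < e by rewrite invr_gt0 mulr_gt0.
  suff : (spectral_bound T <= (s - e)%:E)%E by rewrite sE lee_fin; lra.
  apply: ge_ereal_sup => _ [l hl <-]; rewrite lee_fin leNgt; apply/negP => sl; apply: hl.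
  apply: (@resolvent_set_contraction _ _ T l L (2 / 3) sgT L0) => [||x]; [lra|lra|].
  have := hL x; rewrite nrm_crescale expRN mulrC ler_pdivrMr ?expR_gt0 // => h.
  rewrite /crescale nrmZ cabs_cexp raddfN /= mulNr expRN mulrC ler_pdivrMr ?expR_gt0 //.
  apply: le_trans h _.
  have h1 : expR (s * L) * (3 / 4) <= expR (complex.Re l * L).
    have -> : complex.Re l * L = s * L + (complex.Re l - s) * L by rewrite mulrBl addrC subrK.
    rewrite expRD ler_pM2l ?expR_gt0 //; apply: le_trans (expR_ge1Dx _).
    have : - e * L <= (complex.Re l - s) * L by rewrite ler_pM2r //; lra.
    have -> : - e * L = - 4^-1 by rewrite /e; field; rewrite lt0r_neq0.
    by lra.
  have := ler_wpM2l (nrm_ge0 x) h1; clearbody s; lra.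
have [r [U [r0 [Ubd hU]]]] := simple_pole sgS Qbl S_Q.
exists r, 1%N, U; split => //; split => // l l0 lr.
have [||Rl hR hsum] := hU (l - s%:C).
- by rewrite -ltcR -cabsE.
- by rewrite -ltcR -cabsE.
exists Rl; split; first by have /is_resolvent_crescale := hR; rewrite subrK.
have Rlin : is_linear Rl by case: hR => -[].
apply/opnorm_cvgP; last by move=> e /hsum [N hN]; exists N.
apply: filterE => n a x y; rewrite Rlin scalerBr addrACA -opprD; congr (_ - _).
rewrite scaler_sumr -big_split /=; apply: eq_bigr => i _.
by have [Ul _] := Ubd i; rewrite Ul scalerDr !scalerA mulrC.
Qed.

End Necessity.

Theorem theorem5p1 (R : realType) (V : completeNormedModType R[i])
  (Er P : set V) (T : R -> V -> V) :
  complex_banach_lattice Er P ->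
  C0_semigroup T ->
  unif_eventually_positive P T ->
  (-oo < spectral_bound T)%E ->
  (unif_exp_balancing T <->
   [/\ norm_continuous_at_infinity T,
       bounded_semigroup (rescaled T (fine (spectral_bound T))) &
       pole_of_resolvent T ((fine (spectral_bound T))%:C)%C]).
Proof.
move=> lat T_C0 T_pos s_gt; split; first exact: balancing_necessary.
by case; apply: (balancing_sufficient lat).
Qed.
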